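(* Assume $p_1>p_0=0$ (with $p_1<1$). Let $A\in\mathcal A$ be nonempty with $\nu(A)>0$ and let $p\in(\nu(A),1)$. If $I_A(p)=\infty$ and the function $J_A(\cdot)$ is continuous at $p$, then $$\lim_{n\to\infty}\frac1n\log\mathbb P\left(\bar Z_n(\sqrt nA)\ge p\right)=(\log p_1)\,J_A(p).$$
   Context: Branching random walk: let $\mathcal T$ be a Galton-Watson tree with root $\rho$ and offspring distribution $\{p_k\}_{k\ge0}$. Given $\mathcal T$, attach to the vertices $v\in\mathcal T\setminus\{\rho\}$ i.i.d. real random variables $X_v$ distributed as a random variable $X$ (the step size), and set $S_\rho=0$ and $S_v=\sum_{\rho\prec u\preceq v}X_u$, where $u\preceq v$ means that $u$ is an ancestor of $v$ or $u=v$. Let $|v|$ be the generation of $v$ (its graph distance to $\rho$), $Z_n(\cdot)=\sum_{v\in\mathcal T,|v|=n}1_{\{S_v\in\cdot\}}$ and $\bar Z_n(\cdot)=Z_n(\cdot)/Z_n(\mathbb R)$. Standing assumptions: $p_0=0$, $p_1<1$; $\sum_k p_k e^{\theta k}<\infty$ for some $\theta>0$; $X$ is symmetric (i.e. $X$ and $-X$ have the same law) with $E[X^2]=1$. Notation: $\nu$ is the standard Gaussian measure on $\mathbb R$; $\mathcal A$ is the algebra of subsets of $\mathbb R$ generated by $\{(-\infty,x]:x\in\mathbb R\}$; for $c,x\in\mathbb R$, $cA=\{cy:y\in A\}$ and $A-x=\{y-x:y\in A\}$. For $p\in(\nu(A),1)$, $$I_A(p)=\inf\{|x|:\nu(A-x)\ge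 p\}\in[0,\infty],\qquad \inf\emptyset=\infty,$$ $$J_A(p)=\inf\Big\{y\in[0,1):\ \sup_{x\in\mathbb R}\nu\big((A-x)/\sqrt{1-y}\big)\ge p\Big\}.$$ *)

(* Defs.v *)
From mathcomp Require Export all_boot all_order all_algebra finmap.
From mathcomp Require Export all_classical all_reals all_analysis.

Set Implicit Arguments.
Unset Strict Implicit.
Unset Printing Implicit Defensive.

Import Order.TTheory GRing.Theory Num.Theory.
Import numFieldNormedType.Exports.

Local Open Scope classical_set_scope.
Local Open Scope ring_scope.

Definition mutually_independent d (Omega : measurableType d) (R : realType)
    (P : probability Omega R) (I : choiceType) (D : set I)
    (F : I -> set (set Omega)) : Prop :=
  forall (J : {fset I}) (E : I -> set Omega),
    (forall i, i \in J -> D i /\ F i (E i)) ->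
    P (\bigcap_(i in [set` J]) E i) = (\prod_(i <- J) P (E i))%E.

Definition sigma_of d d' (Omega : measurableType d) (T : measurableType d')
    (f : Omega -> T) : set (set Omega) :=
  preimage_set_system setT f measurable.

(* Ulam-Harris labelling: a vertex is the word of child indices leading to it
   from the root [::], and the children of [v] are [rcons v i], [i < N v].
   The variables [N v] and [X v] are given for all words; only those with [v]
   in the tree matter. *)
Definition vertex := seq nat.

Record branching_random_walk d (Omega : measurableType d) (R : realType)
    (P : probability Omega R)
    d' (Omega' : measurableType d') (Q : probability Omega' R)
    (p : nat -> R) (xi : {RV Q >-> R})
    (N : vertex -> {RV P >-> nat}) (X : vertex -> {RV P >-> R}) : Prop := {
  brw_offspring_law : forall v k, P (N v @^-1` [set k]) = (p k)%:E;
  brw_step_law : forall v, v <> [::] -> forall B, measurable B ->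
    P (X v @^-1` B) = Q (xi @^-1` B);
  (* No condition is put on [X [::]], since the root carries no step. *)
  brw_independent : mutually_independent P
    [set i : vertex + vertex | i <> inr [::]]
    (fun i => match i with
              | inl v => sigma_of (N v)
              | inr v => sigma_of (X v)
              end)
}.

Definition symmetric_rv d (Omega : measurableType d) (R : realType)
    (P : probability Omega R) (X : {RV P >-> R}) : Prop :=
  forall B, measurable B ->
    P (X @^-1` B) = P ((fun w => - X w) @^-1` B).

Definition tree (Omega : Type) (N : vertex -> Omega -> nat) (w : Omega) :
    set vertex :=
  [set v | forall k, (k < size v)%N -> (nth 0%N v k < N (take k v) w)%N].

(* The vertices u with [::] < u <= v are the nonempty prefixes of v. *)
Definition position (Omega : Type) (R : realType)
    (X : vertex -> Omega -> R) (v : vertex) (w : Omega) : R :=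
  \sum_(1 <= k < (size v).+1) X (take k v) w.

Definition Zn (Omega : Type) (R : realType) (N : vertex -> Omega -> nat)
    (X : vertex -> Omega -> R) (n : nat) (B : set R) (w : Omega) : R :=
  \sum_(v \in [set v | tree N w v /\ size v = n]) (\1_B (position X v w) : R).

Definition Zbar (Omega : Type) (R : realType) (N : vertex -> Omega -> nat)
    (X : vertex -> Omega -> R) (n : nat) (B : set R) (w : Omega) : R :=
  Zn N X n B w / Zn N X n setT w.

Definition set_algebra (T : Type) (G : set (set T)) : Prop :=
  [/\ G setT, setC_closed G & setU_closed G].

Definition ray_algebra (R : realType) : set (set R) :=
  smallest (@set_algebra R) [set `]-oo, x]%classic | x in [set: R]].

Definition nu (R : realType) : set R -> \bar R := normal_prob 0 1.

Definition scale_set (R : realType) (c : R) (A : set R) : set R :=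
  [set c * a | a in A].

Definition shift_set (R : realType) (A : set R) (x : R) : set R :=
  [set a - x | a in A].

Definition rateI (R : realType) (A : set R) (p : R) : \bar R :=
  ereal_inf [set `|x|%:E | x in [set x | (p%:E <= nu (shift_set A x))%E]].

(* The infimum is taken in the reals: for p < 1 and A nonempty in the algebra,
   A contains an interval and the set below is nonempty. *)
Definition rateJ (R : realType) (A : set R) (p : R) : R :=
  inf [set y | 0 <= y < 1 /\
    (p%:E <= ereal_sup
      [set nu (scale_set (Num.sqrt (1 - y))^-1 (shift_set A x))
         | x in [set: R]])%E].

(* Main.v *)
From HB Require Import structures.
Require Import Defs.
From mathcomp Require Import measurable_realfun.
From mathcomp Require Import ring lra.

(** The event that the proportion [Zbar] of generation [n] in [sqrt n * A] is at
    least [p] says that the sum of [b = \1_(sqrt n * A) - p] over the positions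
    of generation [n] is nonnegative. Such level sums are studied through the
    operator [T g x = E (g (x + X))], which gives the mean of a function after
    one step.

    The cheapest way to make the level sum nonnegative is to suppress branching:
    each of the first [m] generations has a single individual, which costs
    [pk 1 ^ m], and the single line of descent is then free to stand wherever the
    random walk can take it, say at [x * sqrt n]. From there on the population
    grows and obeys a law of large numbers: after [k = n - m] more generations the
    proportion is close to the probability that [x * sqrt n] plus [k] steps falls
    in [sqrt n * A], that is to [nu ((A - x) / sqrt (1 - m / n))] by the central
    limit theorem. [rateJ A p] is the least fraction [m / n] for which some [x]
    makes this at least [p]. As [rateI A p] is infinite, no [x] does so for
    [m = 0]; hence the fraction is positive and the position [x * sqrt n] can be
    reached at no exponential cost.

    Upper bound ([upper_tail], [prob_upper]). If [m / n] stays below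
    [rateJ A p'] for some [p' < p], then [T^k b <= - eta] everywhere. The
    exponential of a level sum is estimated by [supersolution_bound], which needs
    only functions [U j] of the position that decrease under one generation of
    branching and moving, [j] being the number of generations left. For
    [j <= k] one takes [U j] close to [exp (l_j T^j b)] with [l_j] proportional
    to the [j]-th power of the mean offspring number [mu]: the sum over
    the children multiplies the exponent by about [mu], and the quadratic errors
    add up to a constant because [l_j] is geometric. With [l_k] small but fixed
    this gives [U k <= s0 < 1]. For the [m] first generations the constants
    [U j] obtained from [s0] by iterating [s |-> pk 1 s + (1 - pk 1) s^2] do: this
    polynomial dominates the offspring generating function, and its iterates
    decrease like [pk 1 ^ m].

    Lower bound ([lower_tail], [prob_lower]). [spine_bound] follows the line of
    descent of an ancestor with one child in each of [m] generations. With a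
    probability bounded below this line ends in a window of width of order
    [sqrt n] around [x * sqrt n], on which [T^k b >= eta]; the estimate above, for
    [- b], then bounds the probability of a nonpositive level sum by [s0 < 1].

    Since [rateJ A] is continuous at [p], the parameters [p'] below and above [p]
    give the same rate.

    The central limit theorem is needed uniformly in the starting point, under a
    second moment only. [clt_iter_average] proves it by replacing the steps one
    by one by Gaussian ones, testing against a logistic function instead of the
    indicator of a half-line; a set of the algebra is then handled by writing
    its indicator as a linear combination of indicators of half-lines
    ([ray_algebra_rep]). *)

Set Implicit Arguments.
Unset Strict Implicit.
Unset Printing Implicit Defensive.

Import Order.TTheory GRing.Theory Num.Theory.
Import numFieldNormedType.Exports.

Local Open Scope classical_set_scope.
Local Open Scope ring_scope.

(** * Independence of families of sigma-algebras *)

Section independence.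
Local Open Scope ereal_scope.
Context d (Omega : measurableType d) (R : realType) (P : probability Omega R).

(** Conditioning on [Z]: the joint law of [(Z, Y)] is the product of the two laws, and
    the product integral is computed by Tonelli. *)
Lemma ge0_integral_independent d1 d2 (T1 : measurableType d1)
    (T2 : measurableType d2) (Z : Omega -> T1) (Y : Omega -> T2)
    (mZ : measurable_fun setT Z) (mY : measurable_fun setT Y)
    (indep : forall A B, measurable A -> measurable B ->
      P (Z @^-1` A `&` Y @^-1` B) = P (Z @^-1` A) * P (Y @^-1` B))
    (F : T1 * T2 -> \bar R) (mF : measurable_fun [set: T1 * T2] F)
    (F0 : forall z, 0 <= F z) :
  \int[P]_w F (Z w, Y w) = \int[P]_w \int[P]_w' F (Z w, Y w').
Proof.
pose Z' : {RV P >-> T1} := HB.pack Z (isMeasurableFun.Build _ _ _ _ _ mZ).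
pose Y' : {RV P >-> T2} := HB.pack Y (isMeasurableFun.Build _ _ _ _ _ mY).
have mZY : measurable_fun setT (fun w => (Z w, Y w)).
  exact: measurable_fun_pair.
pose ZY : {RV P >-> (T1 * T2)%type} :=
  HB.pack (fun w => (Z w, Y w)) (isMeasurableFun.Build _ _ _ _ _ mZY).
rewrite -[LHS](@ge0_integral_distribution _ _ _ _ _ P ZY)//.
rewrite (eq_measure_integral (distribution P Z' \x distribution P Y')); last first.
  by move=> A mA _; apply/esym/product_measure_unique => // B C mB mC; exact: indep.
rewrite fubini_tonelli1//= (@ge0_integral_distribution _ _ _ _ _ P Z')/=; last 2 first.
- exact: measurable_fun_fubini_tonelli_F.
- by move=> y; apply: integral_ge0.
apply: eq_integral => w _.
rewrite /= /fubini_F (@ge0_integral_distribution _ _ _ _ _ P Y')//=.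
exact: measurableT_comp.
Qed.

End independence.

Section adapted.
Context d (Omega : measurableType d) (R : realType) (I : Type)
  (gen : I -> set (set Omega)).

(** Only the sigma-algebra generated by [info J] matters: it is what is known
    when the variables of index in [J] are observed. *)
Definition info (J : set I) : set (set Omega) := \bigcup_(i in J) gen i.

Definition adapted (J : set I) d' (T : measurableType d') (f : Omega -> T) :=
  measurable_fun [set: g_sigma_algebraType (info J)] f.

Lemma adaptedS J J' d' (T : measurableType d') (f : Omega -> T) :
  J `<=` J' -> adapted J f -> adapted J' f.
Proof.
move=> JJ' Jf _ B mB.
have sJJ' : <<s info J >> `<=` <<s info J' >>.
  apply: smallest_sub; first exact: smallest_sigma_algebra.
  by move=> A [i Ji giA]; apply: sub_sigma_algebra; exists i => //; exact: JJ'.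
apply: (sJJ' (setT `&` f @^-1` B)); exact: (Jf measurableT B mB).
Qed.

Lemma adapted_measurable J d' (T : measurableType d') (f : Omega -> T) :
  (forall i, gen i `<=` measurable) -> adapted J f -> measurable_fun setT f.
Proof.
move=> gm Jf _ B mB.
have sJ : <<s info J >> `<=` @measurable _ Omega.
  apply: smallest_sub; first exact: sigma_algebra_measurable.
  by move=> A [i _ /gm].
apply: (sJ (setT `&` f @^-1` B)); exact: (Jf measurableT B mB).
Qed.

Lemma adapted_gen J i d' (T : measurableType d') (f : Omega -> T) : J i ->
  gen i = sigma_of f -> adapted J f.
Proof.
move=> Ji gi _ B mB; apply: sub_sigma_algebra; exists i => //.
by rewrite gi; exists B.
Qed.

Lemma adapted_cst J d' (T : measurableType d') (t : T) : adapted J (fun=> t).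
Proof. exact: measurable_cst. Qed.

End adapted.

Section blocks.
Local Open Scope ereal_scope.
Context d (Omega : measurableType d) (R : realType) (P : probability Omega R).
Context (I : choiceType) (D : set I) (gen : I -> set (set Omega)).
Hypothesis gen_measurable : forall i, gen i `<=` measurable.
Hypothesis genT : forall i, gen i setT.
Hypothesis genI : forall i, setI_closed (gen i).
Hypothesis gen_indep : mutually_independent P D gen.

(** Finite intersections of events of [J] form a pi-system on which
    [G |-> P (G `&` E)] and [G |-> P G * P E] agree by mutual independence; two
    finite measures that agree on a pi-system agree on the sigma-algebra it
    generates. *)
Lemma mutually_independent_one (i : I) (J : set I) (E G : set Omega) :
  D i -> J `<=` D -> ~ J i -> gen i E -> <<s info gen J >> G ->
  P (G `&` E) = P G * P E.
Proof.
move=> Di JD nJi giE.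
have mE : measurable E by exact: gen_measurable giE.
pose C := [set G | exists (F : {fset I}) (e : I -> set Omega),
  (forall j, j \in F -> J j /\ gen j (e j)) /\ G = \bigcap_(j in [set` F]) e j].
have Cm : C `<=` measurable.
  move=> _ [F [e [Fe ->]]]; apply: fin_bigcap_measurable => // j /= jF.
  by apply: gen_measurable; exact: (Fe j jF).2.
have CI : setI_closed C.
  move=> _ _ [F1 [e1 [Fe1 ->]]] [F2 [e2 [Fe2 ->]]].
  pose e j := (if j \in F1 then e1 j else setT) `&`
              (if j \in F2 then e2 j else setT).
  exists (F1 `|` F2)%fset, e; split.
    move=> j; rewrite inE => jF; split.
      by case/orP : jF => [/Fe1[]|/Fe2[]].
    by apply: genI; case: ifPn => // h; [exact: (Fe1 j h).2|exact: (Fe2 j h).2].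
  apply/seteqP; split=> [w [h1 h2] j /= jF|w h].
    by split; case: ifPn => // h; [exact: h1|exact: h2].
  split=> j /= jF; have := h j; rewrite /= inE jF ?orbT => /(_ isT) [].
    by rewrite jF.
  by rewrite jF.
have sC : <<s info gen J >> `<=` <<s C >>.
  apply: smallest_sub; first exact: smallest_sigma_algebra.
  move=> A [j Jj gA]; apply: sub_sigma_algebra; exists [fset j]%fset, (fun=> A).
  split; first by move=> k; rewrite inE => /eqP ->.
  by rewrite set_fset1 bigcap_set1.
move=> /sC sG.
have fE : P E \is a fin_num by exact: fin_num_measure.
pose pE : {nonneg R} := NngNum (fine_ge0 (measure_ge0 P E)).
have pEE A : mscale pE P A = P A * P E by rewrite /mscale /= fineK// muleC.
rewrite -pEE -[LHS]/(mrestr P mE G).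
apply: (@g_sigma_algebra_measure_unique _ _ _ C Cm (fun=> setT)) => //.
- move=> _; exists fset0, (fun=> setT); split => //.
  by rewrite set_fset0 bigcap_set0.
- by apply/seteqP; split => // w _; exists 0%N.
- move=> _ [F [e [Fe ->]]]; apply: etrans _ (esym (pEE _)); rewrite /mrestr.
  pose e' j := if j == i then E else e j.
  have iF : i \notin F by apply/negP => /Fe[].
  have e'E j : j \in F -> e' j = e j.
    by move=> jF; rewrite /e' ifN//; apply: contraNneq iF => <-.
  have FE : P (\bigcap_(j in [set` F]) e j) = \prod_(j <- F) P (e j).
    by apply: gen_indep => j /Fe[/JD].
  have := @gen_indep (i |` F)%fset e' _.
  rewrite set_fsetU1 bigcap_setU1 setIC.
  rewrite [e' i]/e' eqxx (_ : \bigcap_(j in [set` F]) e' j = \bigcap_(j in [set` F]) e j); last first.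
    by apply: eq_bigcapr => j /= /e'E.
  move=> FiE; apply: etrans (FiE _) _.
    move=> j; rewrite !inE => /orP[/eqP ->|jF]; first by rewrite /e' eqxx.
    by rewrite e'E//; have [/JD] := Fe _ jF.
  rewrite FE big_fsetU1//= {1}/e' eqxx muleC; congr (_ * _).
  rewrite [LHS]big_seq_cond [RHS]big_seq_cond; apply: eq_bigr => j /andP[jF _].
  by rewrite e'E.
- by move=> _; apply: le_lt_trans (probability_le1 P _) (ltry _); rewrite setTI.
Qed.
End blocks.

(** * Level sums and one generation of branching *)

Lemma measurable_fun_nat_case d d' (T : measurableType d)
    (T' : measurableType d') (n : T -> nat) (f : nat -> T -> T') :
  measurable_fun setT n -> (forall k, measurable_fun setT (f k)) ->
  measurable_fun setT (fun w => f (n w) w).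
Proof.
move=> mn mf.
have nT : [set: T] = \bigcup_k (n @^-1` [set k]).
  by apply/seteqP; split => // w _; exists (n w).
rewrite nT; apply/measurable_fun_bigcup => k.
- by rewrite -[X in measurable X]setTI; exact: mn.
- apply: (eq_measurable_fun (f k)); first by move=> w; rewrite inE /= => ->.
  exact: measurable_funTS.
Qed.

Lemma eseries_pick (R : realType) (n : nat) (f : nat -> R) :
  (\sum_(k <oo) ((n == k)%:R * f k)%:E = (f n)%:E)%E.
Proof.
apply/cvg_lim => //; apply: cvg_near_cst; exists n.+1 => // m /= nm.
rewrite big_mkord (bigD1 (Ordinal nm))//= eqxx mul1r big1 ?adde0// => i ni.
by rewrite eq_sym -[X in _ == X]/(val (Ordinal nm)) val_eqE (negbTE ni) mul0r.
Qed.

(** Stated for the extended real integral, since [U] may be unbounded. *)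
Lemma measurable_average d (Omega : measurableType d) (R : realType)
    (Q : probability Omega R) (xi : {RV Q >-> R}) (U : R -> R) :
  measurable_fun setT U -> (forall x, 0 <= U x) ->
  measurable_fun setT (fun x : R => \int[Q]_w (U (x + xi w))%:E)%E.
Proof.
move=> mU U0.
apply: (@measurable_fun_fubini_tonelli_F _ _ _ _ _ Q
  (fun z : R * Omega => (U (z.1 + xi z.2))%:E)) => /=.
  apply/measurable_EFinP; apply: measurableT_comp => //.
  by apply: measurable_funD => //; exact: measurableT_comp.
by move=> x; rewrite lee_fin.
Qed.

Section level_sum.
Context (Omega : Type) (R : realType) (N : vertex -> Omega -> nat)
  (X : vertex -> Omega -> R) (b : R -> R).

(** The recursion goes from the root downwards, so that conditioning on the first
    generation is one unfolding. The position [x] of [a] is an argument because it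
    is random when [a] is not the root. *)
Fixpoint level_sum (j : nat) (a : vertex) (x : R) (w : Omega) : R :=
  if j is j'.+1 then
    \sum_(i < N a w) level_sum j' (rcons a i) (x + X (rcons a i) w) w
  else b x.

End level_sum.

Lemma level_sumN (Omega : Type) (R : realType) (N : vertex -> Omega -> nat)
    (X : vertex -> Omega -> R) (b : R -> R) j a x w :
  level_sum N X (fun x => - b x) j a x w = - level_sum N X b j a x w.
Proof.
elim: j a x => [//|j IH] a x /=.
by rewrite -sumrN; apply: eq_bigr => i _; exact: IH.
Qed.

(** The labels on which the level sums below [a] depend once the position of
    [a] is given: the step that leads to [a] is excluded. *)
Definition descendants (a : vertex) : set (vertex + vertex) :=
  [set i | match i with
           | inl v => prefix a v
           | inr v => prefix a v && (v != a)
           end].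

Definition root_step : vertex + vertex := inr [::].

(** The step of the root carries no law and takes no part in the independence,
    so it is removed. *)
Definition outside (a : vertex) : set (vertex + vertex) :=
  [set i | i <> root_step] `\` descendants a.

Lemma prefix_rconsl (a v : vertex) i : prefix (rcons a i) v -> prefix a v.
Proof. by apply: prefix_trans; exact: prefix_rcons. Qed.

Lemma prefix_rcons_self (a : vertex) i : prefix (rcons a i) a = false.
Proof. by apply/negbTE/negP => /size_prefix; rewrite size_rcons ltnn. Qed.

Lemma prefix_rcons_inj (a v : vertex) i j :
  prefix (rcons a i) v -> prefix (rcons a j) v -> i = j.
Proof.
case/prefixP => s1 -> /prefixP[s2] /eqP.
by rewrite !cat_rcons eqseq_cat// eqxx /= => /eqP[].
Qed.

Section label_events.
Context d (Omega : measurableType d) (R : realType) (P : probability Omega R)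
  (N : vertex -> {RV P >-> nat}) (X : vertex -> {RV P >-> R}).

Definition label_events (i : vertex + vertex) : set (set Omega) :=
  match i with inl v => sigma_of (N v) | inr v => sigma_of (X v) end.

Local Notation gen := label_events.
Local Notation adap := (adapted gen).

Lemma label_events_measurable i : gen i `<=` measurable.
Proof. case: i => v _ [B mB <-].
- exact: (measurable_funP (N v)).
- exact: (measurable_funP (X v)).
Qed.

Lemma label_eventsT i : gen i setT.
Proof. by case: i => v; exists setT => //; rewrite setTI preimage_setT. Qed.

Lemma label_eventsI i : setI_closed (gen i).
Proof.
case: i => v _ _ [B mB <-] [C mC <-]; exists (B `&` C).
- exact: measurableI.
- by rewrite !setTI preimage_setI.
- exact: measurableI.
- by rewrite !setTI preimage_setI.
Qed.

Lemma label_adapted_measurable J d' (T : measurableType d') (f : Omega -> T) :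
  adap J f -> measurable_fun setT f.
Proof. exact: (adapted_measurable label_events_measurable). Qed.

Lemma adapted_step J v : J (inr v) -> adap J (X v).
Proof. by move=> Jv; exact: adapted_gen Jv _. Qed.

Lemma adapted_offspring J v : J (inl v) -> adap J (N v).
Proof. by move=> Jv; exact: adapted_gen Jv _. Qed.

Lemma adapted_level_sum (b : R -> R) (mb : measurable_fun setT b) j :
  forall a J (x : Omega -> R), descendants a `<=` J -> adap J x ->
  adap J (fun w => level_sum N X b j a (x w) w).
Proof.
elim: j => [|j IH] a J x aJ ax /=; first exact: measurableT_comp.
apply: (@measurable_fun_nat_case _ _ (g_sigma_algebraType (info gen J)) _
  (N a : g_sigma_algebraType (info gen J) -> nat)
  (fun k w => \sum_(i < k) level_sum N X b j (rcons a i) (x w + X (rcons a i) w) w)).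
  by apply: adapted_offspring; apply: aJ; rewrite /= prefix_refl.
move=> k; apply: measurable_sum => i; apply: IH.
  apply: subset_trans aJ => -[v|v] /=; first exact: prefix_rconsl.
  case/andP => av va; rewrite (prefix_rconsl av) /=.
  by apply: contraTneq av => ->; rewrite prefix_rcons_self.
apply: measurable_funD => //; apply: adapted_step; apply: aJ => /=.
rewrite prefix_rcons /=; apply/eqP => /(congr1 size)/eqP.
by rewrite size_rcons -addn1 -[X in _ == X]addn0 eqn_add2l.
Qed.

Lemma measurable_level_sum (b : R -> R) j a (z : Omega -> R) :
  measurable_fun setT b -> adap (outside a) z ->
  measurable_fun setT (fun w => level_sum N X b j a (z w) w).
Proof.
move=> mb az; apply: (label_adapted_measurable (J := setT)).
by apply: (adapted_level_sum mb) => //; exact: adaptedS az.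
Qed.

Lemma measurable_root_level_sum (b : R -> R) j : measurable_fun setT b ->
  measurable_fun setT (fun w => level_sum N X b j [::] 0 w).
Proof.
by move=> mb; apply: (@measurable_level_sum b j [::] (cst 0)) => //; exact: adapted_cst.
Qed.

End label_events.

Section branching.
Context d (Omega : measurableType d) (R : realType) (P : probability Omega R)
  d' (Omega' : measurableType d') (Q : probability Omega' R)
  (pk : nat -> R) (xi : {RV Q >-> R})
  (N : vertex -> {RV P >-> nat}) (X : vertex -> {RV P >-> R}).
Hypothesis brw : branching_random_walk pk xi N X.

Local Notation gen := (label_events N X).
Local Notation adap := (adapted gen).
Local Notation lsum := (level_sum N X).

Let adapted_indep J d1 (T1 : measurableType d1) (Z : Omega -> T1) i
    d2 (T2 : measurableType d2) (Y : Omega -> T2) :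
  gen i = sigma_of Y -> i <> root_step -> J `<=` [set t | t <> root_step] ->
  ~ J i -> adap J Z -> measurable_fun setT Y -> forall A B,
  measurable A -> measurable B ->
  (P (Z @^-1` A `&` Y @^-1` B) = P (Z @^-1` A) * P (Y @^-1` B))%E.
Proof.
move=> giY iD JD nJi aZ mY A B mA mB.
apply: (@mutually_independent_one _ _ _ _ _ [set t | t <> root_step] gen
  (@label_events_measurable _ _ _ _ N X) (@label_eventsT _ _ _ _ N X)
  (@label_eventsI _ _ _ _ N X) (brw_independent brw) i J) => //.
- by rewrite giY; exists B => //; rewrite setTI.
- by have := aZ measurableT A mA; rewrite setTI.
Qed.

(** Integrating out the step of [v], independent of what [J] tells. *)
Let integral_step (U : R -> R) (mU : measurable_fun setT U)
    (U0 : forall x, 0 <= U x) v J (Phi zeta : Omega -> R) :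
  v <> [::] -> J `<=` [set t | t <> root_step] -> ~ J (inr v) ->
  adap J Phi -> adap J zeta -> (forall w, 0 <= Phi w) ->
  (\int[P]_w (Phi w * U (zeta w + X v w))%:E =
   \int[P]_w ((Phi w)%:E * \int[Q]_w' (U (zeta w + xi w'))%:E))%E.
Proof.
move=> v0 JD nJv aP az P0.
pose F := fun z : (R * R) * R => (`|z.1.1| * U (z.1.2 + z.2))%:E.
have mF : measurable_fun [set: (R * R) * R] F.
  apply/measurable_EFinP; apply: measurable_funM => /=.
    by apply: measurableT_comp => //; exact: measurableT_comp.
  apply: measurableT_comp => //; apply: measurable_funD => //.
  exact: measurableT_comp.
have aPz : adap J (fun w => (Phi w, zeta w)) by exact: measurable_fun_pair.
transitivity (\int[P]_w F ((Phi w, zeta w), X v w))%E.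
  by apply: eq_integral => w _; rewrite /F /= ger0_norm.
rewrite (@ge0_integral_independent _ _ _ P _ _ _ _
  (fun w => (Phi w, zeta w)) (X v)) //.
- apply: eq_integral => w _; rewrite /F /=.
  transitivity (\int[distribution P (X v)]_y (`|Phi w| * U (zeta w + y))%:E)%E.
    rewrite ge0_integral_distribution//.
      apply/measurable_EFinP; apply: measurable_funM => //.
      by apply: measurableT_comp => //; exact: measurable_funD.
    by move=> y; rewrite lee_fin mulr_ge0.
  rewrite (eq_measure_integral (distribution Q xi)); last first.
    by move=> A mA _; case: brw => _ /(_ v v0 A mA).
  rewrite ge0_integral_distribution/=.
  - rewrite ger0_norm// -ge0_integralZl_EFin//.
    + by move=> w' _; rewrite lee_fin.
    + apply/measurable_EFinP; apply: measurableT_comp => //.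
      exact: measurable_funD.
  - apply/measurable_EFinP; apply: measurable_funM => //.
    by apply: measurableT_comp => //; exact: measurable_funD.
  - by move=> y; rewrite lee_fin mulr_ge0.
- exact: label_adapted_measurable aPz.
- by apply: (@adapted_indep J _ _ _ (inr v)) => // -[].
- by move=> z; rewrite lee_fin mulr_ge0.
Qed.

Let integral_offspring a k J (Phi : Omega -> R) :
  J `<=` [set t | t <> root_step] -> ~ J (inl a) ->
  adap J Phi -> (forall w, 0 <= Phi w) ->
  (\int[P]_w ((N a w == k)%:R * Phi w)%:E =
   (pk k)%:E * \int[P]_w (Phi w)%:E)%E.
Proof.
move=> JD nJa aP P0.
pose F := fun z : R * nat => ((z.2 == k)%:R * `|z.1|)%:E.
have mk : measurable_fun setT (fun n : nat => (n == k)%:R : R) by [].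
have mF : measurable_fun [set: R * nat] F.
  apply/measurable_EFinP; apply: measurable_funM => /=.
    exact: (measurableT_comp mk measurable_snd).
  exact: measurableT_comp.
have mN : measurable_fun setT (N a) by [].
transitivity (\int[P]_w F (Phi w, N a w))%E.
  by apply: eq_integral => w _; rewrite /F /= ger0_norm.
rewrite (@ge0_integral_independent _ _ _ P _ _ _ _ Phi (N a)) //.
- have pkE : (\int[P]_w ((N a w == k)%:R : R)%:E = (pk k)%:E)%E.
    rewrite -(brw_offspring_law brw a) -[N a @^-1` _]setIT -integral_indic//.
      apply: eq_integral => w _; rewrite indicE; congr ((nat_of_bool _)%:R)%:E.
      by apply/eqP/idP; rewrite inE.
    by rewrite -[X in measurable X]setTI; exact: mN.
  have pk0 : 0 <= pk k by rewrite -lee_fin -(brw_offspring_law brw a).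
  rewrite -ge0_integralZl_EFin//.
  + apply: eq_integral => w _; rewrite /F /= -pkE ger0_norm//.
    under eq_integral do rewrite mulrC EFinM.
    rewrite ge0_integralZl_EFin// 1?muleC//.
    exact/measurable_EFinP/(measurableT_comp mk mN).
  + by move=> w _; rewrite lee_fin.
  + by apply/measurable_EFinP; exact: label_adapted_measurable aP.
- exact: label_adapted_measurable aP.
- by apply: (@adapted_indep J _ _ _ (inl a)).
- by move=> z; rewrite lee_fin mulr_ge0.
Qed.

Let integral_sum_offspring a (G : nat -> Omega -> R) :
  (forall k, measurable_fun setT (G k)) -> (forall k w, 0 <= G k w) ->
  (\int[P]_w (G (N a w) w)%:E =
   \sum_(k <oo) \int[P]_w ((N a w == k)%:R * G k w)%:E)%E.
Proof.
move=> mG G0.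
under eq_integral do rewrite -(eseries_pick _ (G ^~ _)).
rewrite integral_nneseries//.
  move=> n; apply/measurable_EFinP; apply: measurable_funM => //.
  have mk : measurable_fun setT (fun m : nat => (m == n)%:R : R) by [].
  exact: (measurableT_comp mk).
by move=> n w _; rewrite lee_fin mulr_ge0.
Qed.

(** All the labels that the [i]-th child of [a] brings, its step included. *)
Definition block (a : vertex) (i : nat) : set (vertex + vertex) :=
  [set t | match t with inl v => prefix (rcons a i) v
                      | inr v => prefix (rcons a i) v end].

Let descendants_block a i : descendants (rcons a i) `<=` block a i.
Proof. by move=> [v//|v] /= /andP[]. Qed.

Let block_descendants a i : block a i `<=` descendants a.
Proof.
move=> [v|v] /=; first exact: prefix_rconsl.
move=> av; rewrite (prefix_rconsl av) /=.
by apply: contraTneq av => ->; rewrite prefix_rcons_self.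
Qed.

Let rcons_neq0 (a : vertex) i : rcons a i <> [::].
Proof. by case: a. Qed.

Let outside_root a : outside a `<=` [set t | t <> root_step].
Proof. by move=> t []. Qed.

(** [U j] bounds the conditional expectation of the exponential of the level sum
    at a vertex with [j] generations left, and [V j] the same quantity before
    the step to that vertex. The hypotheses [UV] and [VU] say that a step and a
    branching do not increase these bounds. *)
Section supersolution.
Variables (n : nat) (b : R -> R) (U V : nat -> R -> R).
Hypothesis mb : measurable_fun setT b.
Hypothesis mU : forall j, measurable_fun setT (U j).
Hypothesis mV : forall j, measurable_fun setT (V j).
Hypothesis U0 : forall j x, 0 <= U j x.
Hypothesis V0 : forall j x, 0 <= V j x.
Hypothesis bU : forall x, expR (b x) <= U 0%N x.
Hypothesis UV : forall j x, (j < n)%N -> (\int[Q]_w (U j (x + xi w))%:E <= (V j x)%:E)%E.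
Hypothesis VU : forall j x, (j < n)%N ->
  (\sum_(k <oo) (pk k * V j x ^+ k)%:E <= (U j.+1 x)%:E)%E.

Let others a k : set (vertex + vertex) :=
  [set t | t <> root_step /\ forall i, (i < k)%N -> ~ block a i t].

(** The children are integrated out one at a time, from the last to the first.
    When it is the turn of child [k], the factors of the children [i < k] are
    kept in the weight [Psi], which depends on labels outside the subtree of
    child [k] only. *)
Let supersolution_children j (jn : (j < n)%N)
  (IH : forall a (Phi z : Omega -> R), adap (outside a) Phi ->
    adap (outside a) z -> (forall w, 0 <= Phi w) ->
    (\int[P]_w (Phi w * expR (lsum b j a (z w) w))%:E <=
     \int[P]_w (Phi w * U j (z w))%:E)%E)
  a k : forall (Phi z : Omega -> R), adap (others a k) Phi ->
    adap (others a k) z -> (forall w, 0 <= Phi w) ->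
    (\int[P]_w (Phi w *
       \prod_(i < k) expR (lsum b j (rcons a i) (z w + X (rcons a i) w) w))%:E <=
     \int[P]_w (Phi w * V j (z w) ^+ k)%:E)%E.
Proof.
elim: k => [|k IHk] Phi z aP az P0.
  rewrite le_eqVlt; apply/orP; left; apply/eqP; apply: eq_integral => w _.
  by rewrite big_ord0 expr0.
have sub_out : others a k.+1 `<=` outside (rcons a k).
  move=> t [t0 ta]; split => // /descendants_block; exact: ta.
have sub_others : others a k.+1 `<=` others a k.
  by move=> t [t0 ta]; split => // i ik; apply: ta; exact: ltnW.
have block_out i : (i < k)%N -> block a i `<=` outside (rcons a k).
  move=> ik t ait; split.
    move=> t0; rewrite t0 in ait.
    have : prefix (rcons a i) [::] by exact: ait.
    by rewrite prefixs0 => /eqP/rcons_neq0.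
  move=> /descendants_block akt; have : i = k.
    by case: t ait akt => v; exact: prefix_rcons_inj.
  by move=> ikE; rewrite ikE ltnn in ik.
pose Psi w := Phi w *
  \prod_(i < k) expR (lsum b j (rcons a i) (z w + X (rcons a i) w) w).
have aPsi J : others a k.+1 `<=` J -> (forall i, (i < k)%N -> block a i `<=` J) ->
    adap J Psi.
  move=> oJ bJ.
  have aP' := adaptedS oJ aP; have az' := adaptedS oJ az.
  apply: measurable_funM => //; apply: measurable_prod => i _.
  apply: measurableT_comp => //; apply: adapted_level_sum => //.
    by apply: subset_trans (bJ i (ltn_ord i)); exact: descendants_block.
  apply: measurable_funD => //; apply: adapted_step; apply: (bJ i (ltn_ord i)) => /=.
  exact: prefix_refl.
have Psi0 w : 0 <= Psi w.
  by rewrite mulr_ge0// prodr_ge0// => i _; exact: expR_ge0.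
have step_out : outside (rcons a k) (inr (rcons a k)).
  split; first by case=> /rcons_neq0.
  by rewrite /= eqxx andbF.
under eq_integral do rewrite big_ord_recr /= mulrA -/(Psi _).
apply: le_trans (IH (rcons a k) Psi (fun w => z w + X (rcons a k) w) _ _ Psi0) _.
- exact: aPsi.
- apply: measurable_funD; first exact: adaptedS az.
  exact: adapted_step.
pose J := others a k.+1 `|` \bigcup_(i in [set i | (i < k)%N]) block a i.
have aPsiJ : adap J Psi.
  by apply: aPsi => [|i ik t ait]; [left|right; exists i].
rewrite (@integral_step _ (mU j) (U0 j) (rcons a k) J)//; first last.
- by apply: adaptedS az; left.
- case=> [[_ /(_ k (ltnSn _))]|[i /= ik aik]]; first by rewrite /= prefix_refl.
  by have := prefix_rcons_inj aik (prefix_refl _) => ikE; rewrite ikE ltnn in ik.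
- by move=> t [[]//|[i ik /(block_out _ ik)[]]].
apply: (@le_trans _ _ (\int[P]_w (Psi w * V j (z w))%:E)%E).
  apply: ge0_le_integral => //.
  - by move=> w _; rewrite mule_ge0 ?lee_fin//; apply: integral_ge0 => w' _; rewrite lee_fin.
  - apply: emeasurable_funM.
      apply/measurable_EFinP; exact: label_adapted_measurable aPsiJ.
    apply: (measurableT_comp (measurable_average xi (@mU j) (U0 j))).
    exact: label_adapted_measurable az.
  - apply/measurable_EFinP; apply: measurable_funM.
      exact: label_adapted_measurable aPsiJ.
    by apply: measurableT_comp => //; exact: label_adapted_measurable az.
  - move=> w _; rewrite [leRHS]EFinM; apply: lee_wpmul2l; first by rewrite lee_fin.
    exact: UV.
under eq_integral do rewrite /Psi mulrAC.
under [leRHS]eq_integral do rewrite exprS mulrA.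
apply: IHk.
- apply: measurable_funM; first exact: adaptedS aP.
  by apply: measurableT_comp => //; exact: adaptedS az.
- exact: adaptedS az.
- by move=> w; rewrite mulr_ge0.
Qed.

Let outside_others a k : outside a `<=` others a k.
Proof. by move=> t [t0 ta]; split => // i _ /block_descendants. Qed.

Let offspring_others a k : others a k (inl a).
Proof. by split => // i _; rewrite /= prefix_rcons_self. Qed.

(** The weight [Phi] makes the induction possible: it stands for all that was
    observed outside the subtree of [a], so the bound is one on conditional
    expectations. *)
Lemma supersolution_bound j : (j <= n)%N -> forall a (Phi z : Omega -> R),
  adap (outside a) Phi -> adap (outside a) z -> (forall w, 0 <= Phi w) ->
  (\int[P]_w (Phi w * expR (lsum b j a (z w) w))%:E <=
   \int[P]_w (Phi w * U j (z w))%:E)%E.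
Proof.
elim: j => [|j IH] jn a Phi z aP az P0.
  have mz := label_adapted_measurable az.
  have mP := label_adapted_measurable aP.
  apply: ge0_le_integral => //.
  - by move=> w _; rewrite lee_fin mulr_ge0// expR_ge0.
  - apply/measurable_EFinP; apply: measurable_funM => //=.
    by apply: measurableT_comp => //; exact: measurableT_comp.
  - apply/measurable_EFinP; apply: measurable_funM => //=.
    exact: measurableT_comp.
  - by move=> w _; rewrite lee_fin ler_wpM2l//= bU.
pose G k w := Phi w *
  \prod_(i < k) expR (lsum b j (rcons a i) (z w + X (rcons a i) w) w).
have aPk k := adaptedS (@outside_others a k) aP.
have azk k := adaptedS (@outside_others a k) az.
have aVk k : adap (outside a) (fun w => Phi w * V j (z w) ^+ k).
  apply: measurable_funM => //; apply: measurable_funX.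
  exact: measurableT_comp.
have mG k : measurable_fun setT (G k).
  apply: (label_adapted_measurable (J := setT)) => //.
  apply: measurable_funM; first exact: adaptedS aP.
  apply: measurable_prod => i _; apply: measurableT_comp => //.
  apply: adapted_level_sum => //; apply: measurable_funD; last exact: adapted_step.
  exact: adaptedS az.
have G0 k w : 0 <= G k w.
  by rewrite mulr_ge0// prodr_ge0// => i _; exact: expR_ge0.
have -> : (\int[P]_w (Phi w * expR (lsum b j.+1 a (z w) w))%:E =
           \int[P]_w (G (N a w) w)%:E)%E.
  by apply: eq_integral => w _; rewrite /G /= expR_sum.
rewrite integral_sum_offspring//.
(* Splitting according to the number of children of [a] turns the product over
   the children into a fixed number of factors, then recombines. *)
apply: (@le_trans _ _
  (\sum_(k <oo) (pk k)%:E * \int[P]_w (Phi w * V j (z w) ^+ k)%:E)%E).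
  apply: lee_nneseries => [k _ _|k _].
    by apply: integral_ge0 => w _; rewrite lee_fin mulr_ge0.
  rewrite -(@integral_offspring a k (outside a))//; first last.
  - by move=> w; rewrite mulr_ge0// exprn_ge0.
  - by case=> _; rewrite /= prefix_refl.
  under eq_integral do rewrite /G mulrA.
  under [leRHS]eq_integral do rewrite mulrA.
  apply: (supersolution_children jn (IH (ltnW jn))) => //.
  + apply: measurable_funM => //.
    have mk : measurable_fun setT (fun m : nat => (m == k)%:R : R) by [].
    by apply: (measurableT_comp mk); exact: adapted_offspring.
  + exact: aPk.
  + by move=> w; apply: mulr_ge0; rewrite ?ler0n.
have pk0 k : 0 <= pk k by rewrite -lee_fin -(brw_offspring_law brw a).
have mPV k : measurable_fun setT (fun w => (Phi w * V j (z w) ^+ k)%:E).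
  apply/measurable_EFinP; exact: label_adapted_measurable (aVk k).
have t0 k w : (0 <= (pk k)%:E * (Phi w * V j (z w) ^+ k)%:E)%E.
  by apply: mule_ge0; rewrite lee_fin// mulr_ge0// exprn_ge0.
have mt k : measurable_fun setT
    (fun w => (pk k)%:E * (Phi w * V j (z w) ^+ k)%:E)%E.
  by apply: emeasurable_funM => //; exact: measurable_cst.
have -> : (\sum_(k <oo) (pk k)%:E * \int[P]_w (Phi w * V j (z w) ^+ k)%:E =
    \int[P]_w \sum_(k <oo) ((pk k)%:E * (Phi w * V j (z w) ^+ k)%:E))%E.
  rewrite integral_nneseries//; apply: eq_eseriesr => k _.
  rewrite ge0_integralZl_EFin// => w _.
  by rewrite lee_fin mulr_ge0// exprn_ge0.
apply: ge0_le_integral => //.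
- by move=> w _; apply: nneseries_ge0.
- by apply: ge0_emeasurable_sum.
- apply/measurable_EFinP; apply: measurable_funM.
    exact: label_adapted_measurable aP.
  by apply: measurableT_comp => //; exact: label_adapted_measurable az.
- move=> w _; rewrite [leRHS]EFinM.
  have -> : (\sum_(k <oo) (pk k)%:E * (Phi w * V j (z w) ^+ k)%:E =
    (Phi w)%:E * \sum_(k <oo) (pk k * V j (z w) ^+ k)%:E)%E.
    rewrite -nneseriesZl; last first.
      by move=> k _; rewrite lee_fin mulr_ge0// exprn_ge0.
    by apply: eq_eseriesr => k _; rewrite -!EFinM mulrCA.
  by apply: lee_wpmul2l; [rewrite lee_fin|exact: VU].
Qed.

End supersolution.

(** A lower bound for the probability that a level sum is positive, obtained by
    keeping the trees in which [a], its child, and so on have a single child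
    for [i] generations. [q i] is such a bound with [i] of these generations
    left and [W i] the same quantity before the step. *)
Section spine.
Variables (b : R -> R) (k0 : nat) (q W : nat -> R -> R).
Hypothesis mb : measurable_fun setT b.
Hypothesis mq : forall i, measurable_fun setT (q i).
Hypothesis mW : forall i, measurable_fun setT (W i).
Hypothesis q0 : forall i x, 0 <= q i x.
Hypothesis W0 : forall i x, 0 <= W i x.
Hypothesis Wq : forall i x, ((W i x)%:E <= \int[Q]_w (q i (x + xi w))%:E)%E.
Hypothesis qS : forall i x, q i.+1 x <= pk 1%N * W i x.

Let positive j a x w : R := (0 < lsum b j a x w)%R%:R.

Hypothesis q_start : forall a (Phi z : Omega -> R),
  adap (outside a) Phi -> adap (outside a) z -> (forall w, 0 <= Phi w <= 1) ->
  (\int[P]_w (Phi w * q 0 (z w))%:E <=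
   \int[P]_w (Phi w * positive k0 a (z w) w)%:E)%E.

Let adapted_positive j a J (z : Omega -> R) : descendants a `<=` J -> adap J z ->
  adap J (fun w => positive j a (z w) w).
Proof.
move=> aJ az.
apply: (@measurableT_comp _ _ _ _ _ _ (fun b : bool => b%:R : R)) => //.
by apply: measurable_fun_ltr => //; exact: adapted_level_sum.
Qed.

(** If [a] has a single child, the level sum of [a] is that of the child, one
    generation shorter; this event costs [pk 1] and is independent of the
    rest. *)
Lemma spine_bound i : forall a (Phi z : Omega -> R),
  adap (outside a) Phi -> adap (outside a) z -> (forall w, 0 <= Phi w <= 1) ->
  (\int[P]_w (Phi w * q i (z w))%:E <=
   \int[P]_w (Phi w * positive (i + k0) a (z w) w)%:E)%E.
Proof.
elim: i => [|i IH] a Phi z aP az P01; first exact: q_start.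
have P0 w : 0 <= Phi w by have /andP[] := P01 w.
have mz := label_adapted_measurable az.
have mP := label_adapted_measurable aP.
have pk0 k : 0 <= pk k by rewrite -lee_fin -(brw_offspring_law brw a).
have out : outside a `<=` outside (rcons a 0%N).
  by move=> t [t0 ta]; split => // /descendants_block/block_descendants.
have step_out : outside (rcons a 0%N) (inr (rcons a 0%N)).
  split; first by case=> /rcons_neq0.
  by rewrite /= eqxx andbF.
have ind_out : outside (rcons a 0%N) (inl a).
  by split => //; rewrite /= prefix_rcons_self.
pose Psi w := (N a w == 1%N)%:R * Phi w.
have aPsi J : outside a `<=` J -> J (inl a) -> adap J Psi.
  move=> oJ Ja; apply: measurable_funM => //; last exact: adaptedS aP.
  have mk : measurable_fun setT (fun m : nat => (m == 1%N)%:R : R) by [].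
  by apply: (measurableT_comp mk); exact: adapted_offspring.
have Psi0 w : 0 <= Psi w by rewrite mulr_ge0.
have Psi01 w : 0 <= Psi w <= 1.
  rewrite Psi0 /= /Psi; have /andP[_] := P01 w.
  by case: (_ == _); rewrite ?mul1r ?mul0r.
apply: (@le_trans _ _ (\int[P]_w (Psi w * W i (z w))%:E)%E).
  under [leRHS]eq_integral do rewrite -mulrA.
  rewrite (@integral_offspring a 1%N (outside a))//; first last.
  - by move=> w; rewrite mulr_ge0.
  - by apply: measurable_funM => //; exact: measurableT_comp.
  - by case=> _; rewrite /= prefix_refl.
  rewrite -ge0_integralZl_EFin//; first last.
  - by apply/measurable_EFinP; apply: measurable_funM => //; exact: measurableT_comp.
  - by move=> w _; rewrite lee_fin mulr_ge0.
  apply: ge0_le_integral => //.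
  - by move=> w _; rewrite lee_fin mulr_ge0.
  - by apply/measurable_EFinP; apply: measurable_funM => //; exact: measurableT_comp.
  - apply/measurable_EFinP; apply: measurable_funM => //; apply: measurable_funM => //.
    exact: measurableT_comp.
  - by move=> w _; rewrite -EFinM lee_fin mulrCA ler_wpM2l.
pose J := outside a `|` [set inl a].
have aPsiJ : adap J Psi by apply: aPsi; [left|right].
have mPsi := label_adapted_measurable aPsiJ.
apply: (@le_trans _ _ (\int[P]_w (Psi w * q i (z w + X (rcons a 0%N) w))%:E)%E).
  rewrite (@integral_step _ (mq i) (q0 i) (rcons a 0%N) J)//; first last.
  - by apply: adaptedS az; left.
  - case=> // -[_]; apply; rewrite /= prefix_rcons /=.
    by apply/eqP => /(congr1 size)/eqP; rewrite size_rcons -[X in _ == X]addn0 -addn1 eqn_add2l.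
  - by move=> t [[]//|->].
  apply: ge0_le_integral => //.
  - by move=> w _; rewrite lee_fin mulr_ge0.
  - by apply/measurable_EFinP; apply: measurable_funM => //; exact: measurableT_comp.
  - apply: emeasurable_funM; first exact/measurable_EFinP.
    exact: (measurableT_comp (measurable_average xi (mq i) (q0 i))).
  - by move=> w _; rewrite EFinM lee_wpmul2l// lee_fin.
apply: le_trans (IH (rcons a 0%N) Psi (fun w => z w + X (rcons a 0%N) w) _ _ Psi01) _.
- exact: aPsi.
- apply: measurable_funD; first exact: adaptedS az.
  exact: adapted_step.
apply: ge0_le_integral => //.
- by move=> w _; rewrite lee_fin mulr_ge0// ler0n.
- apply/measurable_EFinP; apply: measurable_funM => //.
  apply: (label_adapted_measurable (J := setT)) => //.
  apply: adapted_positive => //; apply: measurable_funD; last exact: adapted_step.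
  exact: adaptedS az.
- apply/measurable_EFinP; apply: measurable_funM => //.
  apply: (label_adapted_measurable (J := setT)) => //.
  by apply: adapted_positive => //; exact: adaptedS az.
- move=> w _; rewrite lee_fin /Psi addSn.
  case: (eqVneq (N a w) 1%N) => [N1|_]; last first.
    by rewrite !mul0r mulr_ge0// ler0n.
  by rewrite mul1r /positive /= N1 big_ord1.
Qed.

End spine.

End branching.

(** * Level sums as sums over the vertices of the tree *)

Section levels.
Context (Omega : Type) (R : realType) (N : vertex -> Omega -> nat)
  (X : vertex -> Omega -> R) (w : Omega).

Fixpoint level (j : nat) (a : vertex) : seq vertex :=
  if j is j'.+1 then
    flatten [seq level j' (rcons a i) | i <- iota 0 (N a w)]
  else [:: a].

Lemma position_rcons a i :
  position X (rcons a i) w = position X a w + X (rcons a i) w.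
Proof.
rewrite /position size_rcons big_nat_recr//= -(size_rcons a i) take_size.
congr (_ + _).
rewrite [LHS]big_nat_cond [RHS]big_nat_cond; apply: eq_bigr => k /andP[/andP[_ ks] _].
by rewrite -cats1 takel_cat// -ltnS -(size_rcons a i).
Qed.

Lemma level_sum_level (b : R -> R) j a :
  level_sum N X b j a (position X a w) w =
  \sum_(v <- level j a) b (position X v w).
Proof.
elim: j a => [|j IH] a /=; first by rewrite big_seq1.
rewrite big_flatten /= big_map -(big_mkord xpredT
  (fun i => level_sum N X b j (rcons a i) (position X a w + X (rcons a i) w) w)).
by rewrite /index_iota subn0; apply: eq_bigr => i _; rewrite -position_rcons IH.
Qed.

Lemma mem_level j a v : (v \in level j a) = (prefix a v &&
  (size v == size a + j)%N &&
  all (fun k => nth 0%N v k < N (take k v) w)%N (iota (size a) j)).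
Proof.
elim: j a => [|j IH] a /=.
  rewrite inE addn0 andbT; apply/eqP/andP => [->|[/prefixP[u ->]]].
    by rewrite prefix_refl eqxx.
  rewrite size_cat -[X in _ == X]addn0 eqn_add2l => /nilP ->.
  by rewrite cats0.
apply/flatten_mapP/idP => [[i]|].
  rewrite mem_iota add0n IH size_rcons addSnnS.
  move=> /andP[_ iN] /andP[/andP[pv ->] ->]; rewrite (prefix_rconsl pv) /= andbT.
  case/prefixP: pv => u ->.
  by rewrite cat_rcons nth_cat ltnn subnn /= take_size_cat.
move=> /andP[/andP[/prefixP[u vE] sv] /andP[av al]].
case: u vE => [vE|i u vE].
  by move: sv; rewrite vE cats0 -[X in X == _]addn0 eqn_add2l.
exists i; first by move: av; rewrite mem_iota vE nth_cat ltnn subnn /= take_size_cat.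
by rewrite IH size_rcons addSnnS sv al andbT andbT vE -cat_rcons prefix_prefix.
Qed.

Lemma level_uniq j a : uniq (level j a).
Proof.
elim: j a => [//|j IH] a /=.
elim: (N a w) 0%N => [//|n IHn] m /=.
rewrite cat_uniq IH IHn andbT /=; apply/hasPn => v /flatten_mapP[i].
rewrite mem_iota => /andP[mi _]; rewrite !mem_level => /andP[/andP[iv _] _].
apply/negP => /andP[/andP[mv _] _].
by move: mi; rewrite (prefix_rcons_inj iv mv) ltnn.
Qed.

(** The finitely supported sum in [Zn] runs over the duplicate-free enumeration
    [level] of the vertices of generation [n]. *)
Lemma ZnE n (B : set R) : Zn N X n B w = level_sum N X \1_B n [::] 0 w.
Proof.
have -> : 0 = position X [::] w by rewrite /position big_geq.
rewrite level_sum_level (fsbig_seq _ _ (level_uniq n [::])) /Zn.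
suff -> : [set v | tree N w v /\ size v = n] = [set` level n [::]] by [].
apply/seteqP; split=> v /=; rewrite mem_level prefix0s add0n /=.
  by move=> [tv sv]; rewrite sv eqxx /=; apply/allP => k; rewrite mem_iota -sv => kv; exact: tv.
move=> /andP[/eqP sv /allP al]; split => // k kv.
by apply: al; rewrite mem_iota -sv.
Qed.

Lemma level_sum_center c p n (B : set R) :
  level_sum N X (fun x => c * (\1_B x - p)) n [::] 0 w =
  c * (Zn N X n B w - p * Zn N X n setT w).
Proof.
rewrite !ZnE; have -> : 0 = position X [::] w by rewrite /position big_geq.
rewrite !level_sum_level -mulr_sumr sumrB; congr (_ * (_ - _)).
rewrite mulr_sumr; apply: eq_bigr => v _.
by rewrite indicT /cst mulr1.
Qed.

End levels.

(** * Gaussian integrals *)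

Section gaussian.
Context (R : realType).
Local Notation mu := (@lebesgue_measure R).

Lemma ge0_integral_normal_prob (m s : R) (f : R -> \bar R) :
  measurable_fun setT f -> (forall x, 0 <= f x)%E ->
  (\int[normal_prob m s]_x f x =
   \int[mu]_x (f x * (normal_pdf m s x)%:E))%E.
Proof.
move=> mf f0.
rewrite -(Radon_Nikodym_SigmaFinite.change_of_variables
  (normal_prob_dominates m s))//.
apply: ae_eq_integral => //.
- apply: emeasurable_funM => //; apply: (measurable_int mu).
  exact: (Radon_Nikodym_SigmaFinite.f_integrable (normal_prob_dominates m s)).
- by apply: emeasurable_funM => //; apply/measurable_EFinP; exact: measurable_normal_pdf.
- apply: ae_eqe_mul2l => /=.
  apply: integral_ae_eq => //=.
  + exact: (Radon_Nikodym_SigmaFinite.f_integrable (normal_prob_dominates m s)).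
  + by apply/measurable_EFinP; exact: measurable_normal_pdf.
  + move=> E _ mE.
    by rewrite -(Radon_Nikodym_SigmaFinite.f_integral (normal_prob_dominates m s)).
Qed.

Lemma ge0_integral_affine (x s : R) (f : R -> \bar R) : 0 < s ->
  measurable_fun setT f -> (forall x, 0 <= f x)%E ->
  (\int[mu]_u f u = s%:E * \int[mu]_z f (x + s * z)%R)%E.
Proof.
move=> s0 mf f0.
pose phi : R -> R := fun z => x + s * z.
have mphi : measurable_fun [set: measurableTypeR R] (phi : _ -> measurableTypeR R).
  by apply: measurable_funD => //; exact: measurable_funM.
pose sn : {nonneg R} := NngNum (ltW s0).
rewrite -[in RHS](ge0_integral_pushforward mphi mu measurableT)//.
rewrite -[s]/(sn%:num) -ge0_integral_mscale//.
apply: eq_measure_integral => A mA _ /=.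
apply: lebesgue_measure_unique => //= _ [[a b]] _ <-.
rewrite /mscale /= /pushforward /=.
have -> : phi @^-1` `]a, b] = `](a - x) / s, (b - x) / s]%classic.
  apply/seteqP; split => z /=; rewrite !in_itv /phi /= ltr_pdivrMr// ler_pdivlMr//.
    by rewrite ltrBlDl lerBrDl mulrC.
  by rewrite ltrBlDl lerBrDl mulrC.
rewrite !lebesgue_measure_itv/= !lte_fin ltr_pM2r ?invr_gt0// ltrD2r.
case: ifPn => _; last by rewrite mule0.
rewrite -!EFinD -EFinM; congr EFin; rewrite -mulrBl mulrC divfK ?gt_eqF//.
by rewrite opprB addrA subrK.
Qed.

Lemma normal_pdf_affine (x s z : R) : 0 < s ->
  normal_pdf x s (x + s * z) * s = normal_pdf 0 1 z.
Proof.
move=> s0; rewrite !normal_pdfE ?oner_neq0 ?gt_eqF// /normal_peak /normal_fun.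
have -> : - (x + s * z - x) ^+ 2 / (s ^+ 2 *+ 2) = - (z - 0) ^+ 2 / (1 ^+ 2 *+ 2).
  by field; rewrite gt_eqF.
rewrite expr1n mul1r -mulrnAr sqrtrM ?sqr_ge0// sqrtr_sqr gtr0_norm//.
have c0 : Num.sqrt (pi *+ 2) != 0 :> R by rewrite gt_eqF// sqrtr_gt0 mulrn_wgt0// pi_gt0.
by field; rewrite c0 gt_eqF.
Qed.

Lemma integral_nu_affine (x s : R) (f : R -> \bar R) : 0 < s ->
  measurable_fun setT f -> (forall x, 0 <= f x)%E ->
  (\int[normal_prob (0 : R) 1]_z f (x + s * z)%R = \int[normal_prob x s]_u f u)%E.
Proof.
move=> s0 mf f0; have mphi : measurable_fun setT (fun z : R => x + s * z).
  by apply: measurable_funD => //; exact: measurable_funM.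
rewrite [RHS]ge0_integral_normal_prob// (ge0_integral_affine x s0); last 2 first.
- by apply: emeasurable_funM => //; apply/measurable_EFinP; exact: measurable_normal_pdf.
- by move=> u; rewrite mule_ge0// lee_fin normal_pdf_ge0.
rewrite ge0_integral_normal_prob//; last exact: measurableT_comp.
rewrite -ge0_integralZl_EFin//; last 3 first.
- by move=> u _; rewrite mule_ge0// lee_fin normal_pdf_ge0.
- apply: emeasurable_funM; first exact: measurableT_comp.
  apply/measurable_EFinP; apply: measurableT_comp => //.
  exact: measurable_normal_pdf.
- exact: ltW.
apply: eq_integral => z _.
by rewrite -(normal_pdf_affine x z s0) EFinM muleA [RHS]muleC.
Qed.

(** Completing the square: a Gaussian step of variance [1] followed by one of
    variance [s ^+ 2] is a step of variance [t ^+ 2], times the law of the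
    intermediate point given both ends. *)
Lemma normal_pdf_mul (x y u s t : R) : 0 < s -> 0 < t -> t ^+ 2 = 1 + s ^+ 2 ->
  normal_pdf x 1 y * normal_pdf y s u =
  normal_pdf x t u * normal_pdf ((s ^+ 2 * x + u) / t ^+ 2) (s / t) y.
Proof.
move=> s0 t0 ts.
have st0 : 0 < s / t by exact: divr_gt0.
have t2 : 1 + s ^+ 2 != 0 by rewrite -ts gt_eqF// exprn_gt0.
rewrite !normal_pdfE ?oner_neq0 ?gt_eqF// /normal_peak /normal_fun.
rewrite mulrACA [RHS]mulrACA -!invfM -!expRD; congr (_^-1 * expR _).
  have pi2 r : 0 <= r ^+ 2 * pi *+ 2 :> R.
    by rewrite mulrn_wge0// mulr_ge0 ?pi_ge0 ?sqr_ge0.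
  rewrite -(sqrtrM _ (pi2 1)) -(sqrtrM _ (pi2 t)); congr (Num.sqrt _).
  by field; rewrite gt_eqF.
rewrite expr_div_n ts; field.
by rewrite t2 gt_eqF.
Qed.

Lemma integral_nu_semigroup (x s t : R) (f : R -> \bar R) :
  0 < s -> 0 < t -> t ^+ 2 = 1 + s ^+ 2 ->
  measurable_fun setT f -> (forall x, 0 <= f x)%E ->
  (\int[normal_prob (0 : R) 1]_y \int[normal_prob (0 : R) 1]_z f (x + y + s * z)%R =
   \int[normal_prob (0 : R) 1]_z f (x + t * z)%R)%E.
Proof.
move=> s0 t0 ts mf f0.
have mpdf m r : measurable_fun setT (fun y : R => (normal_pdf m r y)%:E).
  by apply/measurable_EFinP; exact: measurable_normal_pdf.
have mpdf2 : measurable_fun [set: R * R] (fun z => (normal_pdf z.1 s z.2)%:E).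
  apply/measurable_EFinP.
  rewrite (_ : (fun z => _) = (fun z : R * R => normal_pdf 0 s (z.2 - z.1))).
    apply: measurableT_comp; first exact: measurable_normal_pdf.
    by apply: measurable_funB.
  apply/funext => z; rewrite !normal_pdfE ?gt_eqF//.
  by rewrite /normal_fun subr0.
under eq_integral => y _ do rewrite (integral_nu_affine (x + y) s0 mf f0).
rewrite [RHS](integral_nu_affine x t0 mf f0) [RHS]ge0_integral_normal_prob//.
pose g y := (\int[normal_prob y s]_u f u)%E.
have gE y : g y = (\int[mu]_u (f u * (normal_pdf y s u)%:E))%E.
  exact: ge0_integral_normal_prob.
have mg : measurable_fun setT g.
  rewrite (_ : g = fun y => (\int[mu]_u (f u * (normal_pdf y s u)%:E))%E); last first.
    by apply/funext => y; exact: gE.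
  apply: (@measurable_fun_fubini_tonelli_F _ _ _ _ _ mu
    (fun z : R * R => (f z.2 * (normal_pdf z.1 s z.2)%:E)%E)).
    by apply: emeasurable_funM => //; exact: measurableT_comp.
  by move=> z; rewrite mule_ge0// lee_fin normal_pdf_ge0.
have g0 y : (0 <= g y)%E by exact: integral_ge0.
have -> : (\int[normal_prob (0 : R) 1]_y \int[normal_prob (x + y) s]_u f u =
    \int[normal_prob (0 : R) 1]_y g (x + 1 * y)%R)%E.
  by apply: eq_integral => y _; rewrite mul1r.
clearbody g; rewrite (integral_nu_affine x ltr01 mg g0).
rewrite (ge0_integral_normal_prob x 1 mg g0).
transitivity (\int[mu]_y \int[mu]_u
    (f u * (normal_pdf x 1 y)%:E * (normal_pdf y s u)%:E))%E.
  apply: eq_integral => y _.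
  rewrite gE.
  rewrite muleC.
  rewrite -ge0_integralZl_EFin; last 4 first.
  - exact: measurableT.
  - by move=> u _; rewrite mule_ge0// lee_fin normal_pdf_ge0.
  - by apply: emeasurable_funM => //; exact: mpdf.
  - exact: normal_pdf_ge0.
  by apply: eq_integral => u _; rewrite muleCA muleA.
rewrite (@fubini_tonelli _ _ _ _ _ mu mu
  (fun z : R * R => (f z.2 * (normal_pdf x 1 z.1)%:E * (normal_pdf z.1 s z.2)%:E)%E)).
- apply: eq_integral => u _ /=.
  under eq_integral => y _ do
    rewrite -muleA -EFinM (normal_pdf_mul _ _ _ s0 t0 ts) EFinM muleA.
  rewrite ge0_integralZl//.
  + by rewrite integral_normal_pdf mule1.
  + exact: mpdf.
  + by move=> y _; rewrite lee_fin normal_pdf_ge0.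
  + by rewrite mule_ge0// lee_fin normal_pdf_ge0.
- apply: emeasurable_funM => //; apply: emeasurable_funM; first exact: measurableT_comp.
  exact: (measurableT_comp (mpdf x 1)).
- by move=> z; rewrite !mule_ge0// lee_fin normal_pdf_ge0.
Qed.

Lemma integral_nuN (f : R -> \bar R) :
  measurable_fun setT f -> (forall x, 0 <= f x)%E ->
  (\int[normal_prob (0 : R) 1]_z f (- z)%R = \int[normal_prob (0 : R) 1]_z f z)%E.
Proof.
move=> mf f0.
have mopp : measurable_fun [set: measurableTypeR R] (-%R : _ -> measurableTypeR R) by [].
rewrite !ge0_integral_normal_prob//; last exact: measurableT_comp.
rewrite -[RHS](@eq_measure_integral _ _ _ _ _ (pushforward mu (-%R : _ -> measurableTypeR R))); last first.
  by move=> A mA _; exact: lebesgue_measureN.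
rewrite [RHS](ge0_integral_pushforward mopp mu measurableT); last 2 first.
- by apply: emeasurable_funM => //; apply/measurable_EFinP; exact: measurable_normal_pdf.
- by move=> y _; rewrite mule_ge0// lee_fin normal_pdf_ge0.
- apply: eq_integral => z _ /=; congr (_ * _%:E)%E.
  by rewrite !normal_pdfE ?oner_neq0// /normal_fun !subr0 sqrrN.
Qed.

Let quad_ge0 (z h : R) : 0 < h -> 0 <= z ^+ 2 * h / 2.
Proof. by move=> h0; rewrite divr_ge0// mulr_ge0 ?sqr_ge0// ltW. Qed.

(** A Gaussian Laplace transform in disguise: the integrand increases to
    [z ^+ 2] as [h] decreases to [0], and the integral has a closed form because
    [expR (- (z ^+ 2 * h / 2))] times a Gaussian density is again one, up to a
    constant. *)
Let variance_pdf (h : R) : 0 < h ->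
  (\int[normal_prob (0 : R) 1]_z (2 / h * (1 - expR (- (z ^+ 2 * h / 2))))%:E =
   (2 / (Num.sqrt (1 + h) * (Num.sqrt (1 + h) + 1)))%:E)%E.
Proof.
move=> h0; set r := Num.sqrt (1 + h).
have r0 : 0 < r by rewrite sqrtr_gt0 addr_gt0.
have r2 : r ^+ 2 = 1 + h by rewrite sqr_sqrtr// ltW// addr_gt0.
have e1 (z : R) : expR (- (z ^+ 2 * h / 2)) <= 1.
  by rewrite -[leRHS]expR0 ler_expR oppr_le0 quad_ge0.
have mE : measurable_fun setT (fun z : R => expR (- (z ^+ 2 * h / 2))).
  apply: measurableT_comp => //; apply: measurableT_comp => //.
  by apply: measurable_funM => //; apply: measurable_funM => //; exact: measurable_funX.
rewrite ge0_integral_normal_prob//; last 2 first.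
- by apply/measurable_EFinP; apply: measurable_funM => //; exact: measurable_funB.
- by move=> z; rewrite lee_fin mulr_ge0 ?divr_ge0 ?subr_ge0// ltW.
have pdfE (z : R) : expR (- (z ^+ 2 * h / 2)) * normal_pdf 0 1 z =
    r^-1 * normal_pdf 0 r^-1 z.
  have ri : 0 < r^-1 by rewrite invr_gt0.
  have := normal_pdf_affine 0 (r * z) ri.
  rewrite add0r mulKf ?gt_eqF// => pE; rewrite [RHS]mulrC pE.
  rewrite !normal_pdfE ?oner_neq0// /normal_fun mulrCA -expRD !subr0 exprMn r2.
  by congr (_ * expR _); field.
transitivity (\int[mu]_z ((2 / h)%:E * ((normal_pdf 0 1 z)%:E -
    (r^-1 * normal_pdf 0 r^-1 z)%:E)))%E.
  apply: eq_integral => z _; rewrite -EFinB -!EFinM -pdfE; congr EFin.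
  ring.
have i1 := @integrable_normal_pdf R 0 1.
have i2 : mu.-integrable setT (fun z => (r^-1 * normal_pdf 0 r^-1 z)%:E).
  under [X in mu.-integrable _ X]eq_fun do rewrite EFinM.
  by apply: integrableZl => //; exact: integrable_normal_pdf.
rewrite integralZl//; last exact: integrableB.
rewrite integralB// integral_normal_pdf.
under [X in (_ * (_ - X))%E]eq_integral do rewrite EFinM.
rewrite integralZl//; last exact: integrable_normal_pdf.
rewrite integral_normal_pdf mule1 -EFinB -EFinM; congr EFin.
have -> : h = r ^+ 2 - 1 by rewrite r2 addrAC subrr add0r.
have r1 : 1 < r by nra.
field; apply/and3P; split; apply: lt0r_neq0; nra.
Qed.

(** Both bounds come from [variance_pdf] as [h] tends to [0]: from above through
    the monotone sequence [g n], which lies below the integrand since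
    [expR (- u) <= (1 + u)^-1]; from below since [1 - expR (- u) <= u]. *)
Lemma variance_nu : (\int[normal_prob (0 : R) 1]_z (z ^+ 2)%:E = 1)%E.
Proof.
pose h n : R := n.+1%:R^-1.
have h0 n : 0 < h n by rewrite invr_gt0.
have h1 n : h n <= 1 by rewrite invf_le1// ler1n.
have m2 : measurable_fun setT (fun z : R => (z ^+ 2)%:E).
  by apply/measurable_EFinP; exact: measurable_funX.
have r0 n : 0 < Num.sqrt (1 + h n) by rewrite sqrtr_gt0 addr_gt0.
have mE n : measurable_fun setT (fun z : R => (2 / h n * (1 - expR (- (z ^+ 2 * h n / 2))))%:E).
  apply/measurable_EFinP; apply: measurable_funM => //; apply: measurable_funB => //.
  apply: measurableT_comp => //; apply: measurableT_comp => //.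
  by apply: measurable_funM => //; apply: measurable_funM => //; exact: measurable_funX.
apply/eqP; rewrite eq_le; apply/andP; split.
  pose g n (z : R) := (z ^+ 2 / (1 + z ^+ 2 * h n / 2))%:E.
  have d0 n (z : R) : 0 < 1 + z ^+ 2 * h n / 2.
    by rewrite ltr_wpDr// quad_ge0.
  have mg n : measurable_fun setT (g n).
    apply/measurable_EFinP; apply: continuous_measurable_fun => z.
    apply: cvgM; first exact: sqr_continuous.
    apply: cvgV; first by rewrite gt_eqF.
    apply: cvgD; first exact: cvg_cst.
    by do 2 (apply: cvgM; last exact: cvg_cst); exact: sqr_continuous.
  have g0 n z : setT z -> (0 <= g n z)%E by move=> _; rewrite lee_fin divr_ge0 ?sqr_ge0// ltW.
  have ndg z : setT z -> nondecreasing_seq (g ^~ z).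
    move=> _ m n mn; rewrite lee_fin ler_wpM2l ?sqr_ge0// lef_pV2 ?posrE//.
    rewrite lerD2l ler_wpM2r// ler_wpM2l ?sqr_ge0//.
    by rewrite /h lef_pV2 ?posrE// ler_nat.
  have gl (z : R) : limn (g ^~ z) = (z ^+ 2)%:E.
    apply/cvg_lim => //; apply: cvg_EFin; first exact: nearW.
    rewrite [X in _ --> X](_ : _ = z ^+ 2 / (1 + z ^+ 2 * 0 / 2)); last first.
      by rewrite mulr0 mul0r addr0 divr1.
    apply: cvgM; first exact: cvg_cst.
    apply: cvgV; first by rewrite mulr0 mul0r addr0 oner_neq0.
    apply: cvgD; first exact: cvg_cst.
    apply: cvgM; last exact: cvg_cst.
    by apply: cvgM; [exact: cvg_cst|exact: cvg_harmonic].
  have := @cvg_monotone_convergence _ _ R (normal_prob (0 : R) 1) setT measurableT g mg g0 ndg.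
  under eq_integral => z _ do rewrite gl.
  move=> gc; rewrite -(cvg_lim _ gc)//.
  apply: lime_le; first by apply/cvg_ex; eexists; exact: gc.
  apply: nearW => n.
  apply: (@le_trans _ _ (2 / (Num.sqrt (1 + h n) * (Num.sqrt (1 + h n) + 1)))%:E).
    rewrite -variance_pdf//.
    apply: ge0_le_integral; [exact: measurableT|exact: g0|exact: mg|exact: mE|].
    move=> z _; rewrite lee_fin /=.
    set u := z ^+ 2 * h n / 2.
    have u0 : 0 <= u by rewrite quad_ge0.
    have eu : expR (- u) <= (1 + u)^-1.
      by rewrite expRN lef_pV2 ?posrE ?expR_gt0 ?expR_ge1Dx// ltr_wpDr.
    have -> : z ^+ 2 / (1 + u) = 2 / h n * (1 - (1 + u)^-1).
      have -> : z ^+ 2 = 2 * u / h n by rewrite /u; field; rewrite gt_eqF.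
      by field; rewrite !gt_eqF// ltr_wpDr.
    by rewrite ler_wpM2l ?divr_ge0 ?lerD2l ?lerN2// ltW.
  have r1 : 1 <= Num.sqrt (1 + h n).
    rewrite -[leLHS]sqrtr1 ler_wsqrtr// lerDl; exact: ltW.
  rewrite lee_fin ler_pdivrMr ?mul1r ?mulr_gt0 ?addr_gt0//; nra.
apply/lee_subgt0Pr => e e0.
have [n ne] : exists n, 2 * h n <= e.
  have := @cvg_harmonic R; move=> /cvgrPdist_le /(_ (e / 2)) [|n _ /(_ n (leqnn _))].
    by rewrite divr_gt0.
  rewrite sub0r normrN ger0_norm ?invr_ge0// => hn; exists n.
  by rewrite mulrC -ler_pdivlMr.
apply: (@le_trans _ _ (2 / (Num.sqrt (1 + h n) * (Num.sqrt (1 + h n) + 1)))%:E).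
  rewrite -EFinB lee_fin; set r := Num.sqrt (1 + h n).
  have r2 : r ^+ 2 = 1 + h n by rewrite sqr_sqrtr// addr_ge0// ltW.
  have r1 : r <= 1 + h n.
    have := h0 n; have := r0 n; rewrite -/r; nra.
  have r3 := r0 n; rewrite -/r in r3.
  rewrite ler_pdivlMr ?mulr_gt0 ?addr_gt0//.
  have := h0 n; have := h1 n; nra.
rewrite -variance_pdf//; apply: ge0_le_integral; [exact: measurableT| |exact: mE|exact: m2|].
  move=> z _; rewrite lee_fin; apply: mulr_ge0; first by rewrite divr_ge0// ltW.
  by rewrite subr_ge0 -[leRHS]expR0 ler_expR oppr_le0 quad_ge0.
move=> z _; rewrite lee_fin; have := expR_ge1Dx (- (z ^+ 2 * h n / 2)).
set E := expR _ => e1.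
have -> : z ^+ 2 = 2 / h n * (z ^+ 2 * h n / 2) by field; rewrite gt_eqF.
by rewrite ler_wpM2l ?divr_ge0 ?(ltW (h0 n))//; lra.
Qed.

End gaussian.

(** * The averaging operator of a random step *)

Definition bounded_measurable (R : realType) (g : R -> R) :=
  measurable_fun setT g /\ exists M, forall x, `|g x| <= M.

Definition average d (Omega : measurableType d) (R : realType)
    (P : probability Omega R) (X : Omega -> R) (g : R -> R) (x : R) : R :=
  \int[P]_w g (x + X w).

Section average.
Context d (Omega : measurableType d) (R : realType) (P : probability Omega R).
Variable X : Omega -> R.
Hypothesis mX : measurable_fun setT X.
Implicit Types g h : R -> R.
Local Notation T := (average P X).

Lemma bounded_integrable (f : Omega -> R) M : measurable_fun setT f ->
  (forall w, `|f w| <= M) -> P.-integrable setT (EFin \o f).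
Proof.
move=> mf fM; apply: (@le_integrable _ _ _ P setT measurableT _ (cst M%:E)).
- exact/measurable_EFinP.
- move=> w _ /=; rewrite lee_fin (le_trans (fM w))// ler_norm//.
- exact: finite_measure_integrable_cst.
Qed.

Lemma average_integrable g x : bounded_measurable g ->
  P.-integrable setT (EFin \o (fun w => g (x + X w))).
Proof.
move=> [mg [M gM]]; apply: (@bounded_integrable _ M) => //.
by apply: measurableT_comp => //; exact: measurable_funD.
Qed.

Lemma EFin_average g x : bounded_measurable g ->
  ((T g x)%:E = \int[P]_w (g (x + X w))%:E)%E.
Proof.
move=> bg; rewrite /average /Rintegral fineK//.
exact: integrable_fin_num (average_integrable x bg).
Qed.

Lemma averageD g h x : bounded_measurable g -> bounded_measurable h ->
  T (fun y => g y + h y) x = T g x + T h x.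
Proof.
by move=> bg bh; rewrite /average RintegralD//; exact: average_integrable.
Qed.

Lemma averageZ c g x : bounded_measurable g -> T (fun y => c * g y) x = c * T g x.
Proof. by move=> bg; rewrite /average RintegralZl//; exact: average_integrable. Qed.

Lemma average_cst c x : T (fun=> c) x = c.
Proof. by rewrite /average Rintegral_cst// [X in fine X](@probability_setT _ _ _ P) mulr1. Qed.

Lemma le_average g h x : bounded_measurable g -> bounded_measurable h ->
  (forall y, g y <= h y) -> T g x <= T h x.
Proof. by move=> bg bh gh; apply: le_Rintegral => //; exact: average_integrable. Qed.

Lemma average_norm g M x : measurable_fun setT g -> (forall y, `|g y| <= M) ->
  `|T g x| <= M.
Proof.
move=> mg gM; have bg : bounded_measurable g by split => //; exists M.
apply: le_trans (le_normr_Rintegral measurableT (average_integrable x bg)) _.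
have -> : M = T (fun=> M) x by rewrite average_cst.
apply: le_Rintegral => //.
- apply: (@bounded_integrable _ M) => [|w]; last by rewrite normr_id.
  apply: measurableT_comp => //; apply: measurableT_comp => //.
  exact: measurable_funD.
- by apply: (@bounded_integrable _ `|M|).
Qed.

Lemma bounded_measurable_average g : bounded_measurable g -> bounded_measurable (T g).
Proof.
move=> bg; have [mg [M gM]] := bg.
split; last by exists M => x; exact: average_norm.
have TE x : T g x = fine (\int[P]_w (g (x + X w) + M)%:E)%E - M.
  rewrite -[fine _]/(\int[P]_w (g (x + X w) + M)) RintegralD//.
  - by rewrite Rintegral_cst// [X in fine X](@probability_setT _ _ _ P) mulr1 addrK.
  - exact: average_integrable.
  - by apply: (@bounded_integrable _ `|M|).
rewrite (funext TE); apply: measurable_funB => //.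
apply: measurableT_comp => //.
apply: (@measurable_fun_fubini_tonelli_F _ _ _ _ _ P
  (fun z : R * Omega => (g (z.1 + X z.2) + M)%:E)) => /=.
  apply/measurable_EFinP; apply: measurable_funD => //; apply: measurableT_comp => //.
  by apply: measurable_funD => //; exact: measurableT_comp.
move=> z; rewrite lee_fin -lerBlDr sub0r.
by have := gM (z.1 + X z.2); rewrite ler_norml => /andP[].
Qed.

Lemma bounded_measurable_iter k g :
  bounded_measurable g -> bounded_measurable (iter k T g).
Proof. by move=> bg; elim: k => //= k; exact: bounded_measurable_average. Qed.

Lemma le_iter_average k g h : bounded_measurable g -> bounded_measurable h ->
  (forall y, g y <= h y) -> forall x, iter k T g x <= iter k T h x.
Proof.
move=> bg bh gh; elim: k => //= k IH x.
by apply: le_average => //; exact: bounded_measurable_iter.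
Qed.

Lemma iter_average_cst k c x : iter k T (fun=> c) x = c.
Proof.
elim: k x => //= k IH x; rewrite -[RHS](average_cst c x).
by congr average; apply/funext.
Qed.

(** Adding a bound [M] of [g] makes the integrand nonnegative. *)
Lemma average_eq_law (Y : Omega -> R) g x : measurable_fun setT Y ->
  (forall f, measurable_fun setT f -> (forall z, 0 <= f z)%E ->
    \int[P]_w f (X w) = \int[P]_w f (Y w))%E ->
  bounded_measurable g -> T g x = average P Y g x.
Proof.
move=> mY law [mg [M gM]].
have shift (Z : Omega -> R) : measurable_fun setT Z ->
    average P Z g x = \int[P]_w (g (x + Z w) + M) - M.
  move=> mZ; have ig : P.-integrable setT (EFin \o (fun w => g (x + Z w))).
    apply: (@bounded_integrable _ M) => //; apply: measurableT_comp => //.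
    exact: measurable_funD.
  rewrite RintegralD//; last exact: (@bounded_integrable _ `|M|).
  by rewrite Rintegral_cst// [X in fine X](@probability_setT _ _ _ P) mulr1 addrK.
rewrite (shift X)// (shift Y)//; apply: (congr1 (fun t => t - M)).
rewrite /Rintegral; congr fine; apply: (law (fun z => (g (x + z) + M)%:E)).
  apply/measurable_EFinP; apply: measurable_funD => //.
  by apply: measurableT_comp => //; exact: measurable_funD.
move=> z; rewrite lee_fin -lerBlDr sub0r.
by have := gM (x + z); rewrite ler_norml => /andP[].
Qed.

End average.

Section bounded_measurable.
Context (R : realType).
Implicit Types g h : R -> R.

Lemma bounded_measurableD g h : bounded_measurable g -> bounded_measurable h ->
  bounded_measurable (fun y => g y + h y).
Proof.
move=> [mg [M gM]] [mh [M' hM']]; split; first exact: measurable_funD.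
by exists (M + M') => x; rewrite (le_trans (ler_normD _ _))// lerD.
Qed.

Lemma bounded_measurableZ c g : bounded_measurable g ->
  bounded_measurable (fun y => c * g y).
Proof.
move=> [mg [M gM]]; split; first exact: measurable_funM.
by exists (`|c| * M) => x; rewrite normrM ler_wpM2l.
Qed.

Lemma bounded_measurable_cst (c : R) : bounded_measurable (fun=> c).
Proof. by split => //; exists `|c|. Qed.

Lemma bounded_measurable_indic (A : set R) : measurable A ->
  bounded_measurable (\1_A : R -> R).
Proof.
move=> mA; split; first exact: measurable_indic.
by exists 1 => x; rewrite indicE; case: (_ \in _); rewrite ?normr1 ?normr0.
Qed.

End bounded_measurable.

Section iter_linear.
Context d (Omega : measurableType d) (R : realType) (P : probability Omega R).
Variable X : Omega -> R.
Hypothesis mX : measurable_fun setT X.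
Local Notation T := (average P X).

Lemma iter_averageD k g h x : bounded_measurable g -> bounded_measurable h ->
  iter k T (fun y => g y + h y) x = iter k T g x + iter k T h x.
Proof.
move=> bg bh; elim: k x => //= k IH x.
by rewrite -averageD//; [congr average; apply/funext|exact: bounded_measurable_iter..].
Qed.

Lemma iter_averageZ k c g x : bounded_measurable g ->
  iter k T (fun y => c * g y) x = c * iter k T g x.
Proof.
move=> bg; elim: k x => //= k IH x.
by rewrite -averageZ//; [congr average; apply/funext|exact: bounded_measurable_iter].
Qed.

End iter_linear.

(** * One step on gently curved functions *)

Definition second_difference (R : realType) (h : R -> R) (u x : R) : R :=
  h (x + u) + h (x - u) - 2 * h x.

(** What a function of [a * x] with bounded second and third derivatives
    satisfies. It is stated with finite differences so that it passes to the
    averages of the function without derivatives under the integral. *)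
Definition gently_curved (R : realType) (C a : R) (h : R -> R) :=
  [/\ bounded_measurable h,
      forall x u, `|second_difference h u x| <= C * a ^+ 2 * u ^+ 2 &
      forall x u, `|second_difference h u x - u ^+ 2 * second_difference h 1 x| <=
                  C * a ^+ 3 * u ^+ 2 * (`|u| + 1)].

(** The error of the second order expansion relative to [a ^+ 2]: where
    [a * `|X|] is small the third order bound applies, elsewhere the second
    order one. *)
Definition truncated_variance d (Omega : measurableType d) (R : realType)
    (P : probability Omega R) (X : Omega -> R) (a : R) : R :=
  \int[P]_w (X w ^+ 2 * Num.min 2 (a * (`|X w| + 1))).

Section taylor.
Context d (Omega : measurableType d) (R : realType) (P : probability Omega R).
Variable X : Omega -> R.
Hypothesis mX : measurable_fun setT X.
Implicit Types h : R -> R.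
Local Notation T := (average P X).
Local Notation D := (@second_difference R).

Lemma bounded_measurable_shift h u : bounded_measurable h ->
  bounded_measurable (fun y => h (y + u)).
Proof.
move=> [mh [M hM]]; split; last by exists M.
by apply: measurableT_comp => //; exact: measurable_funD.
Qed.

Lemma bounded_measurable_D2 h u : bounded_measurable h ->
  bounded_measurable (D h u).
Proof.
move=> bh; rewrite /second_difference.
apply: (@bounded_measurableD _ (fun y => h (y + u) + h (y - u)) (fun y => - (2 * h y))).
  by apply: bounded_measurableD; exact: bounded_measurable_shift.
rewrite (_ : (fun y => _) = (fun y => -2 * h y)); first exact: bounded_measurableZ.
by apply/funext => y; rewrite mulNr.
Qed.

Lemma average_shift h u x : T h (x + u) = T (fun y => h (y + u)) x.
Proof. by rewrite /average; under eq_Rintegral do rewrite addrAC. Qed.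

Lemma average_D2 h u x : bounded_measurable h ->
  D (T h) u x = T (D h u) x.
Proof.
move=> bh; rewrite /second_difference !average_shift -averageD//.
rewrite (_ : - (2 * T h x) = T (fun y => -2 * h y) x); last by rewrite averageZ// mulNr.
rewrite -averageD//.
- by congr average; apply/funext => y; rewrite mulNr.
- by apply: bounded_measurableD; exact: bounded_measurable_shift.
- exact: bounded_measurableZ.
- exact: bounded_measurable_shift.
- exact: bounded_measurable_shift.
Qed.

Lemma gently_curved_average C a h : gently_curved C a h -> gently_curved C a (T h).
Proof.
move=> [bh h1 h2]; split; first exact: bounded_measurable_average.
- move=> x u; rewrite average_D2//; apply: average_norm => //.
  by have [] := bounded_measurable_D2 u bh.
- move=> x u; rewrite !average_D2//.
  rewrite -mulNr -averageZ//; last exact: bounded_measurable_D2.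
  rewrite -averageD//; last 2 first.
  + exact: bounded_measurable_D2.
  + by apply: bounded_measurableZ; exact: bounded_measurable_D2.
  apply: average_norm => // [|y]; last by rewrite mulNr.
  apply: measurable_funD; first by have [] := bounded_measurable_D2 u bh.
  by apply: measurable_funM => //; have [] := bounded_measurable_D2 1 bh.
Qed.

Hypothesis symX : forall h x, bounded_measurable h ->
  T h x = average P (fun w => - X w) h x.
Hypothesis varX : (\int[P]_w (X w ^+ 2)%:E = 1)%E.

Let X2_integrable : P.-integrable setT (EFin \o (fun w => X w ^+ 2)).
Proof.
apply/integrableP; split; first by apply/measurable_EFinP; exact: measurable_funX.
under eq_integral do rewrite /= ger0_norm ?sqr_ge0//.
by rewrite varX ltry.
Qed.

Let mtrunc (a : R) : measurable_fun setT (fun w => X w ^+ 2 * Num.min 2 (a * (`|X w| + 1))).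
Proof.
apply: measurable_funM; first exact: measurable_funX.
apply: measurable_minr => //; apply: measurable_funM => //.
by apply: measurable_funD => //; exact: measurableT_comp.
Qed.

Let trunc_ge0 (a u : R) : 0 < a -> 0 <= u ^+ 2 * Num.min 2 (a * (`|u| + 1)).
Proof.
by move=> a0; rewrite mulr_ge0 ?sqr_ge0// le_min ler0n /= mulr_ge0 ?(ltW a0)// addr_ge0.
Qed.

Let trunc_le (a u : R) : u ^+ 2 * Num.min 2 (a * (`|u| + 1)) <= 2 * u ^+ 2.
Proof. by rewrite mulrC ler_wpM2r ?sqr_ge0// ge_min lexx. Qed.

Let trunc_integrable (a : R) : 0 < a ->
  P.-integrable setT (EFin \o (fun w => X w ^+ 2 * Num.min 2 (a * (`|X w| + 1)))).
Proof.
move=> a0.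
apply: (@le_integrable _ _ _ P setT measurableT _
  (EFin \o (fun w => 2 * X w ^+ 2))).
- exact/measurable_EFinP.
- move=> w _ /=; rewrite lee_fin ger0_norm ?trunc_ge0// (le_trans (trunc_le _ _))//.
  exact: ler_norm.
- under [X in _.-integrable _ X]eq_fun do rewrite /= EFinM.
  exact: integrableZl.
Qed.

(** Since [X] and [- X] have the same law, [T h x - h x] is half the mean of the
    second difference of [h] with step [X]; as [X ^+ 2] has mean [1], replacing
    this second difference by [X ^+ 2] times the one with step [1] leaves
    [second_difference h 1 x / 2]. This main term does not depend on the law
    of [X]. *)
Lemma average_taylor C a h x : 0 <= C -> 0 < a -> gently_curved C a h ->
  `|T h x - h x - D h 1 x / 2| <= C * a ^+ 2 / 2 * truncated_variance P X a.
Proof.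
move=> C0 a0 [bh h1 h2].
have iD : P.-integrable setT (EFin \o (fun w => D h (X w) x)).
  have [mh [M hM]] := bh.
  apply: (@bounded_integrable _ _ _ _ _ (M + M + 2 * M)).
    apply: measurable_funB; last exact: measurable_cst.
    apply: measurable_funD; apply: measurableT_comp => //.
      exact: measurable_funD.
    exact: measurable_funB.
  move=> w; rewrite /second_difference.
  rewrite (le_trans (ler_normB _ _))// lerD//.
    by rewrite (le_trans (ler_normD _ _))// lerD.
  by rewrite normrM ger0_norm// ler_wpM2l.
have mX' : measurable_fun setT (fun w => - X w) by exact: measurableT_comp.
have E1 : \int[P]_w D h (X w) x = 2 * (T h x - h x).
  have i1 := average_integrable P mX x bh.
  have i2 := average_integrable P mX' x bh.
  rewrite /second_difference RintegralB//.
  - rewrite RintegralD// -/(average P X h x) -/(average P (fun w => - X w) h x).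
    rewrite -symX// Rintegral_cst// [X in fine X](@probability_setT _ _ _ P).
    by rewrite mulr1; ring.
  - exact: (integrableD measurableT i1 i2).
  - exact: finite_measure_integrable_cst.
have i3 : P.-integrable setT (EFin \o (fun w => X w ^+ 2 * D h 1 x)).
  under [X in _.-integrable _ X]eq_fun do rewrite /= EFinM.
  exact: integrableZr.
have E2 : \int[P]_w (D h (X w) x - X w ^+ 2 * D h 1 x) = 2 * (T h x - h x) - D h 1 x.
  rewrite RintegralB// E1 RintegralZr//; congr (_ - _).
  by rewrite /Rintegral varX /= mul1r.
have -> : T h x - h x - D h 1 x / 2 =
    2^-1 * \int[P]_w (D h (X w) x - X w ^+ 2 * D h 1 x) by rewrite E2; field.
rewrite normrM ger0_norm ?invr_ge0// [leRHS]mulrAC [leRHS]mulrC ler_wpM2l ?invr_ge0//.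
have iB := integrableB measurableT iD i3.
apply: le_trans (le_normr_Rintegral measurableT _) _; first exact: iB.
rewrite -RintegralZl//; last exact: trunc_integrable.
apply: le_Rintegral => //.
- exact: integrable_norm iB.
- under [X in _.-integrable _ X]eq_fun do rewrite /= EFinM.
  by apply: integrableZl => //; exact: trunc_integrable.
- move=> w _; set u := X w.
  have Cau : 0 <= C * a ^+ 2 * u ^+ 2.
    by apply: mulr_ge0; [apply: mulr_ge0|]; rewrite ?sqr_ge0.
  rewrite mulrA minr_pMr// le_min; apply/andP; split.
    apply: le_trans (ler_normB _ _) _.
    have := h1 x u; have := h1 x 1; rewrite normrM (ger0_norm (sqr_ge0 u)).
    move=> k1 k2; have : u ^+ 2 * `|D h 1 x| <= u ^+ 2 * (C * a ^+ 2 * 1 ^+ 2).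
      by rewrite ler_wpM2l ?sqr_ge0.
    lra.
  by apply: le_trans (h2 x u) _; rewrite le_eqVlt; apply/orP; left; apply/eqP; ring.
Qed.

(** Dominated convergence, with [2 * X ^+ 2] as the dominating function: this is
    where a second moment is enough. *)
Lemma truncated_variance_cvg0 e : 0 < e -> exists K : nat, forall k : nat, (K <= k)%N ->
  truncated_variance P X (Num.sqrt k.+1%:R)^-1 <= e.
Proof.
move=> e0.
pose f (k : nat) w : \bar R :=
  (X w ^+ 2 * Num.min 2 ((Num.sqrt k.+1%:R)^-1 * (`|X w| + 1)))%:E.
have a0 (k : nat) : 0 < (Num.sqrt k.+1%:R)^-1 :> R by rewrite invr_gt0 sqrtr_gt0.
have a_cvg : (Num.sqrt k.+1%:R)^-1 @[k --> \oo] --> (0 : R).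
  rewrite (_ : (fun k : nat => _) = Num.sqrt \o @harmonic R).
    rewrite -(@sqrtr0 R); apply: continuous_cvg; last exact: cvg_harmonic.
    exact: sqrt_continuous.
  by apply/funext => k /=; rewrite sqrtrV.
have [] := @dominated_convergence _ _ R P setT measurableT f (cst 0%E)
  (fun w => (2 * X w ^+ 2)%:E).
- by move=> k; exact/measurable_EFinP.
- exact: measurable_cst.
- apply: nearW => w _; apply: cvg_EFin; first exact: nearW.
  apply: (@squeeze_cvgr _ _ _ _ (cst 0)
    (fun k : nat => (Num.sqrt k.+1%:R)^-1 * (X w ^+ 2 * (`|X w| + 1)))).
  + apply: nearW => k /=; rewrite trunc_ge0//= mulrCA ler_wpM2l ?sqr_ge0//.
    by rewrite ge_min lexx orbT.
  + exact: cvg_cst.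
  + rewrite -[X in _ --> X](mul0r (X w ^+ 2 * (`|X w| + 1))).
    by apply: cvgM => //; exact: cvg_cst.
- under [X in _.-integrable _ X]eq_fun do rewrite /= EFinM.
  exact: integrableZl.
- apply: nearW => w k _; rewrite gee0_abs; last by rewrite lee_fin trunc_ge0.
  by rewrite lee_fin; exact: trunc_le.
move=> _ _; rewrite integral_cst// mul0e => fc.
have := fine_cvg fc => /(_ _) /cvgrPdist_le /(_ e e0) [K _ Kf].
exists K => k /Kf /=; rewrite sub0r normrN; apply: le_trans.
exact: ler_norm.
Qed.

End taylor.

(** * Logistic test functions *)

Section logistic.
Context (R : realType).
Implicit Types (f : R -> R) (x u : R).

Lemma mean_value f df a b : (forall x, is_derive x 1 f (df x)) -> a < b ->
  exists2 c, a < c < b & f b - f a = df c * (b - a).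
Proof.
move=> dfE ab; have cf : continuous f.
  by move=> x; apply/differentiable_continuous/derivable1_diffP; have [] := dfE x.
have [c cab fE] := MVT ab (fun x _ => dfE x) (continuous_subspaceT cf).
by exists c.
Qed.

Lemma is_derive_shift f df x c : is_derive (c + x) 1 f df ->
  is_derive x 1 (fun t => f (c + t)) df.
Proof.
move=> h; rewrite -[df]mulr1; apply: (@is_derive1_comp _ f (fun t => c + t)).
by rewrite -[X in is_derive _ _ _ X](add0r (1 : R)); apply: is_deriveD.
Qed.

(** The mean value theorem twice, first for [t |-> f (x + t) - f (x - u + t)]. *)
Lemma second_difference_derive f f1 f2 x u :
  (forall x, is_derive x 1 f (f1 x)) -> (forall x, is_derive x 1 f1 (f2 x)) ->
  exists2 y, `|y - x| <= `|u| & second_difference f u x = u ^+ 2 * f2 y.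
Proof.
move=> df1 df2.
wlog u0 : u / 0 <= u.
  move=> H; have [|u0] := leP 0 u; first exact: H.
  have [|y yx yE] := H (- u); first by rewrite oppr_ge0 ltW.
  exists y; first by rewrite normrN in yx.
  rewrite sqrrN in yE; rewrite -yE /second_difference opprK.
  by rewrite [f (x + u) + _]addrC.
have [->|un0] := eqVneq u 0.
  exists x; first by rewrite subrr normr0.
  by rewrite /second_difference subr0 addr0 expr0n /= mul0r; ring.
have {un0}u0 : 0 < u by rewrite lt_neqAle eq_sym un0.
pose k t := f (x + t) - f (x - u + t).
have dk (t : R) : is_derive t 1 k (f1 (x + t) - f1 (x - u + t)).
  by apply: is_deriveB; exact: is_derive_shift.
have [c /andP[c0 cu] kE] := mean_value dk u0.
have cc : x - u + c < x + c by lra.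
have [y /andP[y1 y2] yE] := mean_value df2 cc.
exists y; first by rewrite (gtr0_norm u0) ler_norml; apply/andP; split; lra.
have -> : second_difference f u x = k u - k 0.
  by rewrite /k /second_difference subrK !addr0; ring.
by rewrite kE yE subr0; ring.
Qed.

Lemma lipschitz_derive f df x y : (forall x, is_derive x 1 f (df x)) ->
  (forall x, `|df x| <= 1) -> `|f x - f y| <= `|x - y|.
Proof.
move=> dfE df1; wlog xy : x y / y < x.
  move=> H; have [xy|yx|->] := ltgtP x y; last by rewrite !subrr normr0.
    by rewrite distrC [leRHS]distrC H.
  exact: H.
have [c _ ->] := mean_value dfE xy.
by rewrite normrM ler_piMl.
Qed.

Definition logistic x := (1 + expR x)^-1.

Let p1 x : 0 < 1 + expR x.
Proof. by rewrite addr_gt0// expR_gt0. Qed.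

Lemma logistic_gt0 x : 0 < logistic x.
Proof. by rewrite invr_gt0. Qed.

Lemma logistic_lt1 x : logistic x < 1.
Proof. by rewrite invf_lt1// ltrDl expR_gt0. Qed.

Lemma logistic_le_expRN x : logistic x <= expR (- x).
Proof. by rewrite expRN lef_pV2 ?posrE ?expR_gt0// lerDr. Qed.

Lemma logistic_decr x y : x <= y -> logistic y <= logistic x.
Proof. by move=> xy; rewrite lef_pV2 ?posrE// lerD2l ler_expR. Qed.

Lemma logisticN x : logistic (- x) = 1 - logistic x.
Proof.
rewrite /logistic expRN; have := expR_gt0 x => e0.
by field; rewrite !gt_eqF// addr_gt0.
Qed.

Lemma is_derive_logistic x :
  is_derive x 1 logistic (- (logistic x * (1 - logistic x))).
Proof.
have dE : is_derive x 1 (fun t : R => 1 + expR t) (expR x).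
  by rewrite -[X in is_derive _ _ _ X]add0r; apply: is_deriveD.
apply: (is_derive_eq (is_deriveV _ dE)); first by rewrite gt_eqF.
rewrite /logistic /GRing.scale /=; have p0 := lt0r_neq0 (p1 x).
by field.
Qed.

Let l1 x := - (logistic x * (1 - logistic x)).
Let l2 x := logistic x * (1 - logistic x) * (1 - 2 * logistic x).
Let l3 x := - (logistic x * (1 - logistic x)) * (1 - 6 * logistic x + 6 * logistic x ^+ 2).

Let dl1 x : is_derive x 1 l1 (l2 x).
Proof.
have d1 := is_derive_logistic x.
have d2 := is_deriveN (is_deriveM d1 (is_deriveB (is_derive_cst (1 : R) x (1 : R)) d1)).
apply: (is_derive_eq (d2 : is_derive x 1 l1 _)).
rewrite /l2 /GRing.scale /= ?fctE; ring.
Qed.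

Let dl2 x : is_derive x 1 l2 (l3 x).
Proof.
have d1 := is_derive_logistic x.
have d2 := is_deriveM d1 (is_deriveB (is_derive_cst (1 : R) x (1 : R)) d1).
have d3 := is_deriveB (is_derive_cst (1 : R) x (1 : R)) (is_deriveM (is_derive_cst (2 : R) x (1 : R)) d1).
apply: (is_derive_eq (is_deriveM d2 d3 : is_derive x 1 l2 _)).
rewrite /l3 /GRing.scale /= ?fctE; ring.
Qed.

Let l2_le1 x : `|l2 x| <= 1.
Proof.
have := logistic_gt0 x; have := logistic_lt1 x; rewrite /l2.
set p := logistic x => p_lt1 p_gt0.
by rewrite ler_norml; apply/andP; split; nra.
Qed.

Let l3_le1 x : `|l3 x| <= 1.
Proof.
have := logistic_gt0 x; have := logistic_lt1 x; rewrite /l3.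
set p := logistic x => p_lt1 p_gt0.
have q0 : 0 <= p * (1 - p) by nra.
have q1 : p * (1 - p) <= 1 / 4 by have := sqr_ge0 (p - 1 / 2); nra.
have -> : - (p * (1 - p)) * (1 - 6 * p + 6 * p ^+ 2) =
  - (p * (1 - p)) + 6 * (p * (1 - p)) ^+ 2 by ring.
set q := p * (1 - p) in q0 q1 *.
by rewrite ler_norml; apply/andP; split; nra.
Qed.

Lemma logistic_second_difference x u :
  `|second_difference logistic u x| <= u ^+ 2.
Proof.
have [y _ ->] := second_difference_derive x u is_derive_logistic dl1.
by rewrite normrM ger0_norm ?sqr_ge0// ler_piMr ?sqr_ge0.
Qed.

(** Both second differences are values of the second derivative at points within
    [`|u|] and [`|v|] of [x], and the second derivative is 1-Lipschitz. *)
Lemma logistic_second_difference_taylor x u v :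
  `|v ^+ 2 * second_difference logistic u x -
    u ^+ 2 * second_difference logistic v x| <= u ^+ 2 * v ^+ 2 * (`|u| + `|v|).
Proof.
have [y yx ->] := second_difference_derive x u is_derive_logistic dl1.
have [z zx ->] := second_difference_derive x v is_derive_logistic dl1.
have uv0 : 0 <= u ^+ 2 * v ^+ 2 by rewrite mulr_ge0 ?sqr_ge0.
have -> : v ^+ 2 * (u ^+ 2 * l2 y) - u ^+ 2 * (v ^+ 2 * l2 z) =
  u ^+ 2 * v ^+ 2 * (l2 y - l2 z) by ring.
rewrite normrM ger0_norm// ler_wpM2l//.
apply: le_trans (lipschitz_derive y z dl2 l3_le1) _.
have -> : y - z = (y - x) - (z - x) by ring.
by apply: le_trans (ler_normB _ _) _; exact: lerD.
Qed.

Lemma gently_curved_logistic kappa beta a : 1 <= kappa -> 0 < a ->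
  gently_curved (kappa ^+ 3) a (fun x => logistic (kappa * (a * x - beta))).
Proof.
move=> k1 a0; have k0 : 0 < kappa by exact: lt_le_trans k1.
have D2E u x : second_difference (fun x => logistic (kappa * (a * x - beta))) u x =
    second_difference logistic (kappa * a * u) (kappa * (a * x - beta)).
  by rewrite /second_difference; congr (logistic _ + logistic _ - _); ring.
split.
- split.
    apply: continuous_measurable_fun => x.
    apply: (@continuous_comp _ _ _ (fun x => kappa * (a * x - beta)) logistic).
      apply: cvgM; first exact: cvg_cst.
      apply: cvgB; last exact: cvg_cst.
      by apply: cvgM; [exact: cvg_cst|exact: cvg_id].
    apply/differentiable_continuous/derivable1_diffP.
    by have [] := is_derive_logistic (kappa * (a * x - beta)).
  exists 1 => x; rewrite ger0_norm; first exact/ltW/logistic_lt1.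
  exact/ltW/logistic_gt0.
- move=> x u; rewrite D2E; apply: le_trans (logistic_second_difference _ _) _.
  rewrite !exprMn ler_wpM2r ?sqr_ge0// ler_wpM2r ?sqr_ge0//.
  exact: ler_weXn2l.
- move=> x u; rewrite !D2E.
  have ka0 : 0 < kappa * a by rewrite mulr_gt0.
  have := logistic_second_difference_taylor (kappa * (a * x - beta)) (kappa * a * u) (kappa * a * 1).
  set Du := second_difference _ _ _; set D1 := second_difference _ _ _.
  have -> : (kappa * a * 1) ^+ 2 * Du - (kappa * a * u) ^+ 2 * D1 =
    (kappa * a) ^+ 2 * (Du - u ^+ 2 * D1) by ring.
  rewrite normrM (ger0_norm (sqr_ge0 _)) !normrM (gtr0_norm k0) (gtr0_norm a0) normr1.
  have -> : (kappa * a * u) ^+ 2 * (kappa * a * 1) ^+ 2 * (kappa * a * `|u| + kappa * a * 1) =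
    (kappa * a) ^+ 2 * (kappa ^+ 3 * a ^+ 3 * u ^+ 2 * (`|u| + 1)) by ring.
  by rewrite ler_pM2l// exprn_gt0.
Qed.

(** A steep logistic function lies between the indicators of two half-lines whose
    ends differ by [2 * delta], up to [e]. *)
Lemma logistic_approx (delta e : R) : 0 < delta -> 0 < e ->
  exists2 kappa, 1 <= kappa & forall x,
    (x <= 0 -> 1 - e <= logistic (kappa * (x - delta))) /\
    (0 < x -> logistic (kappa * (x + delta)) <= e).
Proof.
move=> d0 e0; pose kappa := 1 + (delta * e)^-1.
have i0 : 0 < (delta * e)^-1 by rewrite invr_gt0 mulr_gt0.
have k1 : 1 <= kappa by rewrite lerDl ltW.
have k0 : 0 < kappa by exact: lt_le_trans k1.
have small : expR (- (kappa * delta)) <= e.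
  rewrite expRN -[leRHS]invrK lef_pV2 ?posrE ?expR_gt0 ?invr_gt0//.
  apply: le_trans (expR_ge1Dx _).
  have -> : kappa * delta = delta + e^-1.
    by rewrite /kappa; field; rewrite !gt_eqF.
  by lra.
exists kappa => // x; split=> x0.
  apply: (@le_trans _ _ (logistic (- (kappa * delta)))).
    by rewrite logisticN lerD2l lerN2 (le_trans (logistic_le_expRN _)).
  by apply: logistic_decr; rewrite -mulrN ler_wpM2l ?(ltW k0)//; lra.
apply: le_trans small; apply: le_trans (logistic_le_expRN _).
by apply: logistic_decr; rewrite ler_wpM2l ?(ltW k0)//; lra.
Qed.

End logistic.

(** * A central limit theorem uniform in the starting point *)

Section gaussian_average.
Context (R : realType).
Local Notation N01 := (normal_prob (0 : R) 1).
Implicit Types g h : R -> R.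

(** The heat semigroup at integer times: by [average_heat], the effect of [k]
    standard Gaussian steps. *)
Definition heat (k : nat) : (R -> R) -> R -> R :=
  average N01 (fun z => Num.sqrt k%:R * z).

Let mscale (c : R) : measurable_fun setT (fun z : R => c * z).
Proof. exact: measurable_funM. Qed.

Lemma heat0 g : heat 0 g = g.
Proof.
apply/funext => x; rewrite /heat /average sqrtr0.
under eq_Rintegral do rewrite mul0r addr0.
exact: (average_cst N01 (fun=> 0) (g x) x).
Qed.

Lemma heat1 g : heat 1 g = average N01 id g.
Proof.
apply/funext => x; rewrite /heat /average sqrtr1.
by under eq_Rintegral do rewrite mul1r.
Qed.

Lemma bounded_measurable_heat k g : bounded_measurable g -> bounded_measurable (heat k g).
Proof. by move=> bg; apply: bounded_measurable_average => //; exact: mscale. Qed.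

Lemma average_normal_sym h x : bounded_measurable h ->
  average N01 id h x = average N01 (fun z => - z) h x.
Proof.
apply: average_eq_law => //; first exact: oppr_measurable.
by move=> f mf f0; rewrite integral_nuN.
Qed.

Lemma average_heat g k x : bounded_measurable g -> (forall y, 0 <= g y) ->
  average N01 id (heat k g) x = heat k.+1 g x.
Proof.
move=> bg g0; case: k => [|k]; first by rewrite heat0 heat1.
have sk (n : nat) : 0 < Num.sqrt n.+1%:R :> R by rewrite sqrtr_gt0.
apply: EFin_inj; rewrite EFin_average//; last exact: bounded_measurable_heat.
rewrite [RHS]EFin_average//; last exact: mscale.
have mg : measurable_fun setT (EFin \o g) by apply/measurable_EFinP; case: bg.
have ts : Num.sqrt k.+2%:R ^+ 2 = 1 + Num.sqrt k.+1%:R ^+ 2 :> R.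
  by rewrite !sqr_sqrtr// -[k.+2]add1n natrD.
apply: etrans (@integral_nu_semigroup R x _ _ (EFin \o g) (sk k) (sk k.+1) ts mg _).
  by apply: eq_integral => y _; rewrite EFin_average//; exact: mscale.
by move=> y; rewrite lee_fin.
Qed.

Definition Phi (t : R) : R := fine (N01 `]-oo, t]).

Lemma heat_indic k b x : (0 < k)%N ->
  heat k \1_`]-oo, b] x = Phi ((b - x) / Num.sqrt k%:R).
Proof.
move=> k0; have s0 : 0 < Num.sqrt k%:R :> R by rewrite sqrtr_gt0 ltr0n.
rewrite /heat /average /Rintegral /Phi; congr fine.
rewrite -[in RHS](setIT `]-oo, _]%classic) -integral_indic//; apply: eq_integral => z _.
rewrite !indicE; congr ((nat_of_bool _)%:R)%:E.
by rewrite !mem_setE !in_itv /= ler_pdivlMr// lerBrDl mulrC.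
Qed.

(** The standard Gaussian density is at most [1]. *)
Lemma Phi_lipschitz s t : s <= t -> Phi s <= Phi t <= Phi s + (t - s).
Proof.
move=> st; have fin A : measurable A -> N01 A \is a fin_num.
  by move=> mA; exact: fin_num_measure.
have E : N01 `]-oo, t] = (N01 `]-oo, s] + N01 `]s, t])%E.
  rewrite -measureU//.
    congr (N01 _); rewrite -itv_bndbnd_setU//; by rewrite bnd_simp.
  apply/seteqP; split => // x [] /=; rewrite !in_itv /= => xs /andP[sx _].
  by move: xs; rewrite leNgt sx.
have st_le : (N01 `]s, t] <= (t - s)%:E)%E.
  have pk : normal_peak (1 : R) <= 1.
    have p2 := pi_ge2 R; have p0 : 1 <= (pi : R) *+ 2 by rewrite mulr2n; lra.
    have s1 : 1 <= Num.sqrt ((pi : R) *+ 2) by rewrite -[leLHS]sqrtr1 ler_wsqrtr.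
    by rewrite /normal_peak expr1n mul1r invf_le1// (lt_le_trans ltr01).
  have mst : measurable (`]s, t]%classic : set (measurableTypeR R)) by exact: measurable_itv.
  change (\int[lebesgue_measure]_(x in `]s, t]) (normal_pdf 0 1 x)%:E <= (t - s)%:E)%E.
  apply: (@le_trans _ _ (\int[lebesgue_measure]_(x in `]s, t]) (cst 1%E x))%E).
    apply: ge0_le_integral => //.
    - by move=> x _; rewrite lee_fin normal_pdf_ge0.
    - by apply/measurable_EFinP/measurable_funTS; exact: measurable_normal_pdf.
    - by move=> x _; rewrite lee_fin (le_trans (normal_pdf_ub _ _ (oner_neq0 R))).
  rewrite integral_cst// mul1e /= lebesgue_measure_itv /= lte_fin.
  by case: ltP => // _; rewrite lee_fin subr_ge0.
have f1 : N01 `]-oo, s] \is a fin_num by apply: fin; exact: measurable_itv.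
have f2 : N01 `]s, t] \is a fin_num by apply: fin; exact: measurable_itv.
rewrite /Phi E (fineD f1 f2); apply/andP; split.
  by rewrite lerDl; apply: fine_ge0; exact: measure_ge0.
by rewrite lerD2l -lee_fin (fineK f2).
Qed.

End gaussian_average.

Section clt.
Context d (Omega : measurableType d) (R : realType) (P : probability Omega R).
Variable X : Omega -> R.
Hypothesis mX : measurable_fun setT X.
Hypothesis symX : forall h x, bounded_measurable h ->
  average P X h x = average P (fun w => - X w) h x.
Hypothesis varX : (\int[P]_w (X w ^+ 2)%:E = 1)%E.
Local Notation T := (average P X).
Local Notation N01 := (normal_prob (0 : R) 1).

(** Exchanging one step for a Gaussian one: the main terms of [average_taylor]
    are the same for both. *)
Let replace_step C a g i x : 0 <= C -> 0 < a -> gently_curved C a g ->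
  (forall y, 0 <= g y) ->
  `|T (heat i g) x - heat i.+1 g x| <=
  C * a ^+ 2 / 2 * (truncated_variance P X a + truncated_variance N01 id a).
Proof.
move=> C0 a0 cg g0; have [bg _ _] := cg.
have ch : gently_curved C a (heat i g).
  by apply: gently_curved_average => //; exact: measurable_funM.
rewrite -average_heat//.
have t1 := average_taylor mX symX varX x C0 a0 ch.
have t2 := @average_taylor _ _ R N01 id (@measurable_id _ _ setT) (@average_normal_sym R) (variance_nu R) C a (heat i g) x C0 a0 ch.
set A := _ / 2 in t1 t2.
have -> : T (heat i g) x - average N01 id (heat i g) x =
  (T (heat i g) x - heat i g x - A) - (average N01 id (heat i g) x - heat i g x - A) by ring.
by apply: le_trans (ler_normB _ _) _; rewrite mulrDr lerD.
Qed.

Let replace_all C a g k x : 0 <= C -> 0 < a -> gently_curved C a g ->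
  (forall y, 0 <= g y) ->
  `|iter k T g x - heat k g x| <= k%:R *
  (C * a ^+ 2 / 2 * (truncated_variance P X a + truncated_variance N01 id a)).
Proof.
move=> C0 a0 cg g0; have [bg _ _] := cg.
elim: k x => [|k IH] x; first by rewrite /= heat0 subrr normr0 mul0r.
have -> : iter k.+1 T g x - heat k.+1 g x =
  T (fun y => iter k T g y + -1 * heat k g y) x + (T (heat k g) x - heat k.+1 g x).
  rewrite averageD//=; last 2 first.
  - exact: bounded_measurable_iter.
  - by apply: bounded_measurableZ; exact: bounded_measurable_heat.
  rewrite averageZ//; last exact: bounded_measurable_heat.
  by ring.
apply: le_trans (ler_normD _ _) _; rewrite -natr1 mulrDl mul1r.
apply: lerD; last exact: replace_step.
apply: average_norm => // [|y]; last by rewrite mulN1r.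
have [m1 _] := bounded_measurable_iter P mX k bg.
have [m2 _] := bounded_measurable_heat k bg.
by apply: measurable_funD => //; exact: measurable_funM.
Qed.

(** Lindeberg's replacement: each of the [k] exchanges costs [C / k] times
    truncated variances that tend to [0], for a test function that varies on the
    scale [sqrt k]. The indicator of a half-line is sandwiched between logistic
    functions at the price of shifting its end by [sqrt k * e / 4], harmless
    since [Phi] is Lipschitz. Nothing depends on [b] and [x]. *)
Theorem clt_iter_average (e : R) : 0 < e -> exists K : nat, forall k : nat, (K <= k)%N ->
  forall b x, `|iter k T \1_`]-oo, b] x - Phi ((b - x) / Num.sqrt k%:R)| <= e.
Proof.
move=> e0; have e4 : 0 < e / 4 by rewrite divr_gt0.
have e8 : 0 < e / 8 by rewrite divr_gt0.
have [kappa k1 lg] := logistic_approx e8 e4.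
have kap0 : 0 < kappa by exact: lt_le_trans k1.
have e' : 0 < e / (4 * kappa ^+ 3) by rewrite divr_gt0// mulr_gt0// exprn_gt0.
have [K1 K1P] := truncated_variance_cvg0 mX varX e'.
have [K2 K2P] := @truncated_variance_cvg0 _ _ R N01 id (@measurable_id _ _ setT) (variance_nu R) _ e'.
exists (maxn K1 K2).+1 => -[//|k]; rewrite ltnS geq_max => /andP[/K1P v1 /K2P v2] b x.
set s := Num.sqrt k.+1%:R in v1 v2 *.
have s0 : 0 < s by rewrite sqrtr_gt0.
have a0 : 0 < s^-1 by rewrite invr_gt0.
have bi (c : R) : bounded_measurable (\1_`]-oo, c] : R -> R).
  exact: bounded_measurable_indic.
pose g c y := logistic (kappa * (s^-1 * y - c)).
have cg c : gently_curved (kappa ^+ 3) s^-1 (g c) by exact: gently_curved_logistic.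
have bg c : bounded_measurable (g c) by have [] := cg c.
have close c : `|iter k.+1 T (g c) x - heat k.+1 (g c) x| <= e / 4.
  apply: le_trans (replace_all k.+1 x _ a0 (cg c) _) _.
  - by rewrite exprn_ge0// ltW.
  - by move=> y; exact/ltW/logistic_gt0.
  rewrite exprVn sqr_sqrtr//.
  have -> : k.+1%:R * (kappa ^+ 3 / k.+1%:R / 2 *
     (truncated_variance P X s^-1 + truncated_variance N01 id s^-1)) =
     kappa ^+ 3 / 2 * (truncated_variance P X s^-1 + truncated_variance N01 id s^-1).
    by field; rewrite nat1r pnatr_eq0.
  apply: (@le_trans _ _ (kappa ^+ 3 / 2 * (e / (4 * kappa ^+ 3) + e / (4 * kappa ^+ 3)))).
    by rewrite ler_wpM2l ?divr_ge0 ?exprn_ge0 ?(ltW kap0)// lerD.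
  by rewrite le_eqVlt; apply/orP; left; apply/eqP; field; rewrite gt_eqF.
have ind c y : (\1_`]-oo, c] y : R) = (y / s <= c / s)%R%:R.
  by rewrite indicE mem_setE in_itv /= ler_pM2r.
have up c y : (\1_`]-oo, c] y : R) <= g (c / s + e / 8) y + e / 4.
  rewrite ind /g; case: (leP (y / s) (c / s)) => ys; last first.
    by rewrite addr_ge0// ltW// logistic_gt0.
  have [+ _] := lg (y / s - c / s).
  rewrite (_ : y / s - c / s - e / 8 = s^-1 * y - (c / s + e / 8)); last by ring.
  have ys' : y / s - c / s <= 0 by rewrite subr_le0.
  by move=> /(_ ys') /=; lra.
have down c y : g (c / s - e / 8) y <= (\1_`]-oo, c] y : R) + e / 4.
  rewrite ind /g; case: (leP (y / s) (c / s)) => ys.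
    by have := logistic_lt1 (kappa * (s^-1 * y - (c / s - e / 8))) => /=; lra.
  have [_] := lg (y / s - c / s).
  rewrite (_ : y / s - c / s + e / 8 = s^-1 * y - (c / s - e / 8)); last by ring.
  have ys' : 0 < y / s - c / s by rewrite subr_gt0.
  by move=> /(_ ys') /=; lra.
have bc : bounded_measurable (fun=> e / 4 : R) by exact: bounded_measurable_cst.
have mk : measurable_fun setT (fun z : R => Num.sqrt k.+1%:R * z).
  exact: measurable_funM.
have iup c : iter k.+1 T \1_`]-oo, c] x <= iter k.+1 T (g (c / s + e / 8)) x + e / 4.
  rewrite -[X in _ <= _ + X](iter_average_cst P X k.+1 (e / 4) x) -iter_averageD//.
  by apply: le_iter_average => //; exact: bounded_measurableD.
have idown c : iter k.+1 T (g (c / s - e / 8)) x <= iter k.+1 T \1_`]-oo, c] x + e / 4.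
  rewrite -[X in _ <= _ + X](iter_average_cst P X k.+1 (e / 4) x) -iter_averageD//.
  by apply: le_iter_average => //; exact: bounded_measurableD.
have hup c : Phi ((c - x) / s) <= heat k.+1 (g (c / s + e / 8)) x + e / 4.
  rewrite -heat_indic// -[X in _ <= _ + X](average_cst N01 (fun z => Num.sqrt k.+1%:R * z) (e / 4) x).
  rewrite -averageD//; apply: le_average => //; exact: bounded_measurableD.
have hdown c : heat k.+1 (g (c / s - e / 8)) x <= Phi ((c - x) / s) + e / 4.
  rewrite -heat_indic// -[X in _ <= _ + X](average_cst N01 (fun z => Num.sqrt k.+1%:R * z) (e / 4) x).
  rewrite -averageD//; apply: le_average => //; exact: bounded_measurableD.
have se : 0 < s * e / 4 by rewrite divr_gt0// mulr_gt0.
have le1 : (b - x) / s <= (b + s * e / 4 - x) / s by rewrite ler_pM2r//; lra.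
have le2 : (b - s * e / 4 - x) / s <= (b - x) / s by rewrite ler_pM2r//; lra.
have /andP[_ P1] := Phi_lipschitz le1; have /andP[_ P2] := Phi_lipschitz le2.
have h1 := hdown (b + s * e / 4); have h2 := hup (b - s * e / 4).
rewrite (_ : (b + s * e / 4) / s - e / 8 = b / s + e / 8) in h1; last by field; rewrite gt_eqF.
rewrite (_ : (b - s * e / 4) / s + e / 8 = b / s - e / 8) in h2; last by field; rewrite gt_eqF.
rewrite (_ : (b + s * e / 4 - x) / s - (b - x) / s = e / 4) in P1; last by field; rewrite gt_eqF.
rewrite (_ : (b - x) / s - (b - s * e / 4 - x) / s = e / 4) in P2; last by field; rewrite gt_eqF.
have := close (b / s + e / 8); rewrite ler_norml => /andP[q1 q2].
have := close (b / s - e / 8); rewrite ler_norml => /andP[q3 q4].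
rewrite ler_norml.
by have := iup b; have := idown b; move=> u1 u2; apply/andP; split; lra.
Qed.

End clt.

(** * Gaussian masses of sets of the algebra generated by half-lines *)

Section ray_algebra.
Context (R : realType).
Local Notation N01 := (normal_prob (0 : R) 1).
Implicit Types (A : set R) (s : seq (R * R)).

(** A linear combination of a constant and of the values of [F] at the ends of
    half-lines: applied to the indicators of the half-lines it represents a
    function, and applied to their images under a linear operator it represents
    the image of this function. *)
Definition ray_sum (c : R) s (F : R -> R) : R := c + \sum_(t <- s) t.1 * F t.2.

Definition ray_step (z x : R) : R := (z <= x)%R%:R.

Definition ray_rep A c s := forall z, \1_A z = ray_sum c s (ray_step z).

(** The intersection of two half-lines is a half-line. *)
Lemma ray_sum_mul c s c' s' :
  exists c1 s1, forall z, ray_sum c s (ray_step z) * ray_sum c' s' (ray_step z) =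
  ray_sum c1 s1 (ray_step z).
Proof.
exists (c * c'), ([seq (c * t.1, t.2) | t <- s'] ++ [seq (c' * t.1, t.2) | t <- s] ++
  [seq (t.1 * t'.1, Num.min t.2 t'.2) | t <- s, t' <- s']) => z.
rewrite /ray_sum mulrDl !mulrDr -addrA; congr (_ + _).
rewrite !big_cat /= !big_map big_allpairs_dep /=; congr (_ + (_ + _)).
- by rewrite mulr_sumr; apply: eq_bigr => t _; rewrite mulrA.
- by rewrite mulrC mulr_sumr; apply: eq_bigr => t _; rewrite mulrA.
- rewrite mulr_suml; apply: eq_bigr => t _; rewrite mulr_sumr; apply: eq_bigr => t' _.
  by rewrite mulrACA /ray_step le_min -natrM mulnb.
Qed.

Lemma ray_algebra_rep A : ray_algebra A -> exists c s, ray_rep A c s.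
Proof.
suff : @ray_algebra R `<=` [set A | exists c s, ray_rep A c s] by exact.
apply: smallest_sub; last first.
  move=> _ [x _ <-]; exists 0, [:: (1, x)] => z.
  by rewrite /ray_sum big_seq1 add0r mul1r indicE mem_setE in_itv.
split.
- by exists 1, [::] => z; rewrite /ray_sum big_nil addr0 indicT.
- move=> B [c [s Bs]]; exists (1 - c), [seq (- t.1, t.2) | t <- s] => z.
  have -> : \1_(~` B) z = 1 - \1_B z :> R.
    by rewrite !indicE in_setC; case: (z \in B) => /=; ring.
  rewrite Bs /ray_sum big_map /= opprD addrA; congr (_ + _).
  by rewrite -sumrN; apply: eq_bigr => t _; rewrite mulNr.
- move=> B C [c [s Bs]] [c' [s' Cs]].
  have [c1 [s1 H]] := ray_sum_mul c s c' s'.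
  exists (c + c' - c1), (s ++ s' ++ [seq (- t.1, t.2) | t <- s1]) => z.
  have -> : \1_(B `|` C) z = \1_B z + \1_C z - \1_B z * \1_C z :> R.
    by rewrite !indicE in_setU; case: (z \in B); case: (z \in C) => /=; ring.
  rewrite Bs Cs (H z) /ray_sum !big_cat big_map /=.
  have -> : \sum_(j <- s1) - j.1 * ray_step z j.2 = - \sum_(j <- s1) j.1 * ray_step z j.2.
    by rewrite -sumrN; apply: eq_bigr => t _; rewrite mulNr.
  by ring.
Qed.

Lemma ray_algebra_measurable A : ray_algebra A -> measurable A.
Proof.
apply: smallest_sub; last by move=> _ [x _ <-]; exact: measurable_itv.
split.
- exact: measurableT.
- by move=> B; exact: measurableC.
- by move=> B C; exact: measurableU.
Qed.

(** Membership in [A] can only change at finitely many points, and half-lines are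
    closed on the right. *)
Lemma ray_rep_itv A c s z : ray_rep A c s -> A z ->
  exists2 r, 0 < r & forall y, z - r < y <= z -> A y.
Proof.
move=> As Az.
have [r r0 rs] : exists2 r, 0 < r & forall t, t \in s -> t.2 < z -> t.2 + r <= z.
  elim: (s) => [|t s' [r r0 IH]]; first by exists 1.
  have [tz|zt] := ltP t.2 z; last first.
    exists r => // t'; rewrite inE => /orP[/eqP ->|]; last exact: IH.
    by rewrite ltNge zt.
  exists (Num.min r (z - t.2)); first by rewrite lt_min r0 subr_gt0.
  move=> t'; rewrite inE => /orP[/eqP -> _|ts tz'].
    by rewrite addrC -lerBrDr ge_min lexx orbT.
  by apply: le_trans (IH _ ts tz'); rewrite lerD2l ge_min lexx.
exists r => // y /andP[ry yz].
have : \1_A y = \1_A z :> R.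
  rewrite !As /ray_sum; congr (_ + _); rewrite [LHS]big_seq_cond [RHS]big_seq_cond.
  apply: eq_bigr => t /andP[ts _]; congr (_ * _); rewrite /ray_step.
  have [zt|tz] := leP z t.2; first by rewrite (le_trans yz zt).
  by rewrite leNgt (_ : t.2 < y)//; have := rs t ts tz; lra.
rewrite !indicE (mem_set Az) /=; case: (boolP (y \in A)); first by rewrite inE.
by move=> _ /eqP; rewrite eq_sym oner_eq0.
Qed.

Lemma scale_shiftE A (sigma x : R) : 0 < sigma ->
  scale_set sigma^-1 (shift_set A x) = (fun z => x + sigma * z) @^-1` A.
Proof.
move=> s0; have sn0 : sigma != 0 by rewrite gt_eqF.
apply/seteqP; split => [_ [_ [y Ay <-] <-] /=|z /= Az].
  by rewrite mulVKf// addrC subrK.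
exists (sigma * z); last by rewrite mulKf.
by exists (x + sigma * z) => //; rewrite addrAC subrr add0r.
Qed.

(** The probability that [x] plus a centred Gaussian variable of standard
    deviation [sigma] falls in [A]. *)
Definition gauss_mass A (sigma x : R) : R :=
  fine (nu (scale_set sigma^-1 (shift_set A x))).

Lemma measurable_scale_shift A (sigma x : R) : 0 < sigma -> measurable A ->
  measurable (scale_set sigma^-1 (shift_set A x)).
Proof.
move=> s0 mA; rewrite scale_shiftE// -[X in measurable X]setTI.
have mf : measurable_fun setT (fun z : R => x + sigma * z).
  by apply: measurable_funD => //; exact: measurable_funM.
exact: mf.
Qed.

Lemma gauss_massK A (sigma x : R) : 0 < sigma -> measurable A ->
  ((gauss_mass A sigma x)%:E = nu (scale_set sigma^-1 (shift_set A x)))%E.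
Proof.
move=> s0 mA; rewrite /gauss_mass fineK//.
exact: (@fin_num_measure _ _ _ N01 _ (measurable_scale_shift x s0 mA)).
Qed.

Lemma gauss_massE A (sigma x : R) : 0 < sigma -> measurable A ->
  gauss_mass A sigma x = average N01 (fun z => sigma * z) \1_A x.
Proof.
move=> s0 mA; rewrite /gauss_mass /average /Rintegral; congr fine.
have mB := measurable_scale_shift x s0 mA.
have := @integral_indic _ _ _ N01 setT measurableT _ mB; rewrite setIT => E.
rewrite -[nu _]/(N01 _) -E scale_shiftE//; apply: eq_integral => z _.
Qed.

Lemma gauss_mass_ray (sigma x b : R) : 0 < sigma ->
  gauss_mass `]-oo, b] sigma x = Phi ((b - x) / sigma).
Proof.
move=> s0; rewrite /gauss_mass /Phi scale_shiftE//; congr (fine (N01 _)).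
by apply/seteqP; split => z /=; rewrite !in_itv /= ler_pdivlMr// lerBrDl mulrC.
Qed.

Lemma ray_rep_linear A c s (L : (R -> R) -> R) : ray_rep A c s ->
  (forall g h, bounded_measurable g -> bounded_measurable h ->
     L (fun y => g y + h y) = L g + L h) ->
  (forall a g, bounded_measurable g -> L (fun y => a * g y) = a * L g) ->
  (forall a, L (fun=> a) = a) ->
  L \1_A = ray_sum c s (fun x => L \1_`]-oo, x]).
Proof.
move=> As LD LZ Lc.
have bi (x : R) : bounded_measurable (\1_`]-oo, x] : R -> R).
  exact: bounded_measurable_indic.
have -> : \1_A = (fun y => c + \sum_(t <- s) t.1 * \1_`]-oo, t.2] y) :> (R -> R).
  apply/funext => y; rewrite As /ray_sum; congr (_ + _); apply: eq_bigr => t _.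
  by rewrite indicE mem_setE in_itv.
have [bs Ls] : bounded_measurable (fun y => \sum_(t <- s) t.1 * \1_`]-oo, t.2] y) /\
    L (fun y => \sum_(t <- s) t.1 * \1_`]-oo, t.2] y) =
    \sum_(t <- s) t.1 * L \1_`]-oo, t.2].
  elim: (s) => [|t s' [IH1 IH2]].
    under eq_fun do rewrite big_nil; rewrite big_nil; split; last exact: Lc.
    exact: bounded_measurable_cst.
  under eq_fun do rewrite big_cons.
  have bt : bounded_measurable (fun y => t.1 * \1_`]-oo, t.2] y : R).
    exact: bounded_measurableZ.
  split; first exact: bounded_measurableD.
  by rewrite LD// LZ// IH2 big_cons.
by rewrite LD// ?Lc ?Ls//; exact: bounded_measurable_cst.
Qed.

Let maffine (sigma : R) : measurable_fun setT (fun z : R => sigma * z).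
Proof. exact: measurable_funM. Qed.

Lemma gauss_mass_rep A c s (sigma x : R) : 0 < sigma -> measurable A ->
  ray_rep A c s ->
  gauss_mass A sigma x = ray_sum c s (fun b => Phi ((b - x) / sigma)).
Proof.
move=> s0 mA As; rewrite gauss_massE//.
rewrite (@ray_rep_linear A c s (fun g => average N01 (fun z => sigma * z) g x) As).
- rewrite /ray_sum; congr (_ + _); apply: eq_bigr => t _; congr (_ * _).
  by rewrite -gauss_mass_ray// gauss_massE//; exact: measurable_itv.
- by move=> g h bg bh; rewrite averageD//; exact: maffine.
- by move=> a g bg; rewrite averageZ//; exact: maffine.
- by move=> a; rewrite average_cst.
Qed.

Lemma Phi_lipschitz_norm (u v : R) : `|Phi u - Phi v| <= `|u - v|.
Proof.
wlog uv : u v / v <= u.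
  move=> H; have [|/ltW] := leP v u; first exact: H.
  by move=> uv; rewrite distrC [leRHS]distrC H.
have /andP[h1 h2] := Phi_lipschitz uv.
by rewrite !ger0_norm ?subr_ge0// lerBlDl.
Qed.

Lemma ray_sum_dist c s F G (e : R) : (forall t, t \in s -> `|F t.2 - G t.2| <= e) ->
  `|ray_sum c s F - ray_sum c s G| <= e * \sum_(t <- s) `|t.1|.
Proof.
move=> FG.
rewrite /ray_sum opprD addrACA subrr add0r -sumrB mulr_sumr.
apply: le_trans (ler_norm_sum _ _ _) _.
rewrite [leLHS]big_seq_cond [leRHS]big_seq_cond; apply: ler_sum => t /andP[ts _].
by rewrite -mulrBr normrM mulrC ler_wpM2r// FG.
Qed.

(** Locally Lipschitz in [(sigma^-1, x)], as is [Phi ((b - x) / sigma)] for each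
    end [b]. *)
Lemma gauss_mass_continuous A (sigma x e : R) : ray_algebra A -> 0 < sigma -> 0 < e ->
  exists2 delta, 0 < delta & forall sigma' x', 0 < sigma' ->
    `|sigma'^-1 - sigma^-1| <= delta -> `|x' - x| <= delta ->
    `|gauss_mass A sigma' x' - gauss_mass A sigma x| <= e.
Proof.
move=> Aalg s0 e0; have mA := ray_algebra_measurable Aalg.
have [c [s As]] := ray_algebra_rep Aalg.
pose S := \sum_(t <- s) `|t.1|.
have S0 : 0 <= S by exact: sumr_ge0.
pose B := \sum_(t <- s) `|t.2 - x| + 1 + sigma^-1.
have B0 : 0 < B.
  by rewrite ltr_wpDl ?invr_gt0// addr_ge0// sumr_ge0.
exists (Num.min 1 (e / ((S + 1) * B))).
  by rewrite lt_min ltr01 divr_gt0// mulr_gt0// ltr_wpDl.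
move=> sigma' x' s'0; set d := Num.min _ _ => ds dx.
have d0 : 0 <= d by exact: le_trans ds.
have d1 : d <= 1 by rewrite ge_min lexx.
rewrite !(gauss_mass_rep _ _ mA As)//.
apply: le_trans (@ray_sum_dist c s _ _ (d * B) _) _; last first.
  rewrite -/S; apply: (@le_trans _ _ (d * B * (S + 1))).
    by rewrite ler_wpM2l ?lerDl// mulr_ge0// ltW.
  have SB : 0 < (S + 1) * B by rewrite mulr_gt0// ltr_wpDl.
  rewrite -mulrA [B * _]mulrC -ler_pdivlMr//.
  by rewrite ge_min lexx orbT.
move=> t ts; apply: le_trans (Phi_lipschitz_norm _ _) _.
have -> : (t.2 - x') / sigma' - (t.2 - x) / sigma =
  (t.2 - x) * (sigma'^-1 - sigma^-1) - (x' - x) * (sigma'^-1 - sigma^-1)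
  - (x' - x) * sigma^-1 by ring.
have tS : `|t.2 - x| <= \sum_(t <- s) `|t.2 - x|.
  elim: (s) ts => // t' s' IH; rewrite inE big_cons => /orP[/eqP <-|/IH h].
    by rewrite lerDl sumr_ge0.
  by apply: le_trans h _; rewrite lerDr.
apply: le_trans (ler_normB _ _) _; rewrite normrM (gtr0_norm (_ : 0 < sigma^-1)) ?invr_gt0//.
have h1 : `|(t.2 - x) * (sigma'^-1 - sigma^-1) - (x' - x) * (sigma'^-1 - sigma^-1)| <=
    (\sum_(t <- s) `|t.2 - x|) * d + 1 * d.
  apply: le_trans (ler_normB _ _) _; rewrite !normrM; apply: lerD.
    by rewrite ler_pM.
  by rewrite ler_pM// (le_trans dx).
have h2 : `|x' - x| * sigma^-1 <= d * sigma^-1.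
  by rewrite ler_wpM2r// invr_ge0 ltW.
have -> : d * B = (\sum_(t <- s) `|t.2 - x|) * d + 1 * d + d * sigma^-1.
  by rewrite /B; ring.
exact: lerD.
Qed.

Lemma gauss_mass_itv_ge A x (sigma r : R) : 0 < sigma -> measurable A ->
  (forall y, x - r < y <= x + r -> A y) ->
  Phi (r / sigma) - Phi (- (r / sigma)) <= gauss_mass A sigma x.
Proof.
move=> s0 mA rA; rewrite gauss_massE//.
have bi (b : R) : bounded_measurable (\1_`]-oo, b] : R -> R).
  exact: bounded_measurable_indic.
have PhiE b : Phi ((b - x) / sigma) = average N01 (fun z => sigma * z) \1_`]-oo, b] x.
  by rewrite -gauss_mass_ray// gauss_massE//; exact: measurable_itv.
have -> : r / sigma = (x + r - x) / sigma by congr (_ / _); ring.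
have -> : - ((x + r - x) / sigma) = (x - r - x) / sigma by ring.
rewrite !PhiE lerBlDr -averageD//; last 2 first.
- exact: maffine.
- exact: bounded_measurable_indic.
apply: le_average => //; first exact: maffine.
- by apply: bounded_measurableD => //; exact: bounded_measurable_indic.
move=> y; rewrite !indicE !mem_setE !in_itv /=.
have [yr|] := leP y (x + r); last by rewrite addr_ge0// ler0n.
have [yr'|yr'] := leP y (x - r); first by rewrite lerDr ler0n.
by rewrite addr0 mem_set//; apply: rA; rewrite yr yr'.
Qed.

Lemma Phi_tails (e : R) : 0 < e -> exists2 t, 0 < t & 1 - e <= Phi t - Phi (- t).
Proof.
move=> e0; pose idR : measurableTypeR R -> R := fun x => x.
have midR : measurable_fun setT idR by exact: measurable_id.
pose I : {RV N01 >-> R} := HB.pack idR (isMeasurableFun.Build _ _ _ _ idR midR).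
have e2 : 0 < e / 2 by rewrite divr_gt0.
have PhiE : Phi (R := R) = fine \o cdf I by [].
have cy : Phi t @[t --> +oo] --> (1 : R).
  by rewrite PhiE; exact/fine_cvg/cvg_cdfy1.
have cNy : Phi t @[t --> -oo] --> (0 : R).
  by rewrite PhiE; exact/fine_cvg/cvg_cdfNy0.
move/cvgrPdist_le : cy => /(_ _ e2) [M1 [_ M1P]].
move/cvgrPdist_le : cNy => /(_ _ e2) [M2 [_ M2P]].
pose t := Num.max 1 (Num.max (M1 + 1) (- (M2 - 1))).
exists t; first by rewrite lt_max ltr01.
have q1 : `|1 - Phi t| <= e / 2.
  by apply: M1P; rewrite /t !lt_max ltrDl ltr01 orbT.
have q2 : `|0 - Phi (- t)| <= e / 2.
  by apply: M2P; rewrite ltrNl /t !lt_max ltrN2 gtrBl ltr01 !orbT.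
move: q1 q2; rewrite !ler_norml => /andP[_ q1] /andP[q2 _].
lra.
Qed.

End ray_algebra.

(** * The central limit theorem on the algebra *)

Section clt_algebra.
Context d (Omega : measurableType d) (R : realType) (P : probability Omega R).
Variable X : Omega -> R.
Hypothesis mX : measurable_fun setT X.
Hypothesis symX : forall h x, bounded_measurable h ->
  average P X h x = average P (fun w => - X w) h x.
Hypothesis varX : (\int[P]_w (X w ^+ 2)%:E = 1)%E.
Local Notation T := (average P X).

Lemma scale_setE (A : set R) (c : R) : 0 < c ->
  scale_set c A = (fun z => z / c) @^-1` A.
Proof.
move=> c0; have cn0 : c != 0 by rewrite gt_eqF.
apply/seteqP; split => [_ [y Ay <-] /=|z /= Az].
  by rewrite mulrC mulKf.
by exists (z / c) => //; rewrite mulrC divfK.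
Qed.

Lemma measurable_scale_set (A : set R) (c : R) : 0 < c -> measurable A ->
  measurable (scale_set c A).
Proof.
move=> c0 mA; rewrite scale_setE// -[X in measurable X]setTI.
have mf : measurable_fun setT (fun z : R => z / c) by exact: measurable_funM.
exact: mf.
Qed.

(** The threshold [K] depends on the coefficients of [A] only, not on [n]:
    blowing [A] up moves the ends of its half-lines, and [clt_iter_average] is
    uniform in them. *)
Theorem clt_ray_algebra (A : set R) (e : R) : ray_algebra A -> 0 < e ->
  exists K : nat, forall k n x, (K <= k)%N -> (0 < k)%N -> (0 < n)%N ->
  `|iter k T \1_(scale_set (Num.sqrt n%:R) A) x -
    gauss_mass A (Num.sqrt k%:R / Num.sqrt n%:R) (x / Num.sqrt n%:R)| <= e.
Proof.
move=> Aalg e0; have mA := ray_algebra_measurable Aalg.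
have [c [s As]] := ray_algebra_rep Aalg.
pose S := \sum_(t <- s) `|t.1|.
have S0 : 0 <= S by exact: sumr_ge0.
have eS : 0 < e / (S + 1) by rewrite divr_gt0// ltr_wpDl.
have [K KP] := clt_iter_average mX symX varX eS.
exists K => k n x Kk k0 n0.
have sk : 0 < Num.sqrt k%:R :> R by rewrite sqrtr_gt0 ltr0n.
have sn : 0 < Num.sqrt n%:R :> R by rewrite sqrtr_gt0 ltr0n.
set rn := Num.sqrt n%:R in sn *; set rk := Num.sqrt k%:R in sk *.
have Ans : ray_rep (scale_set rn A) c [seq (t.1, rn * t.2) | t <- s].
  move=> z; rewrite scale_setE//.
  have -> : \1_((fun z => z / rn) @^-1` A) z = \1_A (z / rn) :> R by [].
  rewrite As /ray_sum big_map; congr (_ + _); apply: eq_bigr => t _; congr (_ * _).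
  by rewrite /ray_step /= ler_pdivrMr// mulrC.
rewrite (@ray_rep_linear _ _ _ _ (fun g => iter k T g x) Ans).
- rewrite (gauss_mass_rep _ _ mA As) ?divr_gt0//.
  have -> : ray_sum c s (fun b => Phi ((b - x / rn) / (rk / rn))) =
    ray_sum c [seq (t.1, rn * t.2) | t <- s] (fun b => Phi ((b - x) / rk)).
    rewrite /ray_sum big_map; congr (_ + _); apply: eq_bigr => t _; congr (_ * Phi _).
    by rewrite /=; field; rewrite !gt_eqF.
  apply: le_trans (@ray_sum_dist _ _ _ _ _ (e / (S + 1)) _) _.
    by move=> t _; exact: KP.
  rewrite big_map /= -/S mulrAC ler_pdivrMr ?ltr_wpDl//.
  by rewrite ler_wpM2l ?lerDl// ltW.
- by move=> g h bg bh; rewrite iter_averageD.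
- by move=> a g bg; rewrite iter_averageZ.
- by move=> a; rewrite iter_average_cst.
Qed.

End clt_algebra.

(** * The offspring generating function *)

Section offspring.
Context (R : realType) (pk : nat -> R).
Hypothesis pk_ge0 : forall k, 0 <= pk k.
Hypothesis pk_sum : (\sum_(0 <= k <oo) (pk k)%:E = 1)%E.
Hypothesis pk0 : pk 0%N = 0.
Hypothesis pk1_lt1 : pk 1%N < 1.

Let serD (f g : nat -> R) : (forall k, 0 <= f k) -> (forall k, 0 <= g k) ->
  (\sum_(0 <= k <oo) (f k + g k)%:E =
   \sum_(0 <= k <oo) (f k)%:E + \sum_(0 <= k <oo) (g k)%:E)%E.
Proof.
move=> f0 g0; rewrite -nneseriesD//; last 2 first.
- by move=> k _ _; rewrite lee_fin.
- by move=> k _ _; rewrite lee_fin.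
Qed.

Let serZ c (f : nat -> R) : (forall k, 0 <= f k) ->
  (\sum_(0 <= k <oo) (c * f k)%:E = c%:E * \sum_(0 <= k <oo) (f k)%:E)%E.
Proof. by move=> f0; rewrite -nneseriesZl// => k _; rewrite lee_fin. Qed.

(** [s ^+ k <= s ^+ 2] for [k >= 2]: as far as an upper bound is concerned, all
    individuals have one or two children. *)
Lemma pgf_quadratic (s : R) : 0 <= s <= 1 ->
  (\sum_(0 <= k <oo) (pk k * s ^+ k)%:E <= (s * (pk 1%N + (1 - pk 1%N) * s))%:E)%E.
Proof.
move=> /andP[s0 s1].
have t1 k : 0 <= (1%N == k)%:R * (pk 1%N * (s - s ^+ 2)).
  by rewrite mulr_ge0 ?ler0n// mulr_ge0// subr_ge0 expr2 ler_piMl.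
have t2 k : 0 <= s ^+ 2 * pk k by rewrite mulr_ge0 ?sqr_ge0.
apply: (@le_trans _ _ (\sum_(0 <= k <oo)
    ((1%N == k)%:R * (pk 1%N * (s - s ^+ 2)) + s ^+ 2 * pk k)%:E)%E).
  apply: lee_nneseries => [k _ _|k _]; first by rewrite lee_fin mulr_ge0// exprn_ge0.
  rewrite lee_fin; case: k => [|[|k]].
  - by rewrite pk0 mul0r addr_ge0 // mulr0.
  - by rewrite mul1r expr1 le_eqVlt; apply/orP; left; apply/eqP; ring.
  - rewrite mul0r add0r mulrC ler_wpM2r//.
    by rewrite -addn2 exprD ler_piMl ?sqr_ge0// exprn_ile1.
rewrite serD// serZ// pk_sum mule1 eseries_pick -EFinD lee_fin.
by rewrite le_eqVlt; apply/orP; left; apply/eqP; ring.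
Qed.

Lemma expR_quadratic (x : R) : expR x <= 1 + x + x ^+ 2 * expR `|x|.
Proof.
have mv (a b : R) := @mean_value R expR expR a b (@is_derive_expR R).
have step (y : R) : 0 < y -> exists2 c, 0 < c < y & expR y = 1 + y * expR c.
  move=> /mv[c cy]; rewrite expR0 subr0 => E; exists c => //.
  by rewrite mulrC -E addrC subrK.
have [x0|x0|->] := ltgtP x 0; last first.
- by rewrite normr0 expR0 expr0n /= mul0r !addr0.
- have [c /andP[c0 cx] ->] := step x x0.
  have [c' /andP[c'0 c'c] ->] := step c c0.
  have e0 := expR_gt0 c'.
  have ex : expR c' <= expR x by rewrite ler_expR; lra.
  rewrite gtr0_norm// mulrDr mulr1 addrA lerD2l expr2 -mulrA ler_wpM2l ?(ltW x0)//.
  by rewrite ler_pM// ?ltW.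
- have /mv[c /andP[xc c0]] := x0; rewrite expR0 sub0r => E1.
  have /mv[c' /andP[cc' c'0]] := c0; rewrite expR0 sub0r => E2.
  have e1 : expR c' <= 1 by rewrite -[leRHS]expR0 ler_expR ltW.
  have e2 : 1 <= expR `|x| by rewrite -[leLHS]expR0 ler_expR.
  have e3 := expR_gt0 c'.
  have e4 : expR c = 1 + c * expR c' by lra.
  have -> : expR x = 1 + x + x * c * expR c' by have := E1; rewrite e4; lra.
  rewrite lerD2l expr2; apply: ler_pM; [nra|exact: ltW|nra|exact: le_trans e2].
Qed.

Hypothesis pk_exp : exists2 theta : R, 0 < theta &
  (\sum_(0 <= k <oo) (pk k * expR (theta * k%:R))%:E < +oo)%E.

(** [mu] is the mean offspring number, larger than [1] since [pk 0 = 0] and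
    [pk 1 < 1]. The estimate follows from [expR_quadratic] summed against [pk];
    the exponential moment makes the second order term finite. *)
Lemma pgf_exp : exists mu C t0 : R, [/\ 1 < mu, 0 <= C, 0 < t0 &
  forall t, `|t| <= t0 ->
    (\sum_(0 <= k <oo) (pk k * expR t ^+ k)%:E <= (expR (mu * t + C * t ^+ 2))%:E)%E].
Proof.
have [theta th0 fin] := pk_exp.
pose t0 := theta / 2; have t00 : 0 < t0 by rewrite divr_gt0.
pose w k : R := k%:R ^+ 2 * expR (t0 * k%:R).
have w0 k : 0 <= w k by rewrite mulr_ge0 ?sqr_ge0 ?expR_ge0.
have kw (k : nat) : k%:R <= w k.
  rewrite /w; case: k => [|k]; first by rewrite expr0n mul0r.
  apply: (@le_trans _ _ (k.+1%:R ^+ 2)); first by rewrite expr2 ler_peMl// ler1n.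
  by rewrite ler_peMr ?sqr_ge0// -[leLHS]expR0 ler_expR mulr_ge0// ltW.
have finser (f : nat -> R) : (forall k, 0 <= f k) ->
    (\sum_(0 <= k <oo) (f k)%:E < +oo)%E ->
    exists2 v : R, 0 <= v & (\sum_(0 <= k <oo) (f k)%:E = v%:E)%E.
  move=> f0 foo; have s0 : (0 <= \sum_(0 <= k <oo) (f k)%:E)%E.
    by apply: nneseries_ge0 => k _ _; rewrite lee_fin.
  exists (fine (\sum_(0 <= k <oo) (f k)%:E)%E); first exact: fine_ge0.
  by rewrite fineK// ge0_fin_numE.
have [C C0 CE] : exists2 C : R, 0 <= C & (\sum_(0 <= k <oo) (pk k * w k)%:E = C%:E)%E.
  apply: finser => [k|]; first by rewrite mulr_ge0.
  apply: (@le_lt_trans _ _ (\sum_(0 <= k <oo) (16 / theta ^+ 2 * (pk k * expR (theta * k%:R)))%:E)%E).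
    apply: lee_nneseries => [k _ _|k _]; first by rewrite lee_fin mulr_ge0.
    rewrite lee_fin [leRHS]mulrCA ler_wpM2l// /w.
    have -> : theta * k%:R = t0 * k%:R + (theta * k%:R / 4 + theta * k%:R / 4).
      by rewrite /t0; field.
    (* The square of [k] is absorbed by [expR (theta * k / 2)], since
       [theta * k / 4 <= expR (theta * k / 4)]. *)
    rewrite 2!expRD; set E2 := expR (_ / 4).
    have E2k : theta * k%:R / 4 <= E2.
      by apply: le_trans (expR_ge1Dx _); rewrite lerDr.
    have -> : k%:R ^+ 2 = 16 / theta ^+ 2 * (theta * k%:R / 4) ^+ 2 :> R.
      by field; rewrite gt_eqF.
    set c16 := 16 / theta ^+ 2; rewrite -(mulrA c16).
    have c160 : 0 <= c16 by rewrite divr_ge0// sqr_ge0.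
    rewrite ler_wpM2l// mulrC ler_wpM2l ?expR_ge0//.
    by rewrite -expr2 lerXn2r// ?nnegrE ?expR_ge0// divr_ge0// mulr_ge0// ltW.
  rewrite serZ; last by move=> k; rewrite mulr_ge0// expR_ge0.
  by rewrite lte_mul_pinfty// lee_fin divr_ge0// sqr_ge0.
have [mu mu0 muE] : exists2 mu : R, 0 <= mu & (\sum_(0 <= k <oo) (pk k * k%:R)%:E = mu%:E)%E.
  apply: finser => [k|]; first by rewrite mulr_ge0.
  apply: (@le_lt_trans _ _ (\sum_(0 <= k <oo) (pk k * w k)%:E)%E); last by rewrite CE ltry.
  apply: lee_nneseries => [k _ _|k _]; first by rewrite lee_fin mulr_ge0.
  by rewrite lee_fin ler_wpM2l.
exists mu, C, t0; split => //.
- have : (2%:E <= mu%:E + (pk 1%N)%:E)%E.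
    rewrite -muE -(eseries_pick 1 (fun=> pk 1%N)) -serD//; last 2 first.
    + by move=> k; rewrite mulr_ge0.
    + by move=> k; rewrite mulr_ge0// ler0n.
    rewrite -[2%:E]mule1 -pk_sum -serZ//; apply: lee_nneseries => [k _ _|k _].
      by rewrite lee_fin mulr_ge0.
    rewrite lee_fin; case: k => [|[|k]].
    + by rewrite pk0 mulr0 mul0r add0r mulr_ge0.
    + by rewrite mulr1 mul1r; lra.
    + by rewrite mul0r addr0 mulrC ler_wpM2l// ler_nat.
  rewrite -EFinD lee_fin => mu2; rewrite -(ltrD2r (pk 1%N)) (lt_le_trans _ mu2)//.
  by rewrite -[2]/(1 + 1) ltrD2l.
move=> t tt0.
have key (k : nat) : expR t ^+ k <= 1 + t * k%:R + t ^+ 2 * w k.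
  rewrite -expRM_natr; apply: le_trans (expR_quadratic _) _; rewrite lerD2l.
  rewrite /w mulrA -exprMn ler_wpM2l ?sqr_ge0// ler_expR normrM.
  by rewrite [X in _ * X]ger0_norm// ler_wpM2r.
apply: (@le_trans _ _ (1 + mu * t + C * t ^+ 2)%:E); last first.
  by rewrite lee_fin -addrA; exact: expR_ge1Dx.
set F := (\sum_(0 <= k <oo) _)%E.
(* Series of terms of either sign are avoided by adding [`|t| * mu] on both
   sides. *)
have h : (F + (`|t| * mu)%:E <= (1 + (`|t| + t) * mu + C * t ^+ 2)%:E)%E.
  have g0 k : 0 <= `|t| * (pk k * k%:R) by rewrite !mulr_ge0.
  have at0 : 0 <= `|t| + t by have := ler_norm (- t); rewrite normrN; lra.
  have r0 k : 0 <= (`|t| + t) * (pk k * k%:R) by rewrite !mulr_ge0.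
  have q0 k : 0 <= t ^+ 2 * (pk k * w k) by rewrite mulr_ge0 ?sqr_ge0// mulr_ge0.
  have e0 k : 0 <= pk k * expR t ^+ k by rewrite mulr_ge0// exprn_ge0// expR_ge0.
  have pk0' k : 0 <= pk k * k%:R by rewrite mulr_ge0.
  have pw0 k : 0 <= pk k * w k by rewrite mulr_ge0.
  rewrite EFinM -muE -serZ// -serD//.
  apply: (@le_trans _ _ (\sum_(0 <= k <oo) (pk k + ((`|t| + t) * (pk k * k%:R) + t ^+ 2 * (pk k * w k)))%:E)%E).
    apply: lee_nneseries => [k _ _|k _]; first by rewrite lee_fin addr_ge0.
    have := ler_wpM2l (pk_ge0 k) (key k); rewrite lee_fin; lra.
  rewrite serD//; last by move=> k; rewrite addr_ge0.
  rewrite serD// !serZ// pk_sum muE CE -!EFinM -!EFinD lee_fin.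
  by rewrite le_eqVlt; apply/orP; left; apply/eqP; ring.
have : (F <= (1 + (`|t| + t) * mu + C * t ^+ 2)%:E - (`|t| * mu)%:E)%E by rewrite leeBrDr.
by move=> /le_trans; apply; rewrite -EFinB lee_fin; lra.
Qed.

End offspring.

(** * Exponential functions that decrease under branching *)

Section exponential_supersolution.
Context d (Omega : measurableType d) (R : realType) (Q : probability Omega R).
Variable xi : {RV Q >-> R}.
Local Notation T := (average Q xi).
Variables (mu C t0 : R).
Hypotheses (mu1 : 1 < mu) (C0 : 0 <= C).

(** A step applied to the exponential of a small multiple of [g] gives the
    exponential of the mean of [g], up to an error quadratic in [l]. *)
Lemma average_expR (g : R -> R) (l r x : R) : bounded_measurable g ->
  (forall y, `|g y| <= 1) -> 0 <= l <= 1 ->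
  (\int[Q]_w (expR (l * g (x + xi w) + r))%:E <=
   (expR (l * T g x + (expR 1 * l ^+ 2 + r)))%:E)%E.
Proof.
move=> bg g1 /andP[l0 l1].
have mxi : measurable_fun setT xi by [].
pose h y := expR r * (1 + expR 1 * l ^+ 2) + expR r * l * g y.
have bh : bounded_measurable h.
  by apply: bounded_measurableD; [exact: bounded_measurable_cst|exact: bounded_measurableZ].
have hle y : expR (l * g y + r) <= h y.
  rewrite expRD mulrC /h -!mulrA -mulrDr ler_wpM2l ?expR_ge0//.
  apply: le_trans (expR_quadratic _) _; rewrite addrAC lerD2r lerD2l.
  have gl : `|l * g y| <= 1 by rewrite normrM (ger0_norm l0) mulr_ile1.
  rewrite mulrC; apply: ler_pM; rewrite ?expR_ge0 ?sqr_ge0 ?ler_expR//.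
  rewrite exprMn ler_piMr ?sqr_ge0// -real_normK ?num_real// expr2.
  by rewrite mulr_ile1.
apply: (@le_trans _ _ (T h x)%:E).
  rewrite EFin_average//; apply: ge0_le_integral.
  - exact: measurableT.
  - by move=> w _; rewrite lee_fin expR_ge0.
  - apply/measurable_EFinP; apply: measurableT_comp => //.
    apply: measurable_funD => //; apply: measurable_funM => //.
    by apply: measurableT_comp; [have [] := bg|apply: measurable_funD].
  - apply/measurable_EFinP; apply: measurableT_comp; first by have [] := bh.
    by apply: measurable_funD.
  - by move=> w _; rewrite lee_fin.
rewrite lee_fin /h averageD//; last 2 first.
- exact: bounded_measurable_cst.
- exact: bounded_measurableZ.
rewrite average_cst averageZ//; set v := T g x.
have -> : l * v + (expR 1 * l ^+ 2 + r) = r + (l * v + expR 1 * l ^+ 2) by ring.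
rewrite expRD -mulrA -mulrDr ler_wpM2l ?expR_ge0//.
by apply: le_trans (expR_ge1Dx _); rewrite le_eqVlt; apply/orP; left; apply/eqP; ring.
Qed.

(** The solution [c] of [mu * (expR 1 + c) + 4 * C = c * mu ^+ 2]: with [l] the
    current exponent, the left side times [l ^+ 2] is what the errors of a step
    and of a branching make of [c * l ^+ 2], and the right side is
    [c * (mu * l) ^+ 2], the allowance for the next exponent. *)
Definition quadratic_cost : R := (expR 1 * mu + 4 * C) / (mu ^+ 2 - mu).
Local Notation c := quadratic_cost.

Let mumu : 0 < mu ^+ 2 - mu.
Proof. by move: mu1 => mu1'; nra. Qed.

Lemma quadratic_cost_ge0 : 0 <= c.
Proof.
rewrite divr_ge0 ?(ltW mumu)// addr_ge0// mulr_ge0 ?expR_ge0// ltW//.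
exact: lt_trans mu1.
Qed.

Lemma quadratic_costE : mu * (expR 1 + c) + 4 * C = c * mu ^+ 2.
Proof. by rewrite /c; field; rewrite gt_eqF. Qed.

Variables (lam : R) (k : nat) (b : R -> R).
Hypotheses (lam0 : 0 < lam) (lam_t0 : 2 * lam <= t0) (lam_c : (expR 1 + c) * lam <= 1).
Hypotheses (bb : bounded_measurable b) (b1 : forall x, `|b x| <= 1).

(** Branching multiplies exponents by [mu], so the exponent of the leaves, at
    height [0], has to be [mu ^+ k] times smaller than the exponent [lam] at
    height [k]. *)
Definition tilt (j : nat) : R := lam * mu ^+ j / mu ^+ k.

Definition vertex_bound (j : nat) (x : R) : R := expR (tilt j * iter j T b x + c * tilt j ^+ 2).

Definition step_bound (j : nat) (x : R) : R :=
  expR (tilt j * iter j.+1 T b x + (expR 1 * tilt j ^+ 2 + c * tilt j ^+ 2)).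

Let mu0 : 0 < mu. Proof. exact: lt_trans mu1. Qed.

Lemma tilt_gt0 j : 0 < tilt j.
Proof. by rewrite divr_gt0 ?mulr_gt0 ?exprn_gt0. Qed.

Lemma tilt_le j : (j <= k)%N -> tilt j <= lam.
Proof.
move=> jk; rewrite /tilt ler_pdivrMr ?exprn_gt0// ler_wpM2l ?(ltW lam0)//.
by rewrite ler_weXn2l// ltW.
Qed.

Lemma tilt_k : tilt k = lam.
Proof. by rewrite /tilt mulfK// expf_neq0// gt_eqF. Qed.

Let lam1 : lam <= 1.
Proof.
have := quadratic_cost_ge0; have e1 : 1 <= expR 1 :> R by rewrite -[leLHS]expR0 ler_expR.
by move: lam0 lam_c; nra.
Qed.

Lemma iter_le1 j x : `|iter j T b x| <= 1.
Proof.
elim: j x => [|j IH] x; first exact: b1.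
by apply: average_norm => //; have [] := bounded_measurable_iter Q (measurable_funPT xi) j bb.
Qed.

Lemma step_bound_ge j x : (j <= k)%N ->
  (\int[Q]_w (vertex_bound j (x + xi w))%:E <= (step_bound j x)%:E)%E.
Proof.
move=> jk; apply: average_expR.
- exact: bounded_measurable_iter.
- exact: iter_le1.
- by rewrite (ltW (tilt_gt0 j)) (le_trans (tilt_le jk)).
Qed.

Variable pk : nat -> R.
Hypothesis pgf_le : forall t, `|t| <= t0 ->
  (\sum_(0 <= k <oo) (pk k * expR t ^+ k)%:E <= (expR (mu * t + C * t ^+ 2))%:E)%E.

(** By [pgf_le], raising to the random number of children multiplies the exponent
    [t] by [mu] and adds at most [C * t ^+ 2 <= 4 * C * tilt j ^+ 2];
    [quadratic_cost] is chosen for this sum to fit. *)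
Lemma vertex_bound_ge j x : (j < k)%N ->
  (\sum_(0 <= i <oo) (pk i * step_bound j x ^+ i)%:E <= (vertex_bound j.+1 x)%:E)%E.
Proof.
move=> jk; rewrite /step_bound; set t := _ + _.
have l0 := tilt_gt0 j; have ll := tilt_le (ltnW jk).
have := iter_le1 j.+1 x; set g := iter j.+1 T b x in t * => g1.
have c0 := quadratic_cost_ge0; have e0 := expR_gt0 (1 : R).
have t2 : `|t| <= 2 * tilt j.
  have h1 : `|tilt j * g| <= tilt j by rewrite normrM (gtr0_norm l0) ler_piMr// ltW.
  have h2 : `|expR 1 * tilt j ^+ 2 + c * tilt j ^+ 2| <= tilt j.
    rewrite -mulrDl ger0_norm; last by rewrite mulr_ge0 ?sqr_ge0// addr_ge0// ltW.
    rewrite expr2 mulrA ler_piMl ?(ltW l0)// (le_trans _ lam_c)// ler_wpM2l//.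
    by rewrite addr_ge0// ltW.
  by apply: le_trans (ler_normD _ _) _; rewrite -[2]/(1 + 1) mulrDl mul1r lerD.
apply: le_trans (pgf_le _) _; first by rewrite (le_trans t2)// (le_trans _ lam_t0)// ler_pM2l.
rewrite lee_fin ler_expR /vertex_bound -/g.
have -> : tilt j.+1 = mu * tilt j by rewrite /tilt exprS; ring.
have tt : t ^+ 2 <= 4 * tilt j ^+ 2.
  have -> : 4 * tilt j ^+ 2 = (2 * tilt j) ^+ 2 by ring.
  by rewrite -[t ^+ 2]real_normK ?num_real// lerXn2r// nnegrE mulr_ge0// ltW.
have -> : c * (mu * tilt j) ^+ 2 = c * mu ^+ 2 * tilt j ^+ 2 by ring.
rewrite -quadratic_costE /t.
have := ler_wpM2l C0 tt; rewrite -/t => h; rewrite /t in h *.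
lra.
Qed.

Lemma measurable_vertex_bound j : measurable_fun setT (vertex_bound j).
Proof.
apply: measurableT_comp => //; apply: measurable_funD => //; apply: measurable_funM => //.
by have [] := bounded_measurable_iter Q (measurable_funPT xi) j bb.
Qed.

Lemma measurable_step_bound j : measurable_fun setT (step_bound j).
Proof.
apply: measurableT_comp => //; apply: measurable_funD => //; apply: measurable_funM => //.
by have [] := bounded_measurable_iter Q (measurable_funPT xi) j.+1 bb.
Qed.

End exponential_supersolution.

(** * Bounds for the sign of a level sum *)

Section brw_bounds.
Context d (Omega : measurableType d) (R : realType) (P : probability Omega R)
  d' (Omega' : measurableType d') (Q : probability Omega' R)
  (pk : nat -> R) (xi : {RV Q >-> R})
  (N : vertex -> {RV P >-> nat}) (X : vertex -> {RV P >-> R}).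
Hypothesis brw : branching_random_walk pk xi N X.
Hypothesis pk0 : pk 0%N = 0.
Hypothesis pk1_lt1 : pk 1%N < 1.
Hypothesis pk_exp : exists2 theta : R, 0 < theta &
  (\sum_(0 <= k <oo) (pk k * expR (theta * k%:R))%:E < +oo)%E.
Local Notation T := (average Q xi).
Local Notation lsum := (level_sum N X).
Local Notation adap := (adapted (label_events N X)).

Let pk_ge0 k : 0 <= pk k.
Proof. by rewrite -lee_fin -(brw_offspring_law brw [::]). Qed.

Let pk_sum : (\sum_(0 <= k <oo) (pk k)%:E = 1)%E.
Proof.
rewrite -(probability_setT P).
have -> : [set: Omega] = \bigcup_k (N [::] @^-1` [set k]).
  by apply/seteqP; split => // w _; exists (N [::] w).
rewrite measure_bigcup//=.
- rewrite [RHS](@eq_eseriesl _ _ xpredT); last by move=> k; exact: in_setT.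
  by apply: eq_eseriesr => k _; rewrite (brw_offspring_law brw).
- by move=> k _; rewrite -[X in measurable X]setTI; exact: measurable_funP.
- by move=> i j _ _ [w [/= <- <-]].
Qed.

(** The generating function of the offspring law that gives one child with
    probability [pk 1] and two otherwise. *)
Definition binary_pgf (s : R) : R := s * (pk 1%N + (1 - pk 1%N) * s).

Lemma binary_pgf_itv s : 0 <= s <= 1 -> 0 <= binary_pgf s <= 1.
Proof.
move=> /andP[s0 s1]; have p1 := pk_ge0 1; move: pk1_lt1 => p1'.
rewrite /binary_pgf; set p := pk 1%N in p1 p1' *.
have h0 : 0 <= p + (1 - p) * s by rewrite addr_ge0// mulr_ge0// subr_ge0 ltW.
have h1 : p + (1 - p) * s <= 1.
  have : (1 - p) * s <= (1 - p) * 1 by rewrite ler_wpM2l// subr_ge0 ltW.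
  by lra.
by rewrite mulr_ge0//= mulr_ile1.
Qed.

Lemma iter_binary_pgf_itv s i : 0 <= s <= 1 -> 0 <= iter i binary_pgf s <= 1.
Proof. by move=> s01; elim: i => //= i; exact: binary_pgf_itv. Qed.

(** [lam] is small enough for its linear gain [lam * eta] to be at least twice the
    quadratic cost, whence [s0 < 1]. *)
Lemma exponential_parameter (eta : R) : 0 < eta ->
  exists mu C t0 lam s0 : R, [/\ [/\ 1 < mu, 0 <= C, 0 < lam & 2 * lam <= t0],
   (expR 1 + quadratic_cost mu C) * lam <= 1,
   (forall t, `|t| <= t0 ->
     (\sum_(0 <= k <oo) (pk k * expR t ^+ k)%:E <= (expR (mu * t + C * t ^+ 2))%:E)%E),
   0 < s0 < 1 &
   forall v, v <= - eta -> expR (lam * v + quadratic_cost mu C * lam ^+ 2) <= s0].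
Proof.
move=> eta0.
have [mu [C [t0 [mu1 C0 t00 pgf]]]] := pgf_exp pk_ge0 pk_sum pk0 pk1_lt1 pk_exp.
have c0 := quadratic_cost_ge0 mu1 C0; set c := quadratic_cost mu C in c0 *.
have ec : 0 < expR 1 + c by rewrite ltr_pwDl// expR_gt0.
pose lam := Num.min (t0 / 2) (Num.min (expR 1 + c)^-1 (eta / (2 * c + 2))).
have c2 : 0 < 2 * c + 2 by rewrite ltr_wpDl// mulr_ge0.
have lam0 : 0 < lam by rewrite !lt_min divr_gt0// invr_gt0 ec divr_gt0.
have lam_eta : lam * (2 * c + 2) <= eta.
  by rewrite -ler_pdivlMr// /lam !ge_min lexx !orbT.
exists mu, C, t0, lam, (expR (- (lam * eta / 2))); split => //.
- by split => //; rewrite mulrC -ler_pdivlMr// ge_min lexx.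
- by rewrite mulrC -ler_pdivlMr// mul1r !ge_min lexx orbT.
- rewrite expR_gt0 /= -[ltRHS]expR0 ltr_expR oppr_lt0 divr_gt0// mulr_gt0//.
- move=> v veta; rewrite ler_expR.
  have h1 : lam * v <= - (lam * eta) by rewrite -mulrN ler_wpM2l// ltW.
  have h2 : c * lam <= eta / 2.
    rewrite ler_pdivlMr// (le_trans _ lam_eta)//.
    have -> : lam * (2 * c + 2) = c * lam * 2 + 2 * lam by ring.
    by rewrite lerDl mulr_ge0// ltW.
  have h3 : lam * (c * lam) <= lam * (eta / 2) by rewrite ler_wpM2l// ltW.
  have -> : - (lam * eta / 2) = - (lam * eta) + lam * (eta / 2) by field.
  by apply: lerD => //; rewrite expr2 mulrCA.
Qed.

(** The last [k] generations are averaged by [vertex_bound], which brings the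
    exponential moment down to [s0] from any position; the first [m] generations
    then act on this constant through the generating function. The Markov
    inequality concludes. The multiple [l0] does not change the sign of the level
    sum. *)
Lemma upper_tail (eta : R) : 0 < eta -> exists2 s0 : R, 0 < s0 < 1 &
  forall k m (b : R -> R), bounded_measurable b -> (forall x, `|b x| <= 1) ->
  (forall x, iter k T b x <= - eta) ->
  exists2 l0 : R, 0 < l0 &
  (P [set w | (0 <= lsum (fun x => l0 * b x) (m + k) [::] 0 w)%R] <=
   (iter m binary_pgf s0)%:E)%E.
Proof.
move=> eta0.
have [mu [C [t0 [lam [s0 [[mu1 C0 lam0 lt0] lc pgf s01 s0P]]]]]] := exponential_parameter eta0.
exists s0 => // k m b bb b1 kb.
pose l0 := tilt mu lam k 0; have l00 : 0 < l0 by exact: tilt_gt0.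
exists l0 => //.
have s0' : 0 <= s0 <= 1 by case/andP: s01 => h1 h2; rewrite !ltW.
pose U j x := if (j <= k)%N then vertex_bound xi mu C lam k b j x else iter (j - k) binary_pgf s0.
pose V j x := if (j < k)%N then step_bound xi mu C lam k b j x else iter (j - k) binary_pgf s0.
have mlb : measurable_fun setT (fun x => l0 * b x).
  by apply: measurable_funM => //; case: bb.
have Uk x : vertex_bound xi mu C lam k b k x <= s0.
  by rewrite /vertex_bound tilt_k//; exact: s0P.
have := @supersolution_bound _ _ _ P _ _ Q pk xi N X brw (m + k) (fun x => l0 * b x) U V mlb.
move=> /(_ _ _ _ _ _ _ _ (m + k)%N (leqnn _) [::] (cst 1) (cst 0)) H.
have {H} : (\int[P]_w (1 * expR (lsum (fun x => l0 * b x) (m + k) [::] 0 w))%:E <=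
   \int[P]_w (1 * U (m + k)%N 0)%:E)%E.
  apply: H => //.
  - move=> j; rewrite /U; case: leqP => _; last exact: measurable_cst.
    exact: measurable_vertex_bound.
  - move=> j; rewrite /V; case: ltnP => _; last exact: measurable_cst.
    exact: measurable_step_bound.
  - move=> j x; rewrite /U; case: leqP => _; first exact: expR_ge0.
    by have /andP[] := iter_binary_pgf_itv (j - k) s0'.
  - move=> j x; rewrite /V; case: ltnP => _; first exact: expR_ge0.
    by have /andP[] := iter_binary_pgf_itv (j - k) s0'.
  - move=> x; rewrite /U leq0n /vertex_bound ler_expR /= lerDl mulr_ge0 ?sqr_ge0//.
    exact: quadratic_cost_ge0.
  - move=> j x _; rewrite /U /V; case: (ltngtP j k) => jk.
    + by apply: step_bound_ge => //; exact: ltnW.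
    + rewrite integral_cst// [X in (_ * X)%E](@probability_setT _ _ _ Q) mule1//.
    + rewrite jk subnn /=; apply: (@le_trans _ _ (\int[Q]_w (cst s0%:E w))%E).
        apply: ge0_le_integral => //.
        * by move=> w _; rewrite lee_fin expR_ge0.
        * apply/measurable_EFinP; apply: measurableT_comp; last exact: measurable_funD.
          exact: measurable_vertex_bound.
        * by move=> w _; rewrite lee_fin.
      by rewrite integral_cst// [X in (_ * X)%E](@probability_setT _ _ _ Q) mule1.
  - move=> j x _; rewrite /U /V; case: (ltnP j k) => jk.
    + exact: (vertex_bound_ge xi mu1 C0 lam0 lt0 lc bb b1 pgf x jk).
    + by rewrite subSn//=; apply: pgf_quadratic => //; exact: iter_binary_pgf_itv.
  - exact: adapted_cst.
  - exact: adapted_cst.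
under eq_integral do rewrite mul1r.
rewrite [X in (_ <= X)%E -> _](_ : _ = (U (m + k)%N 0)%:E); last first.
  rewrite (eq_integral (cst (U (m + k)%N 0)%:E)); last by move=> w _; rewrite /cst mul1r.
  by rewrite integral_cst// [X in (_ * X)%E](@probability_setT _ _ _ P) mule1.
have UmE : U (m + k)%N 0 <= iter m binary_pgf s0.
  rewrite /U; case: leqP => [mk|_]; last by rewrite addnK.
  have -> : m = 0%N by apply/eqP; rewrite -leqn0 -(leq_add2r k).
  exact: Uk.
move=> h; apply: le_trans (le_trans h _); last by rewrite lee_fin.
set E := [set w | _].
have ml := measurable_root_level_sum N X (m + k) mlb.
have mE : measurable E.
  have mE' := measurable_fun_ler (@measurable_cst _ _ _ _ setT (0 : R)) ml.
  by rewrite -[E]setTI; exact: (mE' measurableT [set true]).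
rewrite -(setIT E) -integral_indic//; apply: ge0_le_integral => //.
- exact/measurable_EFinP/measurable_indic.
- apply/measurable_EFinP; apply: (measurableT_comp _ ml); exact: measurable_expR.
- move=> w _; rewrite lee_fin indicE; case: (boolP (w \in E)); last by rewrite expR_ge0.
  by rewrite inE /E /= => h0; rewrite -[leLHS]expR0 ler_expR.
Qed.

(** After [m] generations with a single child, an individual in [W] has a
    nonpositive level sum with probability at most [s0], by the exponential
    estimate for [- b]. *)
Lemma lower_tail (eta : R) : 0 < eta -> exists2 s0 : R, 0 < s0 < 1 &
  forall k m (b : R -> R) (W : set R), bounded_measurable b ->
  (forall x, `|b x| <= 1) -> measurable W ->
  (forall x, W x -> eta <= iter k T b x) ->
  exists2 l0 : R, 0 < l0 &
  ((pk 1%N ^+ m * (1 - s0) * iter m T \1_W 0)%:E <=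
   P [set w | (0 < lsum (fun x => l0 * b x) (m + k) [::] 0 w)%R])%E.
Proof.
move=> eta0.
have [mu [C [t0 [lam [s0 [[mu1 C0 lam0 lt0] lc pgf s01 s0P]]]]]] := exponential_parameter eta0.
exists s0 => // k m b W bb b1 mW kb.
have /andP[s0_gt0 s0_lt1] := s01.
pose l0 := tilt mu lam k 0; have l00 : 0 < l0 by exact: tilt_gt0.
exists l0 => //.
have mxi : measurable_fun setT xi by [].
have bW : bounded_measurable (\1_W : R -> R) by exact: bounded_measurable_indic.
have W0 i x : 0 <= iter i T \1_W x.
  rewrite -[leLHS](iter_average_cst Q xi i 0 x); apply: le_iter_average => //.
  exact: bounded_measurable_cst.
pose bn x := - b x.
have bbn : bounded_measurable bn.
  rewrite (_ : bn = fun x => -1 * b x); first exact: bounded_measurableZ.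
  by apply/funext => x; rewrite mulN1r.
have bn1 x : `|bn x| <= 1 by rewrite normrN.
have iterN x : iter k T bn x = - iter k T b x.
  rewrite -mulN1r -iter_averageZ//; congr (iter _ _ _ _).
  by apply/funext => y; rewrite mulN1r.
pose q i x := pk 1%N ^+ i * (1 - s0) * iter i T \1_W x.
pose V i x := pk 1%N ^+ i * (1 - s0) * iter i.+1 T \1_W x.
have c0 i : 0 <= pk 1%N ^+ i * (1 - s0).
  by rewrite mulr_ge0 ?exprn_ge0// subr_ge0 ltW.
have bq i : bounded_measurable (q i).
  by apply: bounded_measurableZ; exact: bounded_measurable_iter.
have bV i : bounded_measurable (V i).
  by apply: bounded_measurableZ; exact: bounded_measurable_iter.
have mlb : measurable_fun setT (fun x => l0 * b x).
  by apply: measurable_funM => //; case: bb.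
have mlbn : measurable_fun setT (fun x => l0 * bn x).
  by apply: measurable_funM => //; case: bbn.
have := @spine_bound _ _ _ P _ _ Q pk xi N X brw (fun x => l0 * b x) k q V mlb.
move=> /(_ _ _ _ _ _ _ _ m [::] (cst 1) (cst 0)) H.
have {H} : (\int[P]_w (1 * q m 0)%:E <= \int[P]_w
   (1 * (0 < lsum (fun x => l0 * b x) (m + k) [::] 0 w)%R%:R)%:E)%E.
  apply: H => //.
  - by move=> i; case: (bq i).
  - by move=> i; case: (bV i).
  - by move=> i x; rewrite mulr_ge0.
  - by move=> i x; rewrite mulr_ge0.
  - by move=> i x; rewrite -EFin_average// lee_fin averageZ//; exact: bounded_measurable_iter.
  - by move=> i x; rewrite /q /V exprS !mulrA.
  - move=> a Phi z aP az P01.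
    have P0 w : 0 <= Phi w by have /andP[] := P01 w.
    have mP := label_adapted_measurable aP; have mz := label_adapted_measurable az.
    pose Psi w := Phi w * \1_W (z w).
    have aPsi : adap (outside a) Psi.
      by apply: measurable_funM => //; apply: measurableT_comp => //; exact: measurable_indic.
    have mPsi := label_adapted_measurable aPsi.
    have W01 x : 0 <= (\1_W x : R) <= 1 by rewrite indicE ler0n lern1 leq_b1.
    have Psi01 w : 0 <= Psi w <= 1.
      have /andP[h1 h2] := P01 w; have /andP[h3 h4] := W01 (z w).
      by rewrite mulr_ge0//= mulr_ile1.
    have Psi0 w : 0 <= Psi w by have /andP[] := Psi01 w.
    have ml := measurable_level_sum k mlb az.
    have mln := measurable_level_sum k mlbn az.
    pose pos w : R := (0 < lsum (fun x => l0 * b x) k a (z w) w)%R%:R.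
    have mpos : measurable_fun setT pos.
      apply: (@measurableT_comp _ _ _ _ _ _ (fun b : bool => b%:R : R)) => //.
      exact: measurable_fun_ltr.
    pose ex w := expR (lsum (fun x => l0 * bn x) k a (z w) w).
    have mex : measurable_fun setT ex by exact: measurableT_comp.
    have key w : Psi w <= Psi w * pos w + Psi w * ex w.
      rewrite -mulrDr ler_peMr// /pos; case: ltP => h.
        by rewrite lerDl expR_ge0.
      rewrite add0r /ex (_ : (fun x => l0 * bn x) = (fun x => - (l0 * b x))); last first.
        by apply/funext => x; rewrite /bn mulrN.
      by rewrite level_sumN -[leLHS]expR0 ler_expR oppr_ge0.
    have H : (\int[P]_w (Psi w * ex w)%:E <=
              \int[P]_w (Psi w * vertex_bound xi mu C lam k bn k (z w))%:E)%E.
      have := @supersolution_bound _ _ _ P _ _ Q pk xi N X brw k (fun x => l0 * bn x)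
        (vertex_bound xi mu C lam k bn) (step_bound xi mu C lam k bn) mlbn.
      move=> /(_ _ _ _ _ _ _ _ k (leqnn _) a Psi z); apply => //.
      - by move=> j; exact: measurable_vertex_bound.
      - by move=> j; exact: measurable_step_bound.
      - by move=> j x; exact: expR_ge0.
      - by move=> j x; exact: expR_ge0.
      - move=> x; rewrite /vertex_bound ler_expR /= lerDl mulr_ge0 ?sqr_ge0//.
        exact: quadratic_cost_ge0.
      - move=> j x jk; apply: (step_bound_ge xi mu1 C0 lam0 lc bbn bn1 x); exact: ltnW.
      - by move=> j x jk; exact: (vertex_bound_ge xi mu1 C0 lam0 lt0 lc bbn bn1 pgf x jk).
    have Psi_fin : (\int[P]_w (Psi w)%:E \is a fin_num)%E.
      apply: integrable_fin_num => //; apply: (@bounded_integrable _ _ _ P _ 1) => // w.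
      by rewrite ger0_norm//; have /andP[] := Psi01 w.
    have H2 : (\int[P]_w (Psi w * vertex_bound xi mu C lam k bn k (z w))%:E <=
               s0%:E * \int[P]_w (Psi w)%:E)%E.
      rewrite -ge0_integralZl_EFin ?(ltW s0_gt0)//; last 2 first.
      - by move=> w _; rewrite lee_fin.
      - exact/measurable_EFinP.
      apply: ge0_le_integral => //.
      - by move=> w _; rewrite lee_fin mulr_ge0// expR_ge0.
      - apply/measurable_EFinP; apply: measurable_funM => //.
        by apply: measurableT_comp => //; exact: measurable_vertex_bound.
      - apply/measurable_EFinP; exact: measurable_funM.
      - move=> w _; rewrite lee_fin mulrC /Psi indicE.
        case: (boolP (z w \in W)) => zW; last by rewrite !(mulr0, mul0r).
        rewrite ler_wpM2r ?mulr1// /vertex_bound tilt_k//; apply: s0P.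
        by rewrite iterN lerN2; apply: kb; rewrite inE in zW.
    have mpp : measurable_fun setT (fun w => (Psi w * pos w)%:E).
      by apply/measurable_EFinP; exact: measurable_funM.
    have mpe : measurable_fun setT (fun w => (Psi w * ex w)%:E).
      by apply/measurable_EFinP; exact: measurable_funM.
    have pos0 w : 0 <= pos w by exact: ler0n.
    have H3 : (\int[P]_w (Psi w)%:E <=
        \int[P]_w (Psi w * pos w)%:E + s0%:E * \int[P]_w (Psi w)%:E)%E.
      apply: (@le_trans _ _ (\int[P]_w ((Psi w * pos w)%:E + (Psi w * ex w)%:E))%E).
        apply: ge0_le_integral => //.
        - by move=> w _; rewrite lee_fin.
        - exact/measurable_EFinP.
        - exact: emeasurable_funD.
        - by move=> w _; rewrite -EFinD lee_fin.
      rewrite ge0_integralD//; last 2 first.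
      - by move=> w _; rewrite lee_fin mulr_ge0.
      - by move=> w _; rewrite lee_fin mulr_ge0// expR_ge0.
      by rewrite leeD2l// (le_trans H).
    apply: (@le_trans _ _ ((1 - s0)%:E * \int[P]_w (Psi w)%:E)%E).
      rewrite -ge0_integralZl_EFin ?subr_ge0 ?(ltW s0_lt1)//; last 2 first.
      - by move=> w _; rewrite lee_fin.
      - exact/measurable_EFinP.
      rewrite le_eqVlt; apply/orP; left; apply/eqP; apply: eq_integral => w _.
      by rewrite /q expr0 mul1r -EFinM; congr EFin; rewrite /Psi /=; ring.
    apply: (@le_trans _ _ (\int[P]_w (Psi w * pos w)%:E)%E).
      rewrite EFinB muleBl ?fin_num_adde_defr// mul1e leeBlDr//.
      by rewrite fin_numM.
    apply: ge0_le_integral => //.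
    - by move=> w _; rewrite lee_fin mulr_ge0.
    - by apply/measurable_EFinP; exact: measurable_funM.
    - move=> w _; rewrite lee_fin ler_wpM2r// /Psi -[leRHS]mulr1 ler_wpM2l//.
  - exact: adapted_cst.
  - exact: adapted_cst.
  - by move=> w /=; rewrite ler01 lexx.
under eq_integral do rewrite mul1r.
under [X in (_ <= X)%E -> _]eq_integral do rewrite mul1r.
rewrite [X in (X <= _)%E -> _](_ : _ = (q m 0)%:E); last first.
  rewrite (eq_integral (cst (q m 0)%:E)); last by [].
  by rewrite integral_cst// [X in (_ * X)%E](@probability_setT _ _ _ P) mule1.
move=> h; apply: (le_trans h).
set E := [set w | _].
have ml := measurable_root_level_sum N X (m + k) mlb.
have mE : measurable E.
  have mE' := measurable_fun_ltr (@measurable_cst _ _ _ _ setT (0 : R)) ml.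
  by rewrite -[E]setTI; exact: (mE' measurableT [set true]).
rewrite -(setIT E) -integral_indic// le_eqVlt; apply/orP; left; apply/eqP.
apply: eq_integral => w _; rewrite indicE; congr ((nat_of_bool _)%:R)%:E.
by apply/idP/idP; rewrite inE.
Qed.

End brw_bounds.

(** * Symmetric steps, proportions and iterates of a generating function *)

Section step.
Context d (Omega : measurableType d) (R : realType) (Q : probability Omega R).
Variable xi : {RV Q >-> R}.

Lemma average_symmetric (h : R -> R) (x : R) : symmetric_rv xi -> bounded_measurable h ->
  average Q xi h x = average Q (fun w => - xi w) h x.
Proof.
move=> sym; have mNxi : measurable_fun setT (fun w => - xi w) by exact: measurableT_comp.
apply: average_eq_law => // f mf f0.
have push (X : Omega -> R) : measurable_fun setT X ->
    (\int[Q]_w f (X w) = \int[pushforward Q X]_z f z)%E.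
  by move=> mX; rewrite ge0_integral_pushforward// preimage_setT.
rewrite (push xi)// (push (fun w => - xi w))//.
by apply: eq_measure_integral => B mB _; exact: sym.
Qed.

End step.

Lemma le_level_sum (Omega : Type) (R : realType) (N : vertex -> Omega -> nat)
    (X : vertex -> Omega -> R) (b c : R -> R) j a x w : (forall y, b y <= c y) ->
  level_sum N X b j a x w <= level_sum N X c j a x w.
Proof.
move=> bc; elim: j a x => [|j IH] a x /=; first exact: bc.
by apply: ler_sum => i _; exact: IH.
Qed.

Section proportion.
Context (Omega : Type) (R : realType) (N : vertex -> Omega -> nat)
  (X : vertex -> Omega -> R) (n : nat) (B : set R) (w : Omega).
Local Notation ZB := (Zn N X n B w).
Local Notation ZT := (Zn N X n setT w).

Lemma Zn_ge0 : 0 <= ZB.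
Proof. by rewrite /Zn fsumr_ge0// => v _; rewrite indicE. Qed.

Lemma Zn_le_total : ZB <= ZT.
Proof. by rewrite !ZnE; apply: le_level_sum => y; rewrite indicT indicE lern1 leq_b1. Qed.

End proportion.

Section proportion_threshold.
Context (Omega : Type) (R : realType) (N : vertex -> Omega -> nat)
  (X : vertex -> Omega -> R) (n : nat) (B : set R) (w : Omega) (p : R).
Hypothesis p_gt0 : 0 < p.
Local Notation ZB := (Zn N X n B w).
Local Notation ZT := (Zn N X n setT w).

(** For a single [w] the total [ZT] may vanish; then [Zbar] is [0], below [p]. *)
Lemma Zbar_geE : (p <= Zbar N X n B w) = (0 <= ZB - p * ZT) && (0 < ZT).
Proof.
have := Zn_ge0 N X n setT w; rewrite /Zbar le_eqVlt => /predU1P[<-|T0].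
  by rewrite invr0 mulr0 ltxx andbF leNgt p_gt0.
by rewrite T0 andbT ler_pdivlMr// subr_ge0.
Qed.

Lemma Zbar_ge_of_gt : 0 < ZB - p * ZT -> p <= Zbar N X n B w.
Proof.
move=> h; rewrite Zbar_geE ltW//=.
have := Zn_ge0 N X n setT w; rewrite le_eqVlt => /predU1P[T0|//].
have := Zn_le_total N X n B w; move: h; rewrite -T0 subr_gt0 mulr0 => h.
by rewrite leNgt h.
Qed.

End proportion_threshold.

Section binary_pgf_iterates.
Context (R : realType) (pk : nat -> R).
Hypothesis pk1_gt0 : 0 < pk 1%N.
Hypothesis pk1_lt1 : pk 1%N < 1.

(** A first phase of geometric decrease, at some rate below [1], makes the iterates
    smaller than [q - pk 1]; from then on each iteration multiplies them by at
    most [q]. *)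
Lemma iter_binary_pgf_decay (s q : R) : 0 < s < 1 -> pk 1%N < q ->
  exists i0, forall m, iter m (binary_pgf pk) s <= q ^+ (m - i0).
Proof.
move=> /andP[s0 s1] pq; have p1 := pk1_lt1; have p0 := pk1_gt0.
set p := pk 1%N in p0 p1 pq *.
pose r := p + (1 - p) * s.
have r0 : 0 <= r by rewrite addr_ge0// ?ltW// mulr_gt0// subr_gt0.
have r1 : r < 1.
  rewrite /r -ltrBrDl -[ltRHS]mulr1 ltr_pM2l// subr_gt0//.
have geo i : 0 <= iter i (binary_pgf pk) s <= r ^+ i /\ iter i (binary_pgf pk) s <= s.
  elim: i => [|i [/andP[h1 h2] h3]] /=; first by rewrite expr0 lexx !ltW.
  set t := iter i _ _ in h1 h2 h3 *; rewrite /binary_pgf -/p.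
  have tr : p + (1 - p) * t <= r by rewrite lerD2l ler_wpM2l// subr_ge0 ltW.
  have t0 : 0 <= p + (1 - p) * t by rewrite addr_ge0 ?(ltW p0)// mulr_ge0// subr_ge0 ltW.
  split; last by rewrite (le_trans _ h3)// ler_piMr// (le_trans tr)// ltW.
  by rewrite mulr_ge0//= exprSr ler_pM.
have rc : r ^+ n @[n --> \oo] --> (0 : R) by apply: cvg_expr; rewrite ger0_norm.
have qp : 0 < q - p by rewrite subr_gt0.
move/cvgrPdist_le : rc => /(_ _ qp) [i0 _ i0P].
exists i0 => m; have [mi|/ltnW/subnKC <-] := leqP m i0.
  have [/andP[_ h] _] := geo m.
  by rewrite (_ : m - i0 = 0)%N ?expr0 ?(le_trans h) ?exprn_ile1// ?ltW//; apply/eqP.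
rewrite addKn; elim: (m - i0)%N => [|j IH].
  rewrite addn0 expr0; have [_ h] := geo i0; exact: le_trans h (ltW s1).
rewrite addnS /=; have [/andP[h1 h2] _] := geo (i0 + j)%N.
set t := iter _ _ _ in IH h1 h2 *; rewrite /binary_pgf -/p exprSr.
have tq : t <= q - p.
  apply: le_trans h2 _; have := i0P _ (leq_addr j i0).
  by rewrite /= sub0r normrN ger0_norm// exprn_ge0.
apply: ler_pM => //; first by rewrite addr_ge0 ?(ltW p0)// mulr_ge0// subr_ge0 ltW.
rewrite -lerBrDl (le_trans _ tq)// ler_piMl//.
by rewrite gerBl ltW.
Qed.

End binary_pgf_iterates.

(** * Fractions of the time and the rate function *)

Section floor_fraction.
Context (R : realType).

Lemma cvg_floor_fraction (y : R) : 0 <= y ->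
  (Num.trunc (y * n%:R))%:R / n%:R @[n --> \oo] --> y.
Proof.
move=> y0; apply/cvgrPdist_le => e e0.
near=> n.
have n0 : 0 < n%:R :> R by rewrite ltr0n; near: n; exists 1%N.
have /andP[h1 h2] := truncn_itv (mulr_ge0 y0 (ltW n0)).
have ne : e^-1 <= n%:R by near: n; exact: nbhs_infty_ger.
rewrite ger0_norm; last by rewrite subr_ge0 ler_pdivrMr.
rewrite lerBlDr addrC -lerBlDr ler_pdivlMr// mulrBl lerBlDr.
apply: le_trans (ltW h2) _; rewrite -addn1 natrD lerD2l.
by rewrite -ler_pdivrMl// mulr1.
Unshelve. all: by end_near.
Qed.

Lemma floor_fraction_le (y : R) n : 0 <= y -> (0 < n)%N ->
  (Num.trunc (y * n%:R))%:R / n%:R <= y.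
Proof.
move=> y0 n0; rewrite ler_pdivrMr ?ltr0n//.
by have /andP[] := truncn_itv (mulr_ge0 y0 (ler0n R n)).
Qed.

Lemma floor_le (y : R) n : 0 <= y < 1 -> (Num.trunc (y * n%:R) <= n)%N.
Proof.
move=> /andP[y0 y1]; rewrite -(@ler_nat R).
have /andP[h _] := truncn_itv (mulr_ge0 y0 (ler0n R n)).
by rewrite (le_trans h)// ler_piMl// ltW.
Qed.

Lemma near_sub_floor (y : R) : 0 <= y < 1 ->
  forall K : nat, \forall n \near \oo, (K <= n - Num.trunc (y * n%:R))%N.
Proof.
move=> y01 K; have /andP[y0 y1] := y01.
have y1' : 0 < 1 - y by rewrite subr_gt0.
near=> n.
have n0 : 0 < n%:R :> R by rewrite ltr0n; near: n; exists 1%N.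
have /andP[h _] := truncn_itv (mulr_ge0 y0 (ltW n0)).
have nK : K%:R / (1 - y) <= n%:R by near: n; exact: nbhs_infty_ger.
rewrite -(@ler_nat R) natrB ?floor_le//.
move: nK; rewrite ler_pdivrMr// => nK.
by apply: le_trans nK _; rewrite mulrBr mulr1 lerD2l lerN2 (mulrC n%:R).
Unshelve. all: by end_near.
Qed.

Lemma near_floor (y : R) : 0 < y ->
  forall K : nat, \forall n \near \oo, (K <= Num.trunc (y * n%:R))%N.
Proof.
move=> y0 K; near=> n.
have yn0 : 0 <= y * n%:R by rewrite mulr_ge0// ltW.
have /andP[_ h] := truncn_itv yn0.
have nK : K%:R / y <= n%:R by near: n; exact: nbhs_infty_ger.
by rewrite -ltnS -(@ltr_nat R) (le_lt_trans _ h)// mulrC -ler_pdivrMr.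
Unshelve. all: by end_near.
Qed.

Lemma sqrt_fraction m n : (m <= n)%N -> (0 < n)%N ->
  Num.sqrt (n - m)%N%:R / Num.sqrt n%:R = Num.sqrt (1 - m%:R / n%:R) :> R.
Proof.
move=> mn n0; have n0' : n%:R != 0 :> R by rewrite pnatr_eq0 -lt0n.
rewrite -sqrtrV ?ler0n// -sqrtrM ?ler0n// natrB// mulrBl divff//.
Qed.

End floor_fraction.

Section rate.
Context (R : realType).
Implicit Types (A : set R) (p : R).

(** The set of which [rateJ A p] is the infimum. *)
Definition scaled_up A p : set R := [set y | 0 <= y < 1 /\
    (p%:E <= ereal_sup
      [set nu (scale_set (Num.sqrt (1 - y))^-1 (shift_set A x))
         | x in [set: R]])%E].

Lemma scaled_up_lbound A p : has_lbound (scaled_up A p).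
Proof. by exists 0 => y [/andP[]]. Qed.

Lemma rateJ_itv A p : 0 <= rateJ A p <= 1.
Proof.
rewrite /rateJ -/(scaled_up A p).
have [->|/set0P E0] := eqVneq (scaled_up A p) set0; first by rewrite inf0 lexx ler01.
apply/andP; split; first by apply: lb_le_inf => // y [/andP[]].
have [y Ey] := E0; apply: le_trans (ge_inf (scaled_up_lbound A p) Ey) _.
by case: Ey => /andP[_ /ltW].
Qed.

Lemma gauss_mass_lt_rateJ A p y x : measurable A -> 0 <= y < rateJ A p ->
  gauss_mass A (Num.sqrt (1 - y)) x < p.
Proof.
move=> mA /andP[y0 yJ]; have /andP[_ J1] := rateJ_itv A p.
have y1 : y < 1 := lt_le_trans yJ J1.
have s0 : 0 < Num.sqrt (1 - y) by rewrite sqrtr_gt0 subr_gt0.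
rewrite ltNge; apply/negP => px; move: yJ; rewrite ltNge => /negP; apply.
apply: ge_inf (scaled_up_lbound A p) _ _; split; first by rewrite y0.
apply: le_trans (ereal_sup_ubound _); last by exists x.
by rewrite -gauss_massK.
Qed.

(** [A] contains an interval, on whose centre almost all the mass of a very narrow
    Gaussian law can be put. *)
Lemma scaled_up_neq0 A p : ray_algebra A -> A !=set0 -> p < 1 -> scaled_up A p !=set0.
Proof.
move=> Aalg [z Az] p1; have mA := ray_algebra_measurable Aalg.
have [c [s As]] := ray_algebra_rep Aalg.
have [r r0 rA] := ray_rep_itv As Az.
have p1' : 0 < 1 - p by rewrite subr_gt0.
have [t t0 tP] := Phi_tails p1'.
pose h := r / 2; have h0 : 0 < h by rewrite divr_gt0.
(* [h / t] makes the interval [t] standard deviations wide on either side, and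
   [sigma] has to be below [1] to be of the form [sqrt (1 - y)]. *)
pose sigma := Num.min (h / t) 2^-1.
have sg0 : 0 < sigma by rewrite lt_min divr_gt0//= invr_gt0.
have sg1 : sigma < 1 by rewrite gt_min invf_lt1// ltr1n orbT.
have s2 : sigma ^+ 2 < 1 by rewrite expr_lt1// ltW.
exists (1 - sigma ^+ 2); split; first by rewrite subr_ge0 ltW//= gtrBl exprn_gt0.
apply: le_trans (ereal_sup_ubound _); last by exists (z - h).
rewrite opprB addrCA subrr addr0 sqrtr_sqr gtr0_norm// -gauss_massK// lee_fin.
apply: le_trans (@gauss_mass_itv_ge _ A (z - h) sigma h sg0 mA _); last first.
  by move=> y /andP[y1 y2]; apply: rA; apply/andP; split; move: y1 y2; rewrite /h; lra.
have th : t <= h / sigma.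
  by rewrite ler_pdivlMr// mulrC -ler_pdivlMr// ge_min lexx.
have /andP[h1 _] := Phi_lipschitz th.
have nth : - (h / sigma) <= - t by rewrite lerN2.
have /andP[h2 _] := Phi_lipschitz nth.
by move: tP h1 h2; lra.
Qed.

Lemma ray_algebra_itv (a b : R) : ray_algebra `]a, b]%classic.
Proof.
move=> C [[CT CC CU] GC].
have Cr x : C `]-oo, x]%classic by apply: GC; exists x.
have -> : `]a, b]%classic = ~` (`]-oo, a]%classic `|` ~` `]-oo, b]%classic).
  rewrite setCU setCK; apply/seteqP; split => x /=; rewrite !in_itv /=.
    by move=> /andP[ax ->]; split => //; apply/negP; rewrite -ltNge.
  by move=> [/negP]; rewrite -ltNge => -> ->.
exact/CC/CU/CC.
Qed.

(** On [`]a, b]] the density is at least its value at [`|a| + `|b|]. *)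
Lemma nu_itv_gt0 (a b : R) : a < b -> (0 < nu `]a, b]%classic)%E.
Proof.
move=> ab; pose M := `|a| + `|b|; pose c := normal_pdf 0 1 M : R.
have pdfE z : normal_pdf 0 1 z = normal_peak 1 * expR (- (z ^+ 2) / 2) :> R.
  by rewrite normal_pdfE ?oner_eq0// /normal_fun subr0 expr1n.
have pk0 : 0 < normal_peak (1 : R) by rewrite normal_peak_gt0// oner_eq0.
have c0 : 0 < c by rewrite /c pdfE mulr_gt0// expR_gt0.
apply: (@lt_le_trans _ _ (c%:E * lebesgue_measure `]a, b]%classic)%E).
  by rewrite lebesgue_measure_itv /= lte_fin ab -EFinB -EFinM lte_fin mulr_gt0// subr_gt0.
rewrite /nu /normal_prob -integral_cst//; apply: ge0_le_integral => //.
- by move=> z _; rewrite lee_fin ltW.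
- by apply/measurable_EFinP; apply: measurable_funTS; exact: measurable_normal_pdf.
- move=> z; rewrite /= in_itv /= => /andP[az zb].
  rewrite lee_fin /c !pdfE ler_wpM2l ?(ltW pk0)// ler_expR ler_wpM2r// lerN2.
  rewrite -(real_normK (num_real z)) lerXn2r ?nnegrE// ?addr_ge0//.
  rewrite ler_norml; apply/andP; split.
    have : - a <= `|a| by rewrite -normrN ler_norm.
    by rewrite /M; have := normr_ge0 b; move: az; lra.
  by rewrite (le_trans zb)// (le_trans (ler_norm b))// lerDr.
Qed.

Lemma gauss_mass_itv_gt0 (a b sigma : R) : a < b -> 0 < sigma ->
  0 < gauss_mass `]a, b]%classic sigma 0.
Proof.
move=> ab s0; rewrite -lte_fin gauss_massK//.
rewrite scale_shiftE//.
have -> : (fun z => 0 + sigma * z) @^-1` `]a, b]%classic = `]a / sigma, b / sigma]%classic.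
  apply/seteqP; split => z /=; rewrite !in_itv /= add0r.
    by rewrite ltr_pdivrMr// ler_pdivlMr// mulrC.
  by rewrite ltr_pdivrMr// ler_pdivlMr// mulrC.
by apply: nu_itv_gt0; rewrite ltr_pM2r// invr_gt0.
Qed.

End rate.

(** * The large deviation bounds *)

Section large_deviations.
Context (R : realType) d (Omega : measurableType d) (P : probability Omega R)
  d' (Omega' : measurableType d') (Q : probability Omega' R)
  (pk : nat -> R) (xi : {RV Q >-> R})
  (N : vertex -> {RV P >-> nat}) (X : vertex -> {RV P >-> R}).
Hypothesis brw : branching_random_walk pk xi N X.
Hypothesis pk0 : pk 0%N = 0.
Hypothesis pk1_gt0 : 0 < pk 1%N.
Hypothesis pk1_lt1 : pk 1%N < 1.
Hypothesis pk_exp : exists2 theta : R, 0 < theta &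
  (\sum_(0 <= k <oo) (pk k * expR (theta * k%:R))%:E < +oo)%E.
Hypothesis xi_sym : symmetric_rv xi.
Hypothesis xi_var : (\int[Q]_w (xi w ^+ 2)%:E = 1)%E.
Variables (A : set R) (p : R).
Hypothesis A_alg : ray_algebra A.
Hypothesis p_gt0 : 0 < p.
Hypothesis p_lt1 : p < 1.
Hypothesis J_cont : {for p, continuous (rateJ A)}.
Hypothesis A_neq0 : A !=set0.
Hypothesis I_infty : rateI A p = +oo%E.
Local Notation T := (average Q xi).
Local Notation lsum := (level_sum N X).
Local Notation L := (ln (pk 1%N)).
Local Notation J := (rateJ A p).
Local Notation blowup n := (scale_set (Num.sqrt n%:R) A).
Local Notation prob n := (P [set w | (p <= Zbar N X n (blowup n) w)%R]).

Let mA : measurable A. Proof. exact: ray_algebra_measurable. Qed.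

Let mxi : measurable_fun setT xi. Proof. by []. Qed.

Let symX h x : bounded_measurable h -> average Q xi h x = average Q (fun w => - xi w) h x.
Proof. exact: average_symmetric. Qed.

Let L_lt0 : L < 0. Proof. by rewrite ln_lt0// pk1_gt0 pk1_lt1. Qed.

Let excess n x : R := \1_(blowup n) x - p.

Let bounded_excess n : (0 < n)%N -> bounded_measurable (excess n).
Proof.
move=> n0; apply: bounded_measurableD.
  by apply: bounded_measurable_indic; apply: measurable_scale_set => //; rewrite sqrtr_gt0 ltr0n.
exact: bounded_measurable_cst.
Qed.

Let excess_le1 n x : `|excess n x| <= 1.
Proof.
move: p_gt0 p_lt1 => p0 p1; rewrite /excess indicE ler_norml.
by case: (_ \in _) => /=; apply/andP; split; lra.
Qed.

Let iter_excess k n x : (0 < n)%N ->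
  iter k T (excess n) x = iter k T \1_(blowup n) x - p.
Proof.
move=> n0; rewrite -[in RHS](iter_average_cst Q xi k p x) -mulN1r -iter_averageZ//; last first.
  exact: bounded_measurable_cst.
rewrite -iter_averageD//; last 2 first.
- by apply: bounded_measurable_indic; apply: measurable_scale_set => //; rewrite sqrtr_gt0 ltr0n.
- by apply: bounded_measurableZ; exact: bounded_measurable_cst.
by congr (iter _ _ _ _); apply/funext => y; rewrite mulN1r.
Qed.

Let mlsum n l : (0 < n)%N -> measurable_fun setT (fun w => lsum (fun x => l * excess n x) n [::] 0 w).
Proof.
move=> n0; apply: measurable_root_level_sum; apply: measurable_funM => //.
by case: (bounded_excess n0).
Qed.

Let measurable_prob n : (0 < n)%N -> measurable [set w | (p <= Zbar N X n (blowup n) w)%R].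
Proof.
move=> n0.
have -> : [set w | (p <= Zbar N X n (blowup n) w)%R] =
    [set w | (0 <= lsum (fun x => 1 * excess n x) n [::] 0 w)%R] `&`
    [set w | (0 < lsum \1_setT n [::] 0 w)%R].
  apply/seteqP; split => w /=; rewrite Zbar_geE// level_sum_center mul1r -ZnE.
    by move=> /andP.
  by move=> [-> ->].
apply: measurableI.
- have := measurable_fun_ler (@measurable_cst _ _ _ _ setT (0 : R)) (mlsum 1 n0).
  by move=> /(_ measurableT [set true]) h; rewrite -[X in measurable X]setTI; exact: h.
- have m1 : measurable_fun setT (\1_setT : R -> R) by exact: measurable_indic.
  have := measurable_fun_ltr (@measurable_cst _ _ _ _ setT (0 : R)) (measurable_root_level_sum N X n m1).
  by move=> /(_ measurableT [set true]) h; rewrite -[X in measurable X]setTI; exact: h.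
Qed.

Let prob_le n l : (0 < n)%N -> 0 < l ->
  (prob n <= P [set w | (0 <= lsum (fun x => l * excess n x) n [::] 0 w)%R])%E.
Proof.
move=> n0 l0; apply: le_measure; rewrite ?inE.
- exact: measurable_prob.
- have := measurable_fun_ler (@measurable_cst _ _ _ _ setT (0 : R)) (mlsum l n0).
  by move=> /(_ measurableT [set true]) h; rewrite -[X in measurable X]setTI; exact: h.
move=> w /=; rewrite Zbar_geE// level_sum_center => /andP[h _].
by rewrite mulr_ge0// ltW.
Qed.

Let prob_ge n l : (0 < n)%N -> 0 < l ->
  (P [set w | (0 < lsum (fun x => l * excess n x) n [::] 0 w)%R] <= prob n)%E.
Proof.
move=> n0 l0; apply: le_measure; rewrite ?inE.
- have := measurable_fun_ltr (@measurable_cst _ _ _ _ setT (0 : R)) (mlsum l n0).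
  by move=> /(_ measurableT [set true]) h; rewrite -[X in measurable X]setTI; exact: h.
- exact: measurable_prob.
move=> w /=; rewrite level_sum_center pmulr_rgt0//; exact: Zbar_ge_of_gt.
Qed.

(** As [y < rateJ A p'] for some [p' < p], after [y * n] generations no starting
    point gives a Gaussian mass of [p'] or more, and the central limit theorem
    turns this into a negative mean excess, uniformly. *)
Let upper_decay (y : R) : 0 <= y < J -> exists2 s0 : R, 0 < s0 < 1 &
  \forall n \near \oo, (prob n <= (iter (Num.trunc (y * n%:R)) (binary_pgf pk) s0)%:E)%E.
Proof.
move=> /andP[y0 yJ].
have [p' p'p yJ'] : exists2 p', p' < p & y < rateJ A p'.
  have Jy : 0 < J - y by rewrite subr_gt0.
  have := J_cont; rewrite /prop_for /continuous_at => /cvgrPdist_lt /(_ _ Jy).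
  move=> [r /= r0 rP]; exists (p - r / 2); first by rewrite gtrBl divr_gt0.
  have : ball_ Num.norm p r (p - r / 2).
    by rewrite /ball_ /= opprB addrC subrK ger0_norm ?divr_ge0 ?(ltW r0)// gtr_pMr// invf_lt1// ltr1n.
  by move=> /rP; rewrite ltr_norml => /andP[_]; lra.
pose eta := (p - p') / 2; have eta0 : 0 < eta by rewrite divr_gt0// subr_gt0.
have [s0 s01 tail] := upper_tail brw pk0 pk1_lt1 pk_exp eta0.
exists s0 => //.
have [K KP] := clt_ray_algebra mxi symX xi_var A_alg eta0.
have /andP[_ J1] := rateJ_itv A p.
have y1 : y < 1 := lt_le_trans yJ J1.
have y01 : 0 <= y < 1 by rewrite y0.
near=> n.
have n0 : (0 < n)%N by near: n; exists 1%N.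
pose m := Num.trunc (y * n%:R); pose k := (n - m)%N.
have mn : (m <= n)%N by exact: floor_le.
have kK : (maxn K 1 <= k)%N by rewrite /k /m; near: n; exact: (near_sub_floor y01 (maxn K 1)).
move: kK; rewrite geq_max => /andP[kK k0].
have kb x : iter k T (excess n) x <= - eta.
  rewrite iter_excess//; have := KP k n x kK k0 n0; rewrite sqrt_fraction//.
  set g := gauss_mass _ _ _.
  have gp : g < p'.
    apply: gauss_mass_lt_rateJ => //; rewrite divr_ge0//=.
    by apply: le_lt_trans yJ'; exact: floor_fraction_le.
  by rewrite ler_norml => /andP[_]; rewrite /eta; move: gp; lra.
have [l0 l00 tl] := tail k m (excess n) (bounded_excess n0) (@excess_le1 n) kb.
apply: le_trans (prob_le n0 l00) _.
by move: tl; rewrite subnKC.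
Unshelve. all: by end_near.
Qed.

Lemma prob_upper e : 0 < e -> \forall n \near \oo, (prob n <= (expR (n%:R * (L * J + e)))%:E)%E.
Proof.
move=> e0; have /andP[J0 J1] := rateJ_itv A p; move: L_lt0 => L0.
move: J0; rewrite le_eqVlt => /predU1P[<-|J0].
  near=> n; apply: (@le_trans _ _ 1%E).
    by apply: probability_le1; apply: measurable_prob; near: n; exists 1%N.
  by rewrite lee_fin -expR0 ler_expR mulr0 add0r mulr_ge0// ltW.
(* The exponential rate is slightly worse than [L] in the decay of the iterates,
   and the time slightly shorter than [J]; [e1] bounds both losses and keeps
   [L + e1] negative. *)
pose e1 := Num.min (- L / 2) (e / (2 * (1 - L))).
have L1 : 0 < 2 * (1 - L) by move: L0; lra.
have e10 : 0 < e1 by rewrite lt_min !divr_gt0// oppr_gt0.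
have e1L : L + e1 < 0.
  have : e1 <= - L / 2 by rewrite ge_min lexx.
  by move: L0; lra.
have e1e : e1 * (1 - L) <= e / 2.
  have : e1 <= e / (2 * (1 - L)) by rewrite ge_min lexx orbT.
  by rewrite ler_pdivlMr//; lra.
pose y := Num.max 0 (J - e1).
have y0 : 0 <= y by rewrite le_max lexx.
have yJ : y < J by rewrite gt_max J0 gtrBl.
have Jy : J - e1 <= y by rewrite le_max lexx orbT.
have [|s0 s01 dec] := @upper_decay y; first by rewrite y0.
have [|i0 i0P] := @iter_binary_pgf_decay _ _ pk1_gt0 pk1_lt1 s0 (expR (L + e1)) s01.
  by rewrite expRD lnK ?posrE// ltr_pMr// expR_gt1.
near=> n.
have n0 : (0 < n)%N by near: n; exists 1%N.
apply: (@le_trans _ _ (iter (Num.trunc (y * n%:R)) (binary_pgf pk) s0)%:E).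
  by near: n.
rewrite lee_fin; set m := Num.trunc _.
have yn0 : 0 <= y * n%:R by rewrite mulr_ge0.
have /andP[_] := truncn_itv yn0; rewrite -/m => mlt.
have nP : (1 + i0%:R) * (- (L + e1)) / (e / 2) <= n%:R by near: n; exact: nbhs_infty_ger.
have {}nP : (1 + i0%:R) * (- (L + e1)) <= n%:R * (e / 2) by rewrite -ler_pdivrMr// divr_gt0.
apply: le_trans (i0P m) _; rewrite -expRM_natl ler_expR.
have mi : y * n%:R - 1 - i0%:R <= (m - i0)%N%:R.
  have := leq_subLR m i0 (m - i0); rewrite leqnn => /esym; rewrite -(@ler_nat R) natrD.
  by move: mlt; rewrite -addn1 natrD; lra.
have h1 : (m - i0)%N%:R * (L + e1) <= (y * n%:R - 1 - i0%:R) * (L + e1).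
  by rewrite ler_wnM2r// ltW.
apply: le_trans h1 _.
have h2 : y * (L + e1) <= L * J + e / 2.
  apply: (@le_trans _ _ ((J - e1) * (L + e1))); first by rewrite ler_wnM2r// ltW.
  have : e1 * J <= e1 * 1 by rewrite ler_pM2l.
  have : 0 <= e1 * e1 by rewrite mulr_ge0// ltW.
  by move: e1e; lra.
have h3 : n%:R * (y * (L + e1)) <= n%:R * (L * J + e / 2) by rewrite ler_wpM2l.
by move: nP h3; lra.
Unshelve. all: by end_near.
Qed.

(** Continuity of [rateJ A] at [p] provides a time [y] close to [rateJ A p] and a
    place [x] that gives strictly more than [p]. This time is not [0], or [x]
    would be admissible in the infimum that defines [rateI A p]. *)
Let good_time e : 0 < e -> exists y x, [/\ 0 < y < 1, y < J + e &
  p < gauss_mass A (Num.sqrt (1 - y)) x].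
Proof.
move=> e0.
have [p' /andP[pp' p'1] Jp'] : exists2 p', p < p' < 1 & rateJ A p' < J + e / 2.
  have e2 : 0 < e / 2 by rewrite divr_gt0.
  have := J_cont; rewrite /prop_for /continuous_at => /cvgrPdist_lt /(_ _ e2).
  move=> [r /= r0 rP].
  (* The second bound keeps [p' = p + h] below [1], which [scaled_up_neq0]
     requires. *)
  pose h := Num.min (r / 2) ((1 - p) / 2).
  have h0 : 0 < h by rewrite lt_min !divr_gt0// subr_gt0.
  have hr : h < r.
    by rewrite /h gt_min; apply/orP; left; rewrite gtr_pMr// invf_lt1// ltr1n.
  have h1 : h <= (1 - p) / 2 by rewrite ge_min lexx orbT.
  exists (p + h); first by rewrite ltrDl h0 /=; move: p_lt1 => p1; lra.
  have : ball_ Num.norm p r (p + h) by rewrite /ball_ /= opprD addrA subrr sub0r normrN gtr0_norm.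
  by move=> /rP; rewrite ltr_norml => /andP[+ _]; lra.
have hi : has_inf (scaled_up A p').
  by split; [exact: scaled_up_neq0|exact: scaled_up_lbound].
have [|y [/andP[y0 y1] ysup] yJ] := @inf_adherent _ _ (e / 2) _ hi; first by rewrite divr_gt0.
have [_ [x _ <-] xp] : exists2 z, [set nu (scale_set (Num.sqrt (1 - y))^-1 (shift_set A x))
    | x in [set: R]] z & (p%:E < z)%E.
  by apply: ereal_sup_gt; apply: lt_le_trans ysup; rewrite lte_fin.
exists y, x.
have s0 : 0 < Num.sqrt (1 - y) by rewrite sqrtr_gt0 subr_gt0.
split; first 2 last.
- by rewrite -lte_fin gauss_massK.
- rewrite y1 andbT lt_neqAle y0 andbT; apply/eqP => yE.
  move: xp; rewrite -yE subr0 sqrtr1 invr1.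
  have -> : scale_set 1 (shift_set A x) = shift_set A x.
    by rewrite scale_setE//; apply/seteqP; split => z /=; rewrite divr1.
  move=> xp; have : (rateI A p <= `|x|%:E)%E.
    by apply: ereal_inf_lbound; exists x => //; exact: ltW.
  by rewrite I_infty.
- apply: lt_trans yJ _; rewrite -/(rateJ A p').
  by move: Jp'; rewrite /rateJ -/(scaled_up A p'); lra.
Qed.

(** After the [y * n] generations without branching, a place within
    [delta * sqrt n] of [x * sqrt n] is still good by continuity of the Gaussian
    mass. The line of descent reaches this window [W] with a probability that
    converges to a positive number, because [y] is positive. *)
Lemma prob_lower e : 0 < e -> \forall n \near \oo, ((expR (n%:R * (L * J - e)))%:E <= prob n)%E.
Proof.
move=> e0; move: L_lt0 => L0.
have L0' : 0 < - L by rewrite oppr_gt0.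
have e1 : 0 < e / 2 / (- L) by rewrite !divr_gt0.
have [y [x [/andP[y0 y1] yJ]]] := good_time e1.
set sigma := Num.sqrt (1 - y); set g := gauss_mass _ _ _ => pg.
have y01 : 0 <= y < 1 by rewrite ltW.
have s0 : 0 < sigma by rewrite sqrtr_gt0 subr_gt0.
have sy0 : 0 < Num.sqrt y by rewrite sqrtr_gt0.
pose eta := (g - p) / 2; have eta0 : 0 < eta by rewrite divr_gt0// subr_gt0.
have eta2 : 0 < eta / 2 by rewrite divr_gt0.
have [s /andP[s1 s2] tail] := lower_tail brw pk0 pk1_lt1 pk_exp eta0.
have [delta delta0 gcont] := gauss_mass_continuous x A_alg s0 eta2.
have [K1 K1P] := clt_ray_algebra mxi symX xi_var A_alg eta2.
pose W := `]x - delta, x + delta]%classic : set R.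
have W_alg : ray_algebra W by exact: ray_algebra_itv.
have mW : measurable W by exact: ray_algebra_measurable.
pose c := gauss_mass W (Num.sqrt y) 0.
have c0 : 0 < c.
  by apply: gauss_mass_itv_gt0 => //; rewrite ltrBlDr -addrA ltrDl addr_gt0.
have c4 : 0 < c / 4 by rewrite divr_gt0.
have [delta' delta'0 wcont] := gauss_mass_continuous 0 W_alg sy0 c4.
have [K2 K2P] := clt_ray_algebra mxi symX xi_var W_alg c4.
pose C := (1 - s) * (c / 2).
have C0 : 0 < C by rewrite mulr_gt0 ?divr_gt0// subr_gt0.
have cvgs1 : (Num.sqrt (1 - (Num.trunc (y * n%:R))%:R / n%:R))^-1 @[n --> \oo] --> sigma^-1.
  apply: cvgV; first by rewrite gt_eqF.
  apply: continuous_cvg; first exact: sqrt_continuous.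
  apply: cvgB; first exact: cvg_cst.
  by apply: cvg_floor_fraction; exact: ltW.
have cvgs2 : (Num.sqrt ((Num.trunc (y * n%:R))%:R / n%:R))^-1 @[n --> \oo] --> (Num.sqrt y)^-1.
  apply: cvgV; first by rewrite gt_eqF.
  apply: continuous_cvg; first exact: sqrt_continuous.
  by apply: cvg_floor_fraction; exact: ltW.
move/cvgrPdist_le : cvgs1 => /(_ _ delta0) cvgs1.
move/cvgrPdist_le : cvgs2 => /(_ _ delta'0) cvgs2.
near=> n.
have n0 : (0 < n)%N by near: n; exists 1%N.
have sn : 0 < Num.sqrt n%:R :> R by rewrite sqrtr_gt0 ltr0n.
pose m := Num.trunc (y * n%:R); pose k := (n - m)%N.
have mn : (m <= n)%N by exact: floor_le.
have kK : (maxn K1 1 <= k)%N by rewrite /k /m; near: n; exact: (near_sub_floor y01 (maxn K1 1)).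
have mK : (maxn K2 1 <= m)%N.
  rewrite /m; near: n; exact: (near_floor y0 (maxn K2 1)).
have d1 : `|sigma^-1 - (Num.sqrt (1 - m%:R / n%:R))^-1| <= delta by rewrite /m; near: n; exact: cvgs1.
have d2 : `|(Num.sqrt y)^-1 - (Num.sqrt (m%:R / n%:R))^-1| <= delta' by rewrite /m; near: n; exact: cvgs2.
have nC : - ln C / (e / 2) <= n%:R by near: n; exact: nbhs_infty_ger.
move: kK mK; rewrite !geq_max => /andP[kK k0] /andP[mK m0].
pose Wn := scale_set (Num.sqrt n%:R) W.
have mWn : measurable Wn by exact: measurable_scale_set.
have kb z : Wn z -> eta <= iter k T (excess n) z.
  rewrite /Wn scale_setE//= /W /= in_itv /= => /andP[z1 z2].
  rewrite iter_excess//; have := K1P k n z kK k0 n0; rewrite sqrt_fraction//.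
  have zx : `|z / Num.sqrt n%:R - x| <= delta.
    by rewrite ler_distl ltW//=.
  have q0 : 0 < Num.sqrt (1 - m%:R / n%:R) :> R.
    by rewrite -sqrt_fraction// divr_gt0// sqrtr_gt0 ltr0n.
  have := gcont _ _ q0; rewrite distrC => /(_ _ d1 zx).
  rewrite !ler_norml => /andP[h1 _] /andP[h2 _].
  by move: h1 h2; rewrite -/sigma -/g /eta; lra.
have [l0 l00 tl] := tail k m (excess n) Wn (bounded_excess n0) (@excess_le1 n) mWn kb.
apply: le_trans (prob_ge n0 l00).
move: tl; rewrite subnKC// => tl; apply: le_trans tl.
rewrite lee_fin.
have window : c / 2 <= iter m T \1_Wn 0.
  have := K2P m n 0 mK m0 n0; rewrite mul0r.
  have mE : Num.sqrt m%:R / Num.sqrt n%:R = Num.sqrt (m%:R / n%:R) :> R.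
    by rewrite -sqrtrV ?ler0n// -sqrtrM ?ler0n.
  have q0 : 0 < Num.sqrt (m%:R / n%:R) :> R.
    by rewrite -mE divr_gt0// sqrtr_gt0 ltr0n.
  have := wcont _ 0 q0; rewrite distrC subrr normr0 => /(_ d2 (ltW delta'0)).
  rewrite mE -/c -/Wn !ler_norml => /andP[h1 _] /andP[h2 _].
  by move: h1 h2; lra.
have pm : pk 1%N ^+ m = expR (m%:R * L) by rewrite expRM_natl lnK.
apply: (@le_trans _ _ (pk 1%N ^+ m * C)); last first.
  rewrite /C mulrA ler_wpM2l// mulr_ge0 ?exprn_ge0 ?(ltW pk1_gt0)//.
  by rewrite subr_ge0 ltW.
rewrite pm -[X in _ <= _ * X](lnK C0) -expRD ler_expR.
have yn0 : 0 <= y * n%:R by rewrite mulr_ge0// ltW.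
have /andP[my _] := truncn_itv yn0; rewrite -/m in my.
have h1 : (y * n%:R) * L <= m%:R * L by rewrite ler_wnM2r// ltW.
have h2 : - ln C <= n%:R * (e / 2) by rewrite -ler_pdivrMr// divr_gt0.
have h3 : n%:R * (L * J - e / 2) <= n%:R * (y * L).
  rewrite ler_wpM2l//.
  have := yJ; rewrite -ltrBlDl ltr_pdivlMr//; lra.
by move: h1 h2 h3; lra.
Unshelve. all: by end_near.
Qed.

End large_deviations.

(** * The limit *)

(** The bounds also show that [u n] is eventually positive and finite, so that its
    logarithm is a real number. *)
Lemma cvg_exponential_rate (R : realType) (u : nat -> \bar R) (l : R) :
  (forall e, 0 < e -> \forall n \near \oo, (u n <= (expR (n%:R * (l + e)))%:E)%E) ->
  (forall e, 0 < e -> \forall n \near \oo, ((expR (n%:R * (l - e)))%:E <= u n)%E) ->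
  ((n%:R^-1)%:E * lne (u n))%E @[n --> \oo] --> l%:E.
Proof.
move=> uu ul.
have bounds e : 0 < e -> \forall n \near \oo,
    exists2 r, ((n%:R^-1)%:E * lne (u n) = r%:E)%E & `|l - r| <= e.
  move=> e0; near=> n.
  have n0 : 0 < n%:R :> R by rewrite ltr0n; near: n; exists 1%N.
  have h1 : (u n <= (expR (n%:R * (l + e)))%:E)%E by near: n; exact: uu.
  have h2 : ((expR (n%:R * (l - e)))%:E <= u n)%E by near: n; exact: ul.
  case: (u n) h1 h2 => [r||]//; rewrite !lee_fin => h1 h2.
  have r0 : 0 < r by apply: lt_le_trans h2; exact: expR_gt0.
  rewrite lne_EFin// -EFinM; eexists; first by reflexivity.
  have {}h1 : ln r <= n%:R * (l + e) by rewrite -ler_expR lnK.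
  have {}h2 : n%:R * (l - e) <= ln r by rewrite -ler_expR lnK.
  rewrite ler_distlC mulrC ler_pdivlMr// ler_pdivrMr//.
  by rewrite ![_ * n%:R]mulrC h1 h2.
apply/fine_cvgP; split.
  by apply: filterS (bounds 1 ltr01) => n [r -> _].
apply/cvgrPdist_le => e e0.
by apply: filterS (bounds e e0) => n [r rE re]; rewrite /= rE.
Unshelve. all: by end_near.
Qed.

Theorem theorem1p2 (R : realType)
    (d : measure_display) (Omega : measurableType d) (P : probability Omega R)
    (d' : measure_display) (Omega' : measurableType d')
    (Q : probability Omega' R)
    (pk : nat -> R) (xi : {RV Q >-> R})
    (N : vertex -> {RV P >-> nat}) (X : vertex -> {RV P >-> R})
    (brw : branching_random_walk pk xi N X)
    (pk0 : pk 0%N = 0) (pk1_gt0 : 0 < pk 1%N) (pk1_lt1 : pk 1%N < 1)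
    (pk_exp : exists2 theta : R, 0 < theta &
      (\sum_(0 <= k <oo) (pk k * expR (theta * k%:R))%:E < +oo)%E)
    (xi_sym : symmetric_rv xi)
    (xi_var : ('E_Q[fun w => (xi w ^+ 2)%R] = 1)%E)
    (A : set R) (A_alg : ray_algebra A) (A_neq0 : A !=set0)
    (A_gt0 : (0 < nu A)%E)
    (p : R) (p_gt : (nu A < p%:E)%E) (p_lt1 : p < 1)
    (I_infty : rateI A p = +oo%E)
    (J_cont : {for p, continuous (rateJ A)}) :
  ((n%:R^-1)%:E *
     lne (P [set w | (p <= Zbar N X n (scale_set (Num.sqrt n%:R) A) w)%R]))%E
    @[n --> \oo] --> (ln (pk 1%N) * rateJ A p)%:E.
Proof.
have p_gt0 : 0 < p by rewrite -lte_fin (lt_trans A_gt0).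
have var : (\int[Q]_w (xi w ^+ 2)%:E = 1)%E by move: xi_var; rewrite unlock.
apply: cvg_exponential_rate => e e0.
- exact: (prob_upper brw pk0 pk1_gt0 pk1_lt1 pk_exp xi_sym var A_alg p_gt0 p_lt1 J_cont e0).
- exact: (prob_lower brw pk0 pk1_gt0 pk1_lt1 pk_exp xi_sym var A_alg p_gt0 p_lt1 J_cont
    A_neq0 I_infty e0).
Qed.
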